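(* Let $\nu_t$ denote the spectral distribution of the free positive multiplicative Brownian motion $h_t$ at time $t$. For every real $t>0$ and every $\alpha\in\mathbb{C}\setminus\{0\}$, $$\int_{(0,\infty)}x^{\alpha}\,d\nu_t(x)=e^{\alpha t/2}\,{}_1F_1(1-\alpha;2;-\alpha t)=e^{\alpha t/2}\,\frac{1}{\alpha}\sum_{j=0}^{\infty}\binom{\alpha}{1+j}\frac{(\alpha t)^j}{j!}.$$
   Context: Free positive multiplicative Brownian motion: on a filtered $W^*$-probability space $(\mathcal{A},(\mathcal{A}_t)_{t\ge 0},\tau)$ let $(c_t)_{t\ge0}$ be a circular Brownian motion, i.e. $c_t=\frac{1}{\sqrt2}(x_t+iy_t)$ where $(x_t)_{t\ge0}$ and $(y_t)_{t\ge0}$ are freely independent semicircular Brownian motions adapted to the filtration (starting at $0$, with increments over $[s,t]$ free from $\mathcal{A}_s$ and semicircular with mean $0$ and variance $t-s$); in particular $\tau(c_tc_t^* )=t$. The free (left-)multiplicative Brownian motion $(g_t)_{t\ge0}$ is the unique solution of the free stochastic differential equation $dg_t=g_t\,dc_t$, $g_0=\mathbf{1}$, i.e. $g_t=\mathbf{1}+\int_0^t g_s\,dc_s$ in the sense of free It\^o integration. The free positive multiplicative Brownian motion is $h_t:=g_{t/2}g_{t/2}^*$, and $\nu_t$ is its spectral distribution with respect to $\tau$: the compactly supported probability measure on $(0,\infty)$ with $\int x^n\,d\nu_t(x)=\tau(h_t^n)$ for all $n\in\mathbb{N}_0$. For $x>0$ and $\alpha\in\mathbb{C}$, $x^\alpha=e^{\alpha\log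 x}$. Kummer's confluent hypergeometric function is ${}_1F_1(a;b;x)=\sum_{j=0}^{\infty}\frac{a^{(j)}}{b^{(j)}}\frac{x^j}{j!}$, where $a^{(j)}=\prod_{i=0}^{j-1}(a+i)$ is the rising factorial. The generalized binomial coefficient is $\binom{\alpha}{k}=\frac{1}{k!}\prod_{i=0}^{k-1}(\alpha-i)$. *)

(* Defs.v *)
From HB Require Import structures.
From mathcomp Require Import all_boot all_order all_algebra.
From mathcomp Require Import complex.
From mathcomp Require Import all_classical all_reals all_analysis.

Set Implicit Arguments.
Unset Strict Implicit.
Unset Printing Implicit Defensive.

Import Order.TTheory GRing.Theory Num.Theory.
Import numFieldNormedType.Exports.

Local Open Scope ring_scope.
Local Open Scope classical_set_scope.
Local Open Scope complex_scope.

(* The form [ip] is linear in its first argument, conjugate-linear in the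
   second, hermitian and positive definite. *)
Record hilbert_space (R : realType) := HilbertSpace {
  hilbert_sort :> lmodType R[i] ;
  ip : {dot hilbert_sort for Num.conj} ;
  hilbert_complete : forall u : nat -> hilbert_sort,
    (forall e : R, 0 < e -> exists N : nat, forall m n : nat,
      (N <= m)%N -> (N <= n)%N ->
      Num.sqrt (complex.Re (ip (u m - u n) (u m - u n))) < e) ->
    exists l : hilbert_sort,
      Num.sqrt (complex.Re (ip (u n - l) (u n - l))) @[n --> \oo] --> (0 : R) }.

Section Operators.
Context {R : realType} {H : hilbert_space R}.
Implicit Types (S T : H -> H) (M : set (H -> H)).

Definition hnorm (xi : H) : R := Num.sqrt (complex.Re (ip H xi xi)).

Definition bounded_operator T : Prop :=
  (forall (a : R[i]) (xi eta : H), T (a *: xi + eta) = a *: T xi + T eta) /\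
  exists K : R, forall xi : H, hnorm (T xi) <= K * hnorm xi.

Definition adjoint T S : Prop :=
  forall xi eta : H, ip H (T xi) eta = ip H xi (S eta).

Definition operator_norm T : R := sup [set hnorm (T xi) | xi in [set xi | hnorm xi <= 1]].

Definition weak_operator_closure M : set (H -> H) :=
  [set T | bounded_operator T /\
    forall (F : seq (H * H)) (e : R), 0 < e ->
      exists2 S, M S &
        forall p, p \in F -> `|ip H (T p.1 - S p.1) p.2| < e%:C].

Definition von_neumann_algebra M : Prop :=
  [/\ M `<=` bounded_operator,
      M id /\ (forall S T, M S -> M T -> M (S \o T)),
      (forall (a : R[i]) S T, M S -> M T -> M (fun xi => a *: S xi + T xi)),
      (forall T, M T -> exists2 S, M S & adjoint T S) &
      weak_operator_closure M `<=` M].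

End Operators.

(* A von Neumann algebra is presented as an abstract algebra [A] with a
   faithful representation [rep] whose image is a von Neumann algebra; the laws
   of the involution [star] follow from [rep_star] and [rep_inj]. *)
Record wstar_algebra (R : realType) := WStarAlgebra {
  wstar_sort :> algType R[i] ;
  star : wstar_sort -> wstar_sort ;
  rep_space : hilbert_space R ;
  rep : wstar_sort -> rep_space -> rep_space ;
  rep_linear : forall (a : R[i]) (x y : wstar_sort) (xi : rep_space),
    rep (a *: x + y) xi = a *: rep x xi + rep y xi ;
  rep1 : forall xi : rep_space, rep 1 xi = xi ;
  repM : forall (x y : wstar_sort) (xi : rep_space),
    rep (x * y) xi = rep x (rep y xi) ;
  rep_star : forall x : wstar_sort, adjoint (rep x) (rep (star x)) ;
  rep_inj : injective rep ;
  rep_von_neumann : von_neumann_algebra (range rep) }.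

Section WStarAlgebra.
Context {R : realType} {A : wstar_algebra R}.
Implicit Types (x y : A) (D B : set A).

Definition wnorm x : R := operator_norm (rep x).

Definition wle x y : Prop := exists z : A, y - x = star z * z.

Definition is_wlub D (s : A) : Prop :=
  (forall x, D x -> wle x s) /\
  (forall u : A, (forall x, D x -> wle x u) -> wle s u).

Definition upward_directed D : Prop :=
  D !=set0 /\
  forall x y, D x -> D y -> exists z, [/\ D z, wle x z & wle y z].

Definition normal_functional (phi : A -> R[i]) : Prop :=
  forall D (s : A), upward_directed D -> (forall x, D x -> star x = x) ->
    is_wlub D s -> sup [set complex.Re (phi x) | x in D] = complex.Re (phi s).

Definition faithful_normal_tracial_state (phi : A -> R[i]) : Prop :=
  [/\ forall (a : R[i]) x y, phi (a *: x + y) = a * phi x + phi y,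
      phi 1 = 1 /\ (forall x, 0 <= phi (star x * x)),
      forall x, phi (star x * x) = 0 -> x = 0,
      forall x y, phi (x * y) = phi (y * x) &
      normal_functional phi].

Definition von_neumann_subalgebra B : Prop := von_neumann_algebra (@rep R A @` B).

Definition unital_star_subalgebra B : Prop :=
  [/\ B 1,
      forall (a : R[i]) x y, B x -> B y -> B (a *: x + y),
      forall x y, B x -> B y -> B (x * y) &
      forall x, B x -> B (star x)].

End WStarAlgebra.

Record wstar_probability_space (R : realType) := WStarProbabilitySpace {
  wps_algebra :> wstar_algebra R ;
  tau : wps_algebra -> R[i] ;
  tau_state : faithful_normal_tracial_state tau }.

Section FreeProbability.
Context {R : realType} {A : wstar_probability_space R}.
Implicit Types (a : A) (Ft : R -> set A) (x c g u : R -> A).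

Definition norm2 a : R := Num.sqrt (complex.Re (tau (star a * a))).

(* Free independence of the unital star-subalgebras generated by the sets
   [S i]: [w] lists the letters of an alternating word, each with its index. *)
Definition free_family (I : eqType) (S : I -> set A) : Prop :=
  forall w : seq (I * A), w != [::] ->
    sorted (fun p q => p.1 != q.1) w ->
    (forall p, p \in w ->
       smallest unital_star_subalgebra (S p.1) p.2 /\ tau p.2 = 0) ->
    tau (\prod_(p <- w) p.2) = 0.

Definition free_pair (S T : set A) : Prop :=
  free_family (fun b : bool => if b then S else T).

Definition semicircle_density (v z : R) : R :=
  (2 * pi * v)^-1 * Num.sqrt (4 * v - z ^+ 2).

Definition semicircular (v : R) a : Prop :=
  star a = a /\
  forall n : nat, tau (a ^+ n) =
    (\int[lebesgue_measure]_(z in `[- (2 * Num.sqrt v), 2 * Num.sqrt v])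
       (z ^+ n * semicircle_density v z))%:C.

(* Processes and filtrations are functions on [R], only ever constrained at
   nonnegative times. *)
Definition filtration Ft : Prop :=
  (forall t : R, 0 <= t -> von_neumann_subalgebra (Ft t)) /\
  (forall s t : R, 0 <= s -> s <= t -> Ft s `<=` Ft t).

Definition adapted Ft u : Prop := forall t : R, 0 <= t -> Ft t (u t).

Definition semicircular_brownian_motion Ft x : Prop :=
  [/\ adapted Ft x, x 0 = 0 &
      forall s t : R, 0 <= s -> s < t ->
        free_pair [set x t - x s] (Ft s) /\ semicircular (t - s) (x t - x s)].

Definition circular_brownian_motion Ft c : Prop :=
  exists x y : R -> A,
    [/\ semicircular_brownian_motion Ft x,
        semicircular_brownian_motion Ft y,
        free_pair [set x t | t in [set t | 0 <= t]]
                  [set y t | t in [set t | 0 <= t]] &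
        forall t : R, 0 <= t ->
          c t = ((Num.sqrt 2)^-1)%:C *: (x t + (0 +i* 1) *: y t)].

(* The list of ((s, s'), a) stands for the simple process
   r |-> sum of the a such that s <= r < s'. *)
Definition simple_process : Type := seq (R * R * A).

Definition simple_adapted Ft (t : R) (th : simple_process) : Prop :=
  forall e, e \in th -> [/\ 0 <= e.1.1, e.1.1 <= e.1.2, e.1.2 <= t & Ft e.1.1 e.2].

Definition simple_value (th : simple_process) (r : R) : A :=
  \sum_(e <- th | e.1.1 <= r < e.1.2) e.2.

Definition simple_integral (th : simple_process) c : A :=
  \sum_(e <- th) e.2 * (c e.1.2 - c e.1.1).

(* [J] is the free Ito integral of [u] against [c] over [0, t] (integrand on
   the left of dc): the L^2 extension from simple adapted processes. *)
Definition free_ito_integral Ft c u (t : R) (J : A) : Prop :=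
  exists th : nat -> simple_process,
    [/\ forall n, simple_adapted Ft t (th n),
        (\int[lebesgue_measure]_(r in `[0%R, t])
           (norm2 (simple_value (th n) r - u r) ^+ 2)%:E)%E
           @[n --> \oo] --> 0%E &
        norm2 (simple_integral (th n) c - J) @[n --> \oo] --> (0 : R)].

Definition operator_norm_continuous u : Prop :=
  forall s : R, 0 <= s ->
    wnorm (u r - u s) @[r --> within [set r | 0 <= r] (nbhs s)] --> (0 : R).

Definition free_multiplicative_brownian_motion Ft c g : Prop :=
  [/\ adapted Ft g, operator_norm_continuous g, g 0 = 1 &
      forall t : R, 0 <= t -> free_ito_integral Ft c g t (g t - 1)].

Definition free_positive_multiplicative_brownian_motion g (t : R) : A :=
  g (t / 2) * star (g (t / 2)).

Definition spectral_distribution a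
    (nu : probability (measurableTypeR R) R) : Prop :=
  (exists K : set R, [/\ compact K, K `<=` `]0, +oo[ & nu K = 1%E]) /\
  forall n : nat, (\int[nu]_(z in `]0, +oo[) (z ^+ n))%:C = tau (a ^+ n).

End FreeProbability.

Section ComplexAnalysis.
Context {R : realType}.
Implicit Types (z alpha : R[i]).

Definition cexp z : R[i] :=
  (expR (complex.Re z))%:C * (cos (complex.Im z) +i* sin (complex.Im z)).

Definition cpow (x : R) alpha : R[i] := cexp (alpha * (ln x)%:C).

Definition cintegrable (mu : {measure set (measurableTypeR R) -> \bar R})
    (D : set R) (f : R -> R[i]) : Prop :=
  mu.-integrable D (fun x => (complex.Re (f x))%:E) /\
  mu.-integrable D (fun x => (complex.Im (f x))%:E).

Definition cintegral (mu : {measure set (measurableTypeR R) -> \bar R})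
    (D : set R) (f : R -> R[i]) : R[i] :=
  (\int[mu]_(x in D) complex.Re (f x)) +i* (\int[mu]_(x in D) complex.Im (f x)).

(* [R[i]^o] is [R[i]] with its modulus topology. *)
Definition csummable (u : nat -> R[i]) : Prop :=
  cvgn (series (u : nat -> R[i]^o)).

Definition csum (u : nat -> R[i]) : R[i] := limn (series (u : nat -> R[i]^o)).

Definition rising_factorial (a : R[i]) (j : nat) : R[i] :=
  \prod_(i < j) (a + i%:R).

Definition generalized_binomial alpha (k : nat) : R[i] :=
  (k`!%:R)^-1 * \prod_(i < k) (alpha - i%:R).

Definition kummer_term (a b z : R[i]) (j : nat) : R[i] :=
  rising_factorial a j / rising_factorial b j * (z ^+ j / j`!%:R).

Definition kummer_1F1 (a b z : R[i]) : R[i] := csum (kummer_term a b z).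

End ComplexAnalysis.

(* Main.v *)
Require Import Defs.
From HB Require Import structures.
From mathcomp Require Import all_boot all_order all_algebra.
From mathcomp Require Import complex ring lra.
From mathcomp Require Import all_classical all_reals all_analysis.
From mathcomp Require Import measurable_realfun.

(** Let [k_u = g_u g_u^*]. Free Ito calculus shows that
    [M(p, u) = tau (k_u (p + k_u)^-1)] satisfies a Burgers-type equation whose
    characteristics are [u |-> (1 - s) / s * exp ((1 - 2 s) u)], [0 < s < 1], along
    which [M] keeps the value [s]. A first-order estimate of [M] to the right of each
    time suffices for this, by a Gronwall argument.

    Hence, for [pinv s = (1 - s) / s * exp ((1 - 2 s) t / 2)],
    [\int x / (pinv s + x) dnu(x) = s]. In probabilistic terms, if [U] and [V] are
    uniform on [(0, 1)] and [X] has law [nu] and is independent of [V], then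
    [pinv U] and [X * (1 - V) / V] have the same law. Comparing moments of
    order [a] with [0 < a < 1] gives
    [\int x^a dnu = exp (a t / 2) * E[exp (- a t U) * ((1 - U) / U)^a] / B(1 - a, 1 + a)],
    which expands into Kummer's series by the recurrence for beta integrals.

    Both sides, divided by [exp (a t / 2)], are everywhere convergent power series
    in [a]; they agree on [(0, 1)], so they have the same coefficients, and the
    identity extends to complex [a]. *)

Set Implicit Arguments.
Unset Strict Implicit.
Unset Printing Implicit Defensive.

Import Order.TTheory GRing.Theory Num.Theory.
Import numFieldNormedType.Exports.

Local Open Scope ring_scope.
Local Open Scope classical_set_scope.
Local Open Scope complex_scope.

(** The equation behind the characteristics is d_u M = p N (1 - 2 M) with d_p M = - N, where N = tau
    (k_u (p + k_u)^-2). Regularity of M in u is not known beforehand, so no equation is solved: s is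
    fixed, p moves with dp = (1 - 2 s) p du, and the difference M - s then has drift - 2 p N (M -
    s), a multiple of itself with p N bounded. It vanishes at u = 0, where k_0 = 1 and M = 1 / (p +
    1); this dictates the starting point (1 - s) / s.

    On the side of the measure, x / (q + x) is the probability that x (1 - V) / V exceeds q. So M is
    the tail function of X (1 - V) / V, and [pinv], its inverse, is a quantile function. The
    restriction a < 1 comes from the integrability of ((1 - V) / V)^a at V = 0. The interval (0, 1)
    nevertheless determines everything, because it accumulates at 0, the centre of both power
    series. *)

(** * Real semi-inner products: Cauchy-Schwarz and the triangle inequality *)

Section SemiInnerProduct.
Variables (R : realType) (V : zmodType) (b : V -> V -> R) (sc : R -> V -> V).
Hypothesis bDl : forall u v w, b (u + v) w = b u w + b v w.
Hypothesis bZl : forall r u v, b (sc r u) v = r * b u v.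
Hypothesis bC : forall u v, b u v = b v u.
Hypothesis b_ge0 : forall u, 0 <= b u u.

(** An abstract real form lets one argument serve both the Hilbert space and the L^2 form of the
    trace. The quadratic [r |-> b (u + r v) (u + r v)] is nonnegative, and its value at the
    minimiser is the discriminant bound. *)
Lemma semi_inner_CS u v : `|b u v| <= Num.sqrt (b u u) * Num.sqrt (b v v).
Proof.
have bDr x y z : b x (y + z) = b x y + b x z.
  by rewrite bC bDl bC [b z x]bC.
have bZr r x y : b x (sc r y) = r * b x y by rewrite bC bZl bC.
have quad r : 0 <= b u u + 2 * r * b u v + r ^+ 2 * b v v.
  have := b_ge0 (u + sc r v).
  rewrite bDl !bDr !bZl !bZr [b v u]bC.
  by congr (_ <= _); ring.
rewrite -sqrtrM // -sqrtr_sqr ler_wsqrtr //.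
have [bv0|bv0] := eqVneq (b v v) 0; last first.
  have bv_gt0 : 0 < b v v by rewrite lt0r bv0 b_ge0.
  have := quad (- b u v / b v v).
  rewrite -(ler_pM2l bv_gt0) mulr0 => h.
  rewrite -subr_ge0; apply: le_trans h _.
  by rewrite le_eqVlt; apply/orP; left; apply/eqP; field.
rewrite bv0 mulr0; have [->|buv0] := eqVneq (b u v) 0; first by rewrite expr0n.
(* With [b v v = 0] the quadratic is affine in [r]; this [r] gives it the value -1. *)
have := quad (- (b u u + 1) / (2 * b u v)).
rewrite bv0 mulr0 addr0.
have -> : 2 * (- (b u u + 1) / (2 * b u v)) * b u v = - (b u u + 1) by field.
have := b_ge0 u; lra.
Qed.

Lemma semi_inner_triangle u v :
  Num.sqrt (b (u + v) (u + v)) <= Num.sqrt (b u u) + Num.sqrt (b v v).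
Proof.
have bDr x y z : b x (y + z) = b x y + b x z.
  by rewrite bC bDl bC [b z x]bC.
rewrite -[leRHS]ger0_norm ?addr_ge0 ?sqrtr_ge0 // -sqrtr_sqr ler_wsqrtr //.
rewrite sqrrD !sqr_sqrtr // bDl !bDr [b v u]bC.
have := le_trans (ler_norm _) (semi_inner_CS u v).
set p := Num.sqrt _ * _; rewrite mulr2n; lra.
Qed.

End SemiInnerProduct.

(** * The Hilbert space through the real part of its inner product *)

Section HilbertSpace.
Context {R : realType} {H : hilbert_space R}.
Implicit Types xi eta : H.

Definition rip xi eta : R := complex.Re (ip H xi eta).

Lemma Re_rM (r : R) (z : R[i]) : complex.Re (r%:C * z) = r * complex.Re z.
Proof. by case: z => u v /=; rewrite mul0r subr0. Qed.

Lemma ReD (z w : R[i]) : complex.Re (z + w) = complex.Re z + complex.Re w.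
Proof. by case: z w => [? ?] [? ?]. Qed.

Lemma ripDl xi eta zeta : rip (xi + eta) zeta = rip xi zeta + rip eta zeta.
Proof. by rewrite /rip linearDl ReD. Qed.

Lemma ripZl r xi eta : rip (r%:C *: xi) eta = r * rip xi eta.
Proof. by rewrite /rip linearZl_LR Re_rM. Qed.

Lemma ripC xi eta : rip xi eta = rip eta xi.
Proof.
rewrite /rip (hermC _ xi eta) expr0 mul1r /=.
by case: (X in complex.Re X^*).
Qed.

Lemma ripDr xi eta zeta : rip xi (eta + zeta) = rip xi eta + rip xi zeta.
Proof. by rewrite ripC ripDl !(ripC _ xi). Qed.

Lemma ripZr r xi eta : rip xi (r%:C *: eta) = r * rip xi eta.
Proof. by rewrite ripC ripZl ripC. Qed.

Lemma ripNl xi eta : rip (- xi) eta = - rip xi eta.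
Proof. by have := ripZl (-1) xi eta; rewrite rmorphN1 scaleN1r mulN1r. Qed.

Lemma ripNr xi eta : rip xi (- eta) = - rip xi eta.
Proof. by rewrite ripC ripNl ripC. Qed.

Lemma ip_conj xi eta : ip H xi eta = (ip H eta xi)^*.
Proof. by rewrite hermC expr0 mul1r. Qed.

Lemma ip_ge0 xi : 0 <= ip H xi xi. Proof. exact: dnorm_ge0. Qed.

Lemma rip_ge0 xi : 0 <= rip xi xi.
Proof. by have := ip_ge0 xi; rewrite /rip lecE => /andP[]. Qed.

Lemma hnorm_ge0 xi : 0 <= hnorm xi. Proof. exact: sqrtr_ge0. Qed.

Lemma sqr_hnorm xi : hnorm xi ^+ 2 = rip xi xi.
Proof. by rewrite sqr_sqrtr // rip_ge0. Qed.

Lemma rip_CS xi eta : `|rip xi eta| <= hnorm xi * hnorm eta.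
Proof. exact: (semi_inner_CS ripDl ripZl ripC rip_ge0). Qed.

Lemma hnormD_le xi eta : hnorm (xi + eta) <= hnorm xi + hnorm eta.
Proof. exact: (semi_inner_triangle ripDl ripZl ripC rip_ge0). Qed.

Lemma hnorm_eq0 xi : hnorm xi = 0 -> xi = 0.
Proof.
move=> h; apply/eqP; rewrite -(dnorm_eq0 (ip H)); apply/eqP.
have := ip_ge0 xi; have := sqr_hnorm xi; rewrite h expr0n /= /rip.
rewrite lecE; case: (ip H xi xi) => u v /= <- /andP[/eqP -> _] //.
Qed.

Lemma hnorm0 : hnorm (0 : H) = 0.
Proof. by rewrite /hnorm linear0l /= sqrtr0. Qed.

Lemma hnormZ r xi : hnorm (r%:C *: xi) = `|r| * hnorm xi.
Proof.
rewrite /hnorm -/(rip _ _) ripZl ripC ripZl mulrA -expr2 sqrtrM ?sqr_ge0 //.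
by rewrite sqrtr_sqr.
Qed.

Lemma hnormN xi : hnorm (- xi) = hnorm xi.
Proof.
by have := hnormZ (-1) xi; rewrite normrN1 mul1r rmorphN1 scaleN1r.
Qed.

Lemma ip_inj xi eta : (forall zeta, ip H zeta xi = ip H zeta eta) -> xi = eta.
Proof.
move=> h; apply/eqP; rewrite -subr_eq0 -(dnorm_eq0 (ip H)) linearBr.
by apply/eqP; apply: etrans (subrr (ip H (xi - eta) eta)); congr (_ - _); exact: h.
Qed.

(** The factor 2 comes from bounding the real and imaginary parts separately; the imaginary part is
    minus the real part of the form at [i xi] and [eta]. *)
Lemma ip_le xi eta : `|ip H xi eta| <= (2 * (hnorm xi * hnorm eta))%:C.
Proof.
pose ii : R[i] := 0 +i* 1.
have -> : ip H xi eta = (rip xi eta)%:C - ii * (rip (ii *: xi) eta)%:C.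
  have zE : ip H (ii *: xi) eta = ii * ip H xi eta by exact: linearZl_LR.
  rewrite /rip zE; case: (ip H xi eta) => u v.
  by apply/eqP; rewrite eq_complex /=; apply/andP; split; apply/eqP; ring.
have hi : hnorm (ii *: xi) = hnorm xi.
  have zE : ip H (ii *: xi) (ii *: xi) = ii * (ii^* * ip H xi xi).
    by rewrite linearZl_LR linearZr_LR.
  rewrite /hnorm zE; case: (ip H xi xi) => u v.
  by congr (Num.sqrt _) => /=; ring.
rewrite (le_trans (ler_normB _ _)) // normrM (_ : `|ii| = 1); last first.
  by rewrite normc_def /= expr0n expr1n add0r sqrtr1.
rewrite mul1r.
rewrite !normc_def /= !expr0n /= !addr0 !sqrtr_sqr -rmorphD lecR mulrDl !mul1r.
by rewrite lerD ?rip_CS // -hi rip_CS.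
Qed.

End HilbertSpace.

(** * The involution and operator norm bounds *)

Section OperatorBounds.
Context {R : realType} {A : wstar_algebra R}.
Implicit Types (a b x y : A) (K L : R).

Lemma repD a b (xi : rep_space A) : rep (a + b) xi = rep a xi + rep b xi.
Proof. by have := rep_linear 1 a b xi; rewrite !scale1r. Qed.

Lemma rep0 (xi : rep_space A) : rep (0 : A) xi = 0.
Proof. by apply: (addrI (rep 0 xi)); rewrite -repD !addr0. Qed.

Lemma repZ (z : R[i]) a (xi : rep_space A) : rep (z *: a) xi = z *: rep a xi.
Proof. by have := rep_linear z a 0 xi; rewrite addr0 rep0 addr0. Qed.

Lemma repN a (xi : rep_space A) : rep (- a) xi = - rep a xi.
Proof. by rewrite -[- a]scaleN1r repZ scaleN1r. Qed.

Lemma repB a b (xi : rep_space A) : rep (a - b) xi = rep a xi - rep b xi.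
Proof. by rewrite repD repN. Qed.

Lemma rep_bounded a : bounded_operator (rep a).
Proof. by case: (rep_von_neumann A) => h _ _ _ _; apply: h; exists a. Qed.

Lemma rep_vectorD a (xi eta : rep_space A) :
  rep a (xi + eta) = rep a xi + rep a eta.
Proof. by have [h _] := rep_bounded a; have := h 1 xi eta; rewrite !scale1r. Qed.

Lemma rep_vector0 a : rep a (0 : rep_space A) = 0.
Proof. by apply: (addrI (rep a 0)); rewrite -rep_vectorD !addr0. Qed.

Lemma rep_vectorZ a (z : R[i]) (xi : rep_space A) : rep a (z *: xi) = z *: rep a xi.
Proof.
by have [h _] := rep_bounded a; have := h z xi 0; rewrite rep_vector0 !addr0.
Qed.

Lemma eq_star a b : adjoint (rep a) (rep b) -> star a = b.
Proof.
move=> h; apply: rep_inj; apply/funext => eta; apply: ip_inj => xi.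
by rewrite -h rep_star.
Qed.

Lemma starK : involutive (@star R A).
Proof.
move=> a; apply: eq_star => xi eta.
by rewrite ip_conj [RHS]ip_conj -rep_star.
Qed.

Lemma starM a b : star (a * b) = star b * star a.
Proof. by apply: eq_star => xi eta; rewrite !repM !rep_star. Qed.

Lemma starD a b : star (a + b) = star a + star b.
Proof.
by apply: eq_star => xi eta; rewrite !repD linearDl linearDr; congr (_ + _); exact: rep_star.
Qed.

Lemma starZ (z : R[i]) a : star (z *: a) = z^* *: star a.
Proof.
apply: eq_star => xi eta; rewrite !repZ linearZl_LR linearZr_LR /= conjCK.
by congr (_ * _); exact: rep_star.
Qed.

Lemma starZr (r : R) a : star (r%:C *: a) = r%:C *: star a.
Proof. by rewrite starZ; congr (_ *: _); exact: conjc_real. Qed.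

Lemma star1 : star (1 : A) = 1.
Proof. by apply: eq_star => xi eta; rewrite !rep1. Qed.

Lemma starN a : star (- a) = - star a.
Proof. by rewrite -[- a]scaleN1r starZ rmorphN1 scaleN1r. Qed.

Lemma starB a b : star (a - b) = star a - star b.
Proof. by rewrite starD starN. Qed.

Lemma star0 : star (0 : A) = 0.
Proof. by have := starB (0 : A) 0; rewrite !subrr. Qed.

(** A relation rather than a norm: bounds on sums, products and adjoints compose directly, without
    handling a supremum each time. *)
Definition opbound a K := 0 <= K /\ forall xi, hnorm (rep a xi) <= K * hnorm xi.

Lemma opbound_ge0 a K : opbound a K -> 0 <= K. Proof. by case. Qed.

Lemma opboundW a K L : opbound a K -> K <= L -> opbound a L.
Proof.
move=> [K0 h] KL; split=> [|xi]; first exact: le_trans KL.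
by rewrite (le_trans (h xi)) // ler_wpM2r // hnorm_ge0.
Qed.

Lemma opboundD a b K L : opbound a K -> opbound b L -> opbound (a + b) (K + L).
Proof.
move=> [K0 h] [L0 h']; split=> [|xi]; first exact: addr_ge0.
by rewrite repD (le_trans (hnormD_le _ _)) // mulrDl lerD.
Qed.

Lemma opboundN a K : opbound a K -> opbound (- a) K.
Proof. by move=> [K0 h]; split=> // xi; rewrite repN hnormN. Qed.

Lemma opboundB a b K L : opbound a K -> opbound b L -> opbound (a - b) (K + L).
Proof. by move=> h h'; apply: opboundD => //; apply: opboundN. Qed.

Lemma opboundZ r a K : opbound a K -> opbound (r%:C *: a) (`|r| * K).
Proof.
move=> [K0 h]; split=> [|xi]; first by rewrite mulr_ge0.
by rewrite repZ hnormZ -mulrA ler_wpM2l.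
Qed.

Lemma opboundM a b K L : opbound a K -> opbound b L -> opbound (a * b) (K * L).
Proof.
move=> [K0 h] [L0 h']; split=> [|xi]; first by rewrite mulr_ge0.
by rewrite repM (le_trans (h _)) // -mulrA ler_wpM2l.
Qed.

Lemma opbound1 : opbound 1 1.
Proof. by split=> // xi; rewrite rep1 mul1r. Qed.

Lemma opbound0 : opbound 0 0.
Proof. by split=> // xi; rewrite rep0 mul0r hnorm0. Qed.

Lemma opboundX a K n : opbound a K -> opbound (a ^+ n) (K ^+ n).
Proof.
move=> h; elim: n => [|n IH]; first by rewrite !expr0; exact: opbound1.
by rewrite !exprS; exact: opboundM.
Qed.

(** The square [|a^* xi|^2 = <a a^* xi, xi>] is at most [K |a^* xi| |xi|], and one factor [|a^* xi|]
    cancels. *)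
Lemma opbound_star a K : opbound a K -> opbound (star a) K.
Proof.
move=> [K0 h]; split=> // xi; have [->|n0] := eqVneq (hnorm (rep (star a) xi)) 0.
  by rewrite mulr_ge0 // hnorm_ge0.
have n_gt0 : 0 < hnorm (rep (star a) xi) by rewrite lt0r n0 hnorm_ge0.
rewrite -(ler_pM2l n_gt0) -expr2 sqr_hnorm /rip -rep_star -/(rip _ _).
rewrite (le_trans (ler_norm _)) // (le_trans (rip_CS _ _)) // mulrCA mulrA.
by rewrite ler_wpM2r ?hnorm_ge0.
Qed.

Lemma opbound_eq0 a : opbound a 0 -> a = 0.
Proof.
move=> [_ h]; apply: rep_inj; apply/funext => xi; rewrite rep0.
by apply: hnorm_eq0; apply/eqP; rewrite eq_le hnorm_ge0 andbT -(mul0r (hnorm xi)).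
Qed.

Lemma opbound_wnorm a : opbound a (wnorm a).
Proof.
have [_ [K hK]] := rep_bounded a.
(* [operator_norm] is a [sup], which is meaningful only for a nonempty bounded set. The sign of [K]
   is unknown, hence the bound by [|K|]. *)
have ubK : has_sup [set hnorm (rep a xi) | xi in [set xi | hnorm xi <= 1]].
  split; first by exists (hnorm (rep a 0)), 0 => //=; rewrite hnorm0.
  exists `|K| => _ [xi /= xi1 <-]; apply: le_trans (hK xi) _.
  rewrite (le_trans (ler_wpM2r (hnorm_ge0 _) (ler_norm K))) //.
  by rewrite -[leRHS]mulr1 ler_wpM2l.
have le_w xi : hnorm xi <= 1 -> hnorm (rep a xi) <= wnorm a.
  by move=> xi1; apply: sup_upper_bound => //; exists xi.
split=> [|xi].
  by have := le_w 0; rewrite rep_vector0 hnorm0; apply.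
have [/hnorm_eq0 ->|n0] := eqVneq (hnorm xi) 0.
  by rewrite rep_vector0 !hnorm0 mulr0.
have n_gt0 : 0 < hnorm xi by rewrite lt0r n0 hnorm_ge0.
have := le_w ((hnorm xi)^-1%:C *: xi).
rewrite rep_vectorZ !hnormZ gtr0_norm ?invr_gt0 // mulVf // => /(_ (lexx 1)).
by rewrite mulrC ler_pdivrMr.
Qed.

Lemma opbound_small a : (forall e, 0 < e -> opbound a e) -> a = 0.
Proof.
move=> h; apply: opbound_eq0; split=> // xi; rewrite mul0r.
apply/ler_addgt0Pr => e e0; rewrite add0r.
have n1 : 0 < hnorm xi + 1 by rewrite ltr_wpDl ?hnorm_ge0.
have [_ /(_ xi)] := h (e / (hnorm xi + 1)) (divr_gt0 e0 n1).
move=> /le_trans; apply; rewrite mulrAC ler_pdivrMr // ler_pM2l //.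
by rewrite lerDl.
Qed.

End OperatorBounds.

(** * Von Neumann subalgebras and their completeness in operator norm *)

Section Subalgebras.
Context {R : realType} {A : wstar_algebra R}.
Implicit Types (a b x y : A) (B : set A).

Lemma rep_memE B a : (@rep R A @` B) (rep a) -> B a.
Proof. by move=> [b Bb /rep_inj <-]. Qed.

Lemma vN_star_subalgebra B : von_neumann_subalgebra B -> unital_star_subalgebra B.
Proof.
move=> [bd [B1 BM] BL BS _]; split.
- by apply: rep_memE; rewrite (_ : rep 1 = id) //; apply/funext => xi; rewrite rep1.
- move=> z x y Bx By; apply: rep_memE.
  rewrite (_ : rep _ = fun xi => z *: rep x xi + rep y xi); last first.
    by apply/funext => xi; rewrite rep_linear.
  by apply: BL; [exists x|exists y].
- move=> x y Bx By; apply: rep_memE.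
  rewrite (_ : rep _ = rep x \o rep y); last by apply/funext => xi; rewrite repM.
  by apply: BM; [exists x|exists y].
- move=> x Bx; have [|S [y By <-] adj] := BS (rep x); first by exists x.
  by rewrite (eq_star adj).
Qed.

Lemma vN_setT : von_neumann_subalgebra [set: A].
Proof. exact: rep_von_neumann. Qed.

Section Closed.
Variables (B : set A).
Hypothesis vB : unital_star_subalgebra B.

Lemma subalg1 : B 1. Proof. by case: vB. Qed.

Lemma subalgM x y : B x -> B y -> B (x * y). Proof. by case: vB => _ _ h _; apply: h. Qed.

Lemma subalg_star x : B x -> B (star x). Proof. by case: vB => _ _ _ h; apply: h. Qed.

Lemma subalg0 : B 0.
Proof. by case: vB => B1 h _ _; have := h (-1) 1 1 B1 B1; rewrite scaleN1r addNr. Qed.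

Lemma subalgZ (z : R[i]) x : B x -> B (z *: x).
Proof. by case: vB => _ h _ _ Bx; have := h z x 0 Bx subalg0; rewrite addr0. Qed.

Lemma subalgD x y : B x -> B y -> B (x + y).
Proof. by case: vB => _ h _ _ Bx By; have := h 1 x y Bx By; rewrite scale1r. Qed.

Lemma subalgN x : B x -> B (- x).
Proof. by rewrite -[- x]scaleN1r; exact: subalgZ. Qed.

Lemma subalgB x y : B x -> B y -> B (x - y).
Proof. by move=> Bx By; apply: subalgD => //; apply: subalgN. Qed.

Lemma subalgX x n : B x -> B (x ^+ n).
Proof.
by move=> Bx; elim: n => [|n IH]; [rewrite expr0; apply: subalg1|rewrite exprS; apply: subalgM].
Qed.

End Closed.

Lemma geometric_small (C r : R) : 0 <= r -> r < 1 ->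
  forall e, 0 < e -> exists N, forall n, (N <= n)%N -> C * r ^+ n < e.
Proof.
move=> r0 r1 e e0.
have : C * r ^+ n @[n --> \oo] --> (C * 0 : R).
  by apply: cvgMl_tmp; apply: cvg_expr; rewrite ger0_norm.
rewrite mulr0 => /cvgrPdist_lt /(_ e e0)[N _ h]; exists N => n Nn.
by have := h n Nn; rewrite /= distrC subr0; apply: le_lt_trans; apply: ler_norm.
Qed.

Lemma opbound_telescope (u : nat -> A) (C r : R) : 0 <= r -> r < 1 -> 0 <= C ->
  (forall n, opbound (u n.+1 - u n) (C * r ^+ n)) ->
  forall n m, opbound (u (n + m)%N - u n) (C * r ^+ n / (1 - r)).
Proof.
move=> r0 r1 C0 hu n m.
have r1' : 0 < 1 - r by rewrite subr_gt0.
(* The induction keeps the exact partial sum of the geometric series. *)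
suff h : opbound (u (n + m)%N - u n) (C * r ^+ n * (1 - r ^+ m) / (1 - r)).
  apply: opboundW h _; rewrite ler_wpM2r ?invr_ge0 ?(ltW r1') //.
  rewrite -[leRHS]mulr1 ler_wpM2l ?mulr_ge0 ?exprn_ge0 //.
  by rewrite gerBl exprn_ge0.
elim: m => [|m IH].
  by rewrite addn0 subrr expr0 subrr mulr0 mul0r; exact: opbound0.
rewrite (_ : u _ - u n = (u (n + m).+1 - u (n + m)%N) + (u (n + m)%N - u n)); last first.
  by rewrite addnS addrA subrK.
apply: opboundW (opboundD (hu _) IH) _.
rewrite le_eqVlt; apply/orP; left; apply/eqP; rewrite exprD exprS.
by field; rewrite gt_eqF.
Qed.

(** The limit is built vector by vector from completeness of the Hilbert space. It is a bounded
    operator in the weak closure of the image of [B], hence comes from [B] itself. Staying inside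
    [B] is what later makes resolvents adapted to the filtration. *)
Lemma vN_complete B : von_neumann_subalgebra B ->
  forall (u : nat -> A) (C r : R), 0 <= r -> r < 1 -> 0 <= C ->
  (forall n, B (u n)) ->
  (forall n, opbound (u n.+1 - u n) (C * r ^+ n)) ->
  exists2 a, B a & forall n, opbound (u n - a) (C * r ^+ n / (1 - r)).
Proof.
move=> vB u C r r0 r1 C0 Bu hu.
have r1' : 0 < 1 - r by rewrite subr_gt0.
pose D := C / (1 - r).
have D0 : 0 <= D by rewrite divr_ge0 ?(ltW r1').
have DE n : C * r ^+ n / (1 - r) = D * r ^+ n by rewrite /D mulrAC.
have cauchy n m xi : hnorm (rep (u (n + m)%N) xi - rep (u n) xi) <= D * r ^+ n * hnorm xi.
  by rewrite -repB -DE; have [_] := opbound_telescope r0 r1 C0 hu n m; apply.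
have lim xi : exists l, forall n, hnorm (rep (u n) xi - l) <= D * r ^+ n * hnorm xi.
  have [|l hl] := @hilbert_complete R (rep_space A) (fun n => rep (u n) xi).
    move=> e e0; have [N hN] := geometric_small (D * hnorm xi) r0 r1 e0.
    exists N => m n Nm Nn; rewrite -/(hnorm _).
    wlog mn : m n Nm Nn / (m <= n)%N => [wl|].
      by case/orP: (leq_total m n) => ?; [|rewrite -hnormN opprB]; exact: wl.
    rewrite -hnormN opprB -(subnKC mn) (le_lt_trans (cauchy _ _ _)) // mulrAC.
    exact: hN.
  exists l => n; apply/ler_addgt0Pr => e e0.
  move/cvgrPdist_lt: hl => /(_ e e0) [N _ hN].
  have := hN (n + N)%N (leq_addl _ _); rewrite /= distrC subr0 -/(hnorm _).
  rewrite ger0_norm ?hnorm_ge0 // => /ltW hle.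
  rewrite (_ : rep (u n) xi - l = - (rep (u (n + N)%N) xi - rep (u n) xi) +
    (rep (u (n + N)%N) xi - l)); last by rewrite opprB addrA subrK.
  by rewrite (le_trans (hnormD_le _ _)) // hnormN lerD.
have [L hL] := choice lim.
have Lsmall xi : forall e, 0 < e -> exists N, forall n, (N <= n)%N -> hnorm (rep (u n) xi - L xi) < e.
  move=> e e0; have [N hN] := geometric_small (D * hnorm xi) r0 r1 e0.
  by exists N => n Nn; rewrite (le_lt_trans (hL _ _)) // mulrAC hN.
have Lbound : bounded_operator L.
  split=> [z xi eta|]; last first.
    have [_ [K hK]] := rep_bounded (u 0).
    exists (K + D) => xi; rewrite -[L xi](subrK (rep (u 0) xi)).
    rewrite (le_trans (hnormD_le _ _)) // mulrDl addrC lerD //.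
    by rewrite -hnormN opprB; have := hL xi 0%N; rewrite expr0 mulr1.
  apply/eqP; rewrite -subr_eq0; apply/eqP/hnorm_eq0/le_anti; rewrite hnorm_ge0 andbT.
  apply/ler_addgt0Pr => e e0; rewrite add0r.
  have e3 : 0 < e / 3 by rewrite divr_gt0.
  have hz w v : hnorm (w *: v : rep_space A) <= `|complex.Re w| * hnorm v + `|complex.Im w| * hnorm v.
    pose ii : R[i] := 0 +i* 1.
    have hi : hnorm (ii *: v) = hnorm v.
      have zE : ip _ (ii *: v) (ii *: v) = ii * (ii^* * ip _ v v).
        by rewrite linearZl_LR linearZr_LR.
      rewrite /hnorm zE; case: (ip _ v v) => u0 v0.
      by congr (Num.sqrt _) => /=; ring.
    have -> : w *: v = (complex.Re w)%:C *: v + (complex.Im w)%:C *: (ii *: v).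
      rewrite scalerA -scalerDl; congr (_ *: _); case: w => p q.
      by apply/eqP; rewrite eq_complex /=; apply/andP; split; apply/eqP; ring.
    by rewrite (le_trans (hnormD_le _ _)) // !hnormZ hi.
  pose c := `|complex.Re z| + `|complex.Im z| + 1.
  have c0 : 0 < c by rewrite ltr_wpDl // addr_ge0.
  have [N1 h1] := Lsmall (z *: xi + eta) _ e3.
  have [N2 h2] := Lsmall xi _ (divr_gt0 e3 c0).
  have [N3 h3] := Lsmall eta _ e3.
  pose n := maxn N1 (maxn N2 N3).
  have -> : L (z *: xi + eta) - (z *: L xi + L eta) =
      - (rep (u n) (z *: xi + eta) - L (z *: xi + eta)) +
      (z *: (rep (u n) xi - L xi) + (rep (u n) eta - L eta)).
    rewrite rep_vectorD rep_vectorZ opprB -addrA; congr (_ + _).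
    by rewrite scalerBr addrACA -opprD addKr.
  rewrite (le_trans (hnormD_le _ _)) // hnormN.
  have -> : e = e / 3 + (e / 3 + e / 3) by field.
  apply: lerD; first by rewrite ltW // h1 // leq_maxl.
  rewrite (le_trans (hnormD_le _ _)) // lerD //; last first.
    by rewrite ltW // h3 // !leq_max leqnn !orbT.
  apply: le_trans (hz _ _) _; rewrite -mulrDl.
  have := h2 n; rewrite !leq_max leqnn orbT => /(_ isT) /ltW.
  rewrite ler_pdivlMr // => h; apply: le_trans h; rewrite mulrC ler_wpM2l ?hnorm_ge0 //.
  by rewrite /c lerDl.
have [a Ba aL] : (@rep R A @` B) L.
  case: (vB) => _ _ _ _; apply; split => // F e e0.
  (* [S] dominates every product of norms in the finite family [F], so a single index [N] serves all
     of its pairs. *)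
  pose S := \sum_(p <- F) hnorm p.1 * hnorm p.2.
  have S0 : 0 <= S by apply: sumr_ge0 => p _; rewrite mulr_ge0 ?hnorm_ge0.
  have [N hN] := geometric_small (2 * D * S) r0 r1 e0.
  exists (rep (u N)); first by exists (u N).
  move=> p pF; apply: le_lt_trans (ip_le _ _) _.
  rewrite ltcR; apply: le_lt_trans (hN N (leqnn _)).
  have pS : hnorm p.1 * hnorm p.2 <= S.
    rewrite /S (big_rem p) //= lerDl.
    by apply: sumr_ge0 => q _; rewrite mulr_ge0 ?hnorm_ge0.
  rewrite -hnormN opprB.
  apply: (@le_trans _ _ (2 * (D * r ^+ N * hnorm p.1 * hnorm p.2))).
    by rewrite ler_pM2l // ler_wpM2r ?hnorm_ge0.
  have -> : 2 * D * S * r ^+ N = 2 * (D * r ^+ N) * S by ring.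
  have -> : 2 * (D * r ^+ N * hnorm p.1 * hnorm p.2) = 2 * (D * r ^+ N) * (hnorm p.1 * hnorm p.2) by ring.
  by rewrite ler_wpM2l // mulr_ge0 // mulr_ge0 // exprn_ge0.
exists a => // n; split=> [|xi].
  by rewrite DE mulr_ge0 // exprn_ge0.
by rewrite repB aL DE.
Qed.

End Subalgebras.

(** * Square roots and resolvents as norm-convergent series *)

Section BanachSeries.
Context {R : realType} {A : wstar_algebra R}.
Implicit Types (a b g r x y : A) (B : set A).

(** The root is [1 - v], where [v] is the fixed point of [w |-> (y + w^2) / 2]. The iterates stay in
    the ball of radius [q], the smaller solution of [q = (rho + q^2) / 2], on which the map
    contracts with ratio [q < 1]. Such roots are the source of positivity for [norm2_mull]. *)
Lemma sqrt_one_sub y (rho : R) : star y = y -> opbound y rho -> rho < 1 ->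
  exists z : A, star z = z /\ z * z = 1 - y.
Proof.
move=> sy hy rho1; have rho0 := opbound_ge0 hy.
have sq_ge0 := sqrtr_ge0 (1 - rho).
have sqE : Num.sqrt (1 - rho) ^+ 2 = 1 - rho by rewrite sqr_sqrtr // subr_ge0 ltW.
pose q := 1 - Num.sqrt (1 - rho).
have sq_gt0 : 0 < Num.sqrt (1 - rho) by rewrite sqrtr_gt0 subr_gt0.
have q1 : q < 1 by rewrite /q; lra.
have q0 : 0 <= q by rewrite /q subr_ge0; nra.
have qE : (rho + q * q) / 2 = q by rewrite /q; nra.
pose w := fix w n := if n is m.+1 then (2^-1)%:C *: (y + w m * w m) else (0 : A).
have h2 : `|2^-1 : R| = 2^-1 by rewrite ger0_norm // invr_ge0.
have hw n : opbound (w n) q.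
  elim: n => [|n IH]; first exact: opboundW opbound0 q0.
  have := opboundZ 2^-1 (opboundD hy (opboundM IH IH)).
  by rewrite h2 mulrC qE.
have sw n : star (w n) = w n.
  by elim: n => [|n IH]; [exact: star0|rewrite /= starZr starD starM sy IH].
have dw n : opbound (w n.+1 - w n) (q * q ^+ n).
  elim: n => [|n IH]; first by rewrite subr0 expr0 mulr1; exact: hw.
  have -> : w n.+2 - w n.+1 =
     (2^-1)%:C *: (w n.+1 * (w n.+1 - w n) + (w n.+1 - w n) * w n).
    rewrite -[w n.+2]/((2^-1)%:C *: (y + w n.+1 * w n.+1)).
    rewrite -[X in _ - X]/((2^-1)%:C *: (y + w n * w n)).
    rewrite -scalerBr; congr (_ *: _).
    by rewrite mulrBr mulrBl addrA subrK opprD addrACA subrr add0r.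
  apply: opboundW (opboundZ 2^-1 (opboundD (opboundM (hw _) IH) (opboundM IH (hw _)))) _.
  by rewrite h2 exprS le_eqVlt; apply/orP; left; apply/eqP; field.
have [v _ hv] := vN_complete vN_setT q0 q1 q0 (fun=> I) dw.
have small a (C : R) : (forall n, opbound a (C * q ^+ n)) -> a = 0.
  move=> ha; apply: opbound_small => e e0; have [N hN] := geometric_small C q0 q1 e0.
  by apply: opboundW (ha N) _; apply: ltW; apply: hN.
have r1' : 0 < 1 - q by rewrite subr_gt0.
pose C := q / (1 - q).
have hv' n : opbound (w n - v) (C * q ^+ n) by have := hv n; rewrite /C mulrAC.
have C0 : 0 <= C by rewrite divr_ge0 // ltW.
have sv : star v = v.
  apply/eqP; rewrite -subr_eq0; apply/eqP; apply: (small _ (2 * C)) => n.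
  have -> : star v - v = (w n - v) - star (w n - v).
    by rewrite starB sw opprB [RHS]addrC addrA subrK.
  apply: opboundW (opboundB (hv' n) (opbound_star (hv' n))) _.
  by rewrite mulr_natl mulrnAl mulr2n.
have hv0 : opbound v (q + C).
  have := opboundB (hw 0%N) (hv' 0%N); rewrite opprB addrC subrK expr0 mulr1.
  by [].
have vE : (2^-1)%:C *: (y + v * v) = v.
  apply/eqP; rewrite -subr_eq0; apply/eqP.
  apply: (small _ (2^-1 * ((q + C) * C + C * q) + C * q)) => n.
  have -> : (2^-1)%:C *: (y + v * v) - v =
     (w n.+1 - v) - (2^-1)%:C *: (v * (w n - v) + (w n - v) * w n).
    rewrite addrAC; congr (_ - _).
    rewrite -[w n.+1]/((2^-1)%:C *: (y + w n * w n)) -scalerBr; congr (_ *: _).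
    rewrite mulrBr mulrBl [X in _ - X]addrC addrA subrK opprB.
    by rewrite -addrA subrKC.
  apply: opboundW (opboundB (hv' n.+1) (opboundZ 2^-1 (opboundD (opboundM hv0 (hv' n)) (opboundM (hv' n) (hw n))))) _.
  rewrite h2 exprS le_eqVlt; apply/orP; left; apply/eqP; ring.
exists (1 - v); split; first by rewrite starB star1 sv.
have v2 : y + v * v = v + v.
  rewrite -{3 4}vE -scalerDl -rmorphD /=.
  by rewrite (_ : 2^-1 + 2^-1 = 1 :> R) ?scale1r //; field.
rewrite mulrBl mul1r mulrBr mulr1 opprB.
have -> : v * v = v + v - y by rewrite -v2 addrC addKr.
by rewrite [X in _ + X]addrAC addrK addrA subrK.
Qed.

Lemma neumann_series B y (rho : R) : von_neumann_subalgebra B -> B y ->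
  opbound y rho -> rho < 1 ->
  exists2 a, B a & [/\ a * (1 - y) = 1, (1 - y) * a = 1 &
    forall n, opbound (\sum_(i < n) y ^+ i - a) (rho ^+ n / (1 - rho))].
Proof.
move=> vB By hy rho1; have rho0 := opbound_ge0 hy.
have sB := vN_star_subalgebra vB.
pose u n := \sum_(i < n) y ^+ i.
have Bu n : B (u n).
  elim: n => [|n IH]; first by rewrite /u big_ord0; exact: subalg0.
  by rewrite /u big_ord_recr; apply: subalgD => //; apply: subalgX.
have du n : opbound (u n.+1 - u n) (1 * rho ^+ n).
  by rewrite /u big_ord_recr /= addrAC subrr add0r mul1r; exact: opboundX.
have [a Ba ha] := vN_complete vB rho0 rho1 ler01 Bu du.
have ha' n : opbound (u n - a) (rho ^+ n / (1 - rho)) by have := ha n; rewrite mul1r.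
exists a => //.
have r1' : 0 < 1 - rho by rewrite subr_gt0.
have small b (C : R) : (forall n, opbound b (C * rho ^+ n)) -> b = 0.
  move=> hb; apply: opbound_small => e e0; have [N hN] := geometric_small C rho0 rho1 e0.
  by apply: opboundW (hb N) _; apply: ltW; apply: hN.
have uE n : u n * (1 - y) = 1 - y ^+ n.
  elim: n => [|n IH]; first by rewrite /u big_ord0 mul0r expr0 subrr.
  rewrite /u big_ord_recr /= mulrDl -/(u n) IH mulrBr mulr1 -exprSr.
  by rewrite addrA subrK.
have uE' n : (1 - y) * u n = 1 - y ^+ n.
  elim: n => [|n IH]; first by rewrite /u big_ord0 mulr0 expr0 subrr.
  rewrite /u big_ord_recr /= mulrDr -/(u n) IH mulrBl mul1r -exprS.
  by rewrite addrA subrK.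
have h1 : opbound (1 - y) (1 + rho) by apply: opboundB => //; exact: opbound1.
have fin n : rho ^+ n / (1 - rho) * (1 + rho) + rho ^+ n = ((1 - rho)^-1 * (1 + rho) + 1) * rho ^+ n.
  by ring.
split => //.
- apply/eqP; rewrite -subr_eq0; apply/eqP; apply: (small _ ((1 - rho)^-1 * (1 + rho) + 1)) => n.
  have -> : a * (1 - y) - 1 = - ((u n - a) * (1 - y)) - y ^+ n.
    by rewrite (mulrBl _ (u n) a) uE opprB -!addrA -opprD subrK.
  apply: opboundW (opboundB (opboundN (opboundM (ha' n) h1)) (opboundX n hy)) _.
  by rewrite fin.
- apply/eqP; rewrite -subr_eq0; apply/eqP; apply: (small _ ((1 - rho)^-1 * (1 + rho) + 1)) => n.
  have -> : (1 - y) * a - 1 = - ((1 - y) * (u n - a)) - y ^+ n.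
    by rewrite (mulrBr _ (u n) a) uE' opprB -!addrA -opprD subrK.
  apply: opboundW (opboundB (opboundN (opboundM h1 (ha' n))) (opboundX n hy)) _.
  by rewrite [X in X + _]mulrC fin.
Qed.

(* Since [k = g g^*], [|k xi|^2 <= K <k xi, xi>] whenever [K >= |g|^2], hence
   [|K - k| <= K] and the resolvent is a Neumann series around [K]. *)
Lemma opbound_sub_positive g (L K : R) : opbound g L -> L ^+ 2 <= K ->
  opbound (K%:C *: 1 - g * star g) K.
Proof.
move=> hg LK; have L0 := opbound_ge0 hg.
have K0 : 0 <= K by rewrite (le_trans _ LK) // sqr_ge0.
split=> // xi; rewrite -[leRHS]ger0_norm ?mulr_ge0 ?hnorm_ge0 //.
rewrite -[leRHS]sqrtr_sqr /hnorm -/(rip _ _) -/(hnorm _) ler_wsqrtr //.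
rewrite repB repZ rep1 repM; set eta := rep (star g) xi.
have e1 : rip (rep g eta) xi = hnorm eta ^+ 2.
  by rewrite sqr_hnorm /rip rep_star.
have e2 : hnorm (rep g eta) ^+ 2 <= K * hnorm eta ^+ 2.
  apply: le_trans (_ : (L * hnorm eta) ^+ 2 <= _).
    by rewrite ler_sqr ?nnegrE ?mulr_ge0 ?hnorm_ge0 //; case: hg.
  by rewrite exprMn ler_wpM2r // sqr_ge0.
have -> : rip (K%:C *: xi - rep g eta) (K%:C *: xi - rep g eta) =
   K ^+ 2 * hnorm xi ^+ 2 - 2 * K * hnorm eta ^+ 2 + hnorm (rep g eta) ^+ 2.
  rewrite !(ripDl, ripDr, ripNl, ripNr, ripZl, ripZr) (ripC xi) e1 -!sqr_hnorm.
  by ring.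
rewrite exprMn; have : 0 <= K * hnorm eta ^+ 2 by rewrite mulr_ge0 // sqr_ge0.
lra.
Qed.

Definition is_resolvent (p : R) a r := (p%:C *: 1 + a) * r = 1 /\ r * (p%:C *: 1 + a) = 1.

Lemma resolvent_unique p a r r' : is_resolvent p a r -> is_resolvent p a r' -> r = r'.
Proof.
move=> [_ h] [h' _]; rewrite -[r]mulr1 -h' mulrA h mul1r //.
Qed.

Lemma resolvent_star p a r : star a = a -> is_resolvent p a r -> star r = r.
Proof.
move=> sa hr; apply: (resolvent_unique (p := p) (a := a)) => //.
case: hr => h h'; have e : star (p%:C *: 1 + a) = p%:C *: 1 + a.
  by rewrite starD starZr star1 sa.
by split; rewrite -{1}e -starM ?h ?h' star1.
Qed.

(** Expanding around [K] makes the ratio [K / (p + K)] less than 1 for every [p > 0], however small.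
    The partial sums are polynomials in [g g^*], so their traces are combinations of moments; this
    is why the rate of convergence is part of the conclusion. *)
Lemma resolvent_exists B g (L K p : R) : von_neumann_subalgebra B -> B g ->
  opbound g L -> L ^+ 2 <= K -> 0 < p ->
  exists2 r, B r & [/\ is_resolvent p (g * star g) r, opbound r p^-1 &
    forall n, opbound (\sum_(i < n) ((p + K) ^- i.+1)%:C *: (K%:C *: 1 - g * star g) ^+ i - r)
      ((K / (p + K)) ^+ n / p)].
Proof.
move=> vB Bg hg LK p0.
have sB := vN_star_subalgebra vB.
have K0 : 0 <= K by rewrite (le_trans _ LK) // sqr_ge0.
have pK : 0 < p + K by rewrite ltr_wpDr.
set k := g * star g; set d := K%:C *: 1 - k.
pose y := ((p + K)^-1)%:C *: d.
have Bd : B d.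
  by apply: subalgB => //; [apply: subalgZ => //; apply: subalg1|apply: subalgM => //; apply: subalg_star].
have inv_ge0 : 0 <= (p + K)^-1 by rewrite invr_ge0 ltW.
have hy : opbound y (K / (p + K)).
  have := opboundZ (p + K)^-1 (opbound_sub_positive hg LK).
  by rewrite ger0_norm // mulrC.
have rho1 : K / (p + K) < 1 by rewrite ltr_pdivrMr // mul1r ltrDr.
have [a Ba [a1 a2 ha]] := neumann_series vB (subalgZ sB _ Bd) hy rho1.
have rhoE : (1 - K / (p + K))^-1 = (p + K) / p by field; rewrite !gt_eqF.
exists ((p + K)^-1%:C *: a); first exact: subalgZ.
have yE : p%:C *: 1 + k = (p + K)%:C *: (1 - y).
  rewrite scalerBr /y scalerA -rmorphM /= divff ?gt_eqF // scale1r /d opprB.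
  by rewrite rmorphD scalerDl -addrA subrKC.
have inv1 : (p + K)%:C * (p + K)^-1%:C = 1 :> R[i].
  by rewrite -rmorphM divff ?gt_eqF.
split.
- by split; rewrite yE -scalerAl -scalerAr scalerA ?a1 ?a2 ?inv1 ?[_^-1%:C * _]mulrC ?inv1 scale1r.
(* The error estimate for the empty partial sum is the norm bound on the resolvent. *)
- have := opboundZ (p + K)^-1 (opboundN (ha 0%N)).
  rewrite big_ord0 sub0r opprK expr0 rhoE mul1r ger0_norm // mulrA mulVf ?gt_eqF // mul1r.
  by [].
- move=> n; have := opboundZ (p + K)^-1 (ha n).
  rewrite rhoE ger0_norm // scalerBr scaler_sumr.
  have -> : (p + K)^-1 * ((K / (p + K)) ^+ n * ((p + K) / p)) = (K / (p + K)) ^+ n / p.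
    by field; rewrite !gt_eqF.
  congr (opbound (_ - _) _); apply: eq_bigr => i _.
  by rewrite /y exprZn scalerA -rmorphXn -rmorphM /= exprS invfM exprVn.
Qed.

End BanachSeries.

(** * The trace and its L^2 norm *)

Section Trace.
Context {R : realType} {A : wstar_probability_space R}.
Implicit Types (a b x y z : A).

Lemma tauD a b : tau (a + b) = tau a + tau b.
Proof. by case: (tau_state A) => h _ _ _ _; have := h 1 a b; rewrite scale1r mul1r. Qed.

Lemma tau0 : tau (0 : A) = 0.
Proof. by apply: (addrI (tau (0 : A))); rewrite -tauD !addr0. Qed.

Lemma tauZ (c : R[i]) a : tau (c *: a) = c * tau a.
Proof. by case: (tau_state A) => h _ _ _ _; have := h c a 0; rewrite !addr0 tau0 addr0. Qed.

Lemma tauN a : tau (- a) = - tau a.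
Proof. by rewrite -[- a]scaleN1r tauZ mulN1r. Qed.

Lemma tauB a b : tau (a - b) = tau a - tau b.
Proof. by rewrite tauD tauN. Qed.

Lemma tauC a b : tau (a * b) = tau (b * a).
Proof. by case: (tau_state A). Qed.

Lemma tau1 : tau (1 : A) = 1.
Proof. by case: (tau_state A) => _ []. Qed.

Lemma tau_ge0 a : 0 <= tau (star a * a).
Proof. by case: (tau_state A) => _ []. Qed.

(** The values of [tau] at [x^* x] are real; comparing imaginary parts for [x] equal to [a], [1 + a]
    and [1 + i a] gives both components. *)
Lemma tau_star a : tau (star a) = (tau a)^*.
Proof.
have := tau_ge0 (1 + a); have := tau_ge0 (1 + (0 +i* 1) *: a); have := tau_ge0 a.
rewrite !starD starZ star1 !mulrDl !mulrDr !mul1r !mulr1 -scalerAl -scalerAr.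
rewrite !tauD !tauZ tau1.
case: (tau (star a * a)) => p q; case: (tau a) => u v; case: (tau (star a)) => u' v'.
rewrite !lecE /= => /andP[/eqP hq _] /andP[/eqP h1 _] /andP[/eqP h2 _].
by apply/eqP; rewrite eq_complex /=; apply/andP; split; apply/eqP; lra.
Qed.

Lemma tau_sum I (r : seq I) (P : pred I) (F : I -> A) :
  tau (\sum_(i <- r | P i) F i) = \sum_(i <- r | P i) tau (F i).
Proof. by rewrite (big_morph _ tauD tau0). Qed.

Definition rtr a : R := complex.Re (tau a).

Lemma rtrD a b : rtr (a + b) = rtr a + rtr b.
Proof. by rewrite /rtr tauD ReD. Qed.

Lemma rtr0 : rtr 0 = 0.
Proof. by rewrite /rtr tau0. Qed.

Lemma rtrN a : rtr (- a) = - rtr a.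
Proof. by rewrite /rtr tauN; case: (tau a). Qed.

Lemma rtrB a b : rtr (a - b) = rtr a - rtr b.
Proof. by rewrite rtrD rtrN. Qed.

Lemma rtrZ r a : rtr (r%:C *: a) = r * rtr a.
Proof. by rewrite /rtr tauZ Re_rM. Qed.

Lemma rtrC a b : rtr (a * b) = rtr (b * a).
Proof. by rewrite /rtr tauC. Qed.

Lemma rtr1 : rtr 1 = 1.
Proof. by rewrite /rtr tau1. Qed.

Lemma rtr_star a : rtr (star a) = rtr a.
Proof. by rewrite /rtr tau_star; case: (tau a). Qed.

Lemma rtr_sum I (r : seq I) (P : pred I) (F : I -> A) :
  rtr (\sum_(i <- r | P i) F i) = \sum_(i <- r | P i) rtr (F i).
Proof. by rewrite (big_morph _ rtrD rtr0). Qed.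

Lemma rtr_ge0 a : 0 <= rtr (star a * a).
Proof. by have := tau_ge0 a; rewrite lecE => /andP[]. Qed.

Lemma tau_selfadjoint a : star a = a -> tau a = (rtr a)%:C.
Proof.
move=> sa; have := tau_star a; rewrite sa /rtr; case: (tau a) => u v [h].
by congr (_ +i* _); rewrite /=; lra.
Qed.

Definition l2ip a b : R := rtr (star a * b).

Lemma l2ipDl a b c : l2ip (a + b) c = l2ip a c + l2ip b c.
Proof. by rewrite /l2ip starD mulrDl rtrD. Qed.

Lemma l2ipZl r a b : l2ip (r%:C *: a) b = r * l2ip a b.
Proof. by rewrite /l2ip starZr -scalerAl rtrZ. Qed.

Lemma l2ipC a b : l2ip a b = l2ip b a.
Proof. by rewrite /l2ip -rtr_star starM starK. Qed.

Lemma l2ipDr a b c : l2ip a (b + c) = l2ip a b + l2ip a c.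
Proof. by rewrite /l2ip mulrDr rtrD. Qed.

Lemma l2ipNr a b : l2ip a (- b) = - l2ip a b.
Proof. by rewrite /l2ip mulrN rtrN. Qed.

Lemma l2ipNl a b : l2ip (- a) b = - l2ip a b.
Proof. by rewrite l2ipC l2ipNr l2ipC. Qed.

Lemma sqr_norm2 a : norm2 a ^+ 2 = l2ip a a.
Proof. by rewrite sqr_sqrtr // rtr_ge0. Qed.

Lemma norm2_ge0 a : 0 <= norm2 a. Proof. exact: sqrtr_ge0. Qed.

Lemma l2ip_CS a b : `|l2ip a b| <= norm2 a * norm2 b.
Proof. exact: (semi_inner_CS l2ipDl l2ipZl l2ipC rtr_ge0). Qed.

Lemma norm2D_le a b : norm2 (a + b) <= norm2 a + norm2 b.
Proof. exact: (semi_inner_triangle l2ipDl l2ipZl l2ipC rtr_ge0). Qed.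

Lemma norm2N a : norm2 (- a) = norm2 a.
Proof. by rewrite /norm2 starN mulNr mulrN opprK. Qed.

Lemma norm2B_le a b : norm2 (a - b) <= norm2 a + norm2 b.
Proof. by rewrite -[norm2 b]norm2N norm2D_le. Qed.

Lemma norm20 : norm2 (0 : A) = 0.
Proof. by rewrite /norm2 mulr0 tau0 sqrtr0. Qed.

Lemma norm2_star a : norm2 (star a) = norm2 a.
Proof. by rewrite /norm2 starK tauC. Qed.

Lemma rtrM_le a b : `|rtr (a * b)| <= norm2 a * norm2 b.
Proof. by have := l2ip_CS (star a) b; rewrite /l2ip starK norm2_star. Qed.

(** This is [a^* a <= K^2] tested on [b]. For [rho < 1] the element [1 - rho a^* a / K^2] is the
    square of a self-adjoint [z], and positivity of the trace at [z b] gives the inequality with the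
    factor [rho], which then tends to 1. *)
Lemma norm2_mull a b K : opbound a K -> norm2 (a * b) <= K * norm2 b.
Proof.
move=> ha; have K0 := opbound_ge0 ha.
have [Kz|Kn] := eqVneq K 0.
  by move: ha; rewrite Kz => /opbound_eq0 ->; rewrite mul0r norm20 mul0r.
have K_gt0 : 0 < K by rewrite lt0r Kn.
suff h rho : 0 < rho -> rho < 1 -> rho * norm2 (a * b) ^+ 2 <= K ^+ 2 * norm2 b ^+ 2.
  rewrite -ler_sqr ?nnegrE ?norm2_ge0 ?mulr_ge0 ?norm2_ge0 // exprMn.
  set X := norm2 (a * b) ^+ 2; set Y := K ^+ 2 * _.
  have [//|YX] := leP X Y.
  have Y0 : 0 <= Y by rewrite mulr_ge0 // sqr_ge0.
  have X0 : 0 < X by rewrite (le_lt_trans Y0).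
  (* If [Y < X], the ratio [(Y + X) / (2 X)] is an admissible [rho] that contradicts [h]. *)
  have r0 : 0 < (Y + X) / (2 * X) by apply: divr_gt0; lra.
  have r1 : (Y + X) / (2 * X) < 1.
    by rewrite ltr_pdivrMr; lra.
  have := h _ r0 r1; rewrite -/X -/Y.
  have -> : (Y + X) / (2 * X) * X = (Y + X) / 2 by field; rewrite gt_eqF.
  lra.
move=> rho0 rho1.
pose y := (rho / K ^+ 2)%:C *: (star a * a).
have rK : 0 <= rho / K ^+ 2 by rewrite divr_ge0 ?sqr_ge0 // ltW.
have hy : opbound y rho.
  apply: opboundW (opboundZ _ (opboundM (opbound_star ha) ha)) _.
  by rewrite ger0_norm // -expr2 divfK // expf_neq0.
have sy : star y = y by rewrite starZr starM starK.
have [z [sz zz]] := sqrt_one_sub sy hy rho1.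
have := rtr_ge0 (z * b); rewrite starM sz mulrA -(mulrA (star b)) zz.
rewrite mulrBr mulr1 mulrBl rtrB -/(l2ip b b) /y -scalerAr -scalerAl rtrZ.
have -> : star b * (star a * a) * b = star (a * b) * (a * b) by rewrite starM !mulrA.
rewrite -/(l2ip (a * b) (a * b)) -!sqr_norm2 subr_ge0 mulrAC ler_pdivrMr ?exprn_gt0 //.
by rewrite [leRHS]mulrC.
Qed.

Lemma norm2_mulr a b K : opbound a K -> norm2 (b * a) <= K * norm2 b.
Proof.
move=> ha; rewrite -norm2_star starM -(norm2_star b).
by apply: norm2_mull; apply: opbound_star.
Qed.

Lemma norm2_opbound a K : opbound a K -> norm2 a <= K.
Proof.
move=> ha; have := norm2_mull 1 ha.
by rewrite mulr1 {2}/norm2 star1 mulr1 tau1 /= sqrtr1 mulr1.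
Qed.

Lemma rtr_opbound a K : opbound a K -> `|rtr a| <= K.
Proof.
move=> ha; have := rtrM_le 1 a; rewrite mul1r {1}/norm2 star1 mulr1 tau1 /= sqrtr1 mul1r.
by move=> /le_trans; apply; apply: norm2_opbound.
Qed.

End Trace.

(** * Trace formulas for free pairs *)

Section Freeness.
Context {R : realType} {A : wstar_probability_space R}.
Implicit Types (a b : A) (S T : set A).

Local Notation alg := (smallest unital_star_subalgebra).

Lemma gen_subalg S : unital_star_subalgebra (alg S).
Proof.
split=> [B [sB _]|z x y hx hy B hB|x y hx hy B hB|x hx B hB].
- exact: (subalg1 sB).
- have [sB _] := hB; apply: subalgD => //; first apply: subalgZ => //.
  + exact: hx.
  + exact: hy.
- by have [sB _] := hB; apply: subalgM => //; [exact: hx|exact: hy].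
- by have [sB _] := hB; apply: subalg_star => //; exact: hx.
Qed.

Lemma gen_sub S a : S a -> alg S a.
Proof. by move=> Sa B [_]; apply. Qed.

Lemma gen_center S a : alg S a ->
  exists2 a0, alg S a0 /\ tau a0 = 0 & a = a0 + tau a *: 1.
Proof.
move=> Sa; have sS := gen_subalg S; exists (a - tau a *: 1); last by rewrite subrK.
split; last by rewrite tauB tauZ tau1 mulr1 subrr.
by apply: (subalgB sS) => //; apply: (subalgZ sS); exact: (subalg1 sS).
Qed.

Lemma free_pairM S T a b : free_pair S T -> alg S a -> alg T b ->
  tau (a * b) = tau a * tau b.
Proof.
move=> fST /gen_center[a0 [Sa0 ta0] aE] /gen_center[b0 [Tb0 tb0] bE].
rewrite {1}aE {1}bE mulrDl !mulrDr -!scalerAl -!scalerAr !mulr1 mul1r.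
rewrite !tauD !tauZ ta0 tb0 tau1 !mulr0 mulr1 !addr0 add0r.
have := fST [:: (true, a0); (false, b0)].
rewrite !big_cons big_nil mulr1 /= => -> //; first by rewrite add0r.
by move=> p; rewrite !inE => /orP[] /eqP -> /=.
Qed.

(** Split [c] and [d] into mean and centred part. The fully centred term is an alternating word;
    each mixed term factors, after a cyclic move, with a centred letter. Only the product of the two
    means survives. *)
Lemma free_pair_sandwich S T a b c d : free_pair S T -> alg S a -> alg S b ->
  alg T c -> alg T d -> tau a = 0 -> tau b = 0 ->
  tau (c * a * (d * b)) = tau c * tau d * tau (a * b).
Proof.
move=> fST Sa Sb /gen_center[c0 [Tc0 tc0] cE] /gen_center[d0 [Td0 td0] dE] a0 b0.
have sS := gen_subalg S.
have e1 : tau (c0 * a * (d0 * b)) = 0.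
  have := fST [:: (false, c0); (true, a); (false, d0); (true, b)].
  rewrite !big_cons big_nil mulr1 /= !mulrA => -> //.
  by move=> p; rewrite !inE => /orP[|/orP[|/orP[]]] /eqP -> //=.
have z1 : tau (c0 * a * b) = 0.
  by rewrite -mulrA tauC (free_pairM fST) // ?tc0 ?mulr0 //; exact: (subalgM sS).
have z2 : tau (a * (d0 * b)) = 0.
  by rewrite mulrA tauC mulrA (free_pairM fST) // ?td0 ?mulr0 //; exact: (subalgM sS).
rewrite {1}cE {1}dE !mulrDl !mulrDr.
rewrite -!scalerAl -!scalerAr !mul1r !tauD e1 add0r !tauZ z1 z2.
by rewrite !mulr0 !add0r.
Qed.

End Freeness.

(** * First two moments of the semicircle law *)

Section Semicircle.
Context {R : realType}.

Lemma continuous_integrable_itv (f : R -> R) (a b : R) : continuous f ->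
  lebesgue_measure.-integrable `[a, b] (EFin \o f).
Proof.
move=> cf; apply: continuous_compact_integrable; first exact: segment_compact.
exact: continuous_subspaceT.
Qed.

Lemma Rintegral_FTC (f F : R -> R) (a b : R) : a < b -> continuous f ->
  continuous F -> (forall x, a < x < b -> is_derive x 1 F (f x)) ->
  \int[lebesgue_measure]_(x in `[a, b]) f x = F b - F a.
Proof.
move=> ab cf cF dF; rewrite /Rintegral (@continuous_FTC2 _ f F) //.
- exact: continuous_subspaceT.
- split=> [x||].
  + by rewrite in_itv /= => /dF[].
  + by apply: cvg_at_right_filter; exact: cF.
  + by apply: cvg_at_left_filter; exact: cF.
- move=> x; rewrite in_itv /= => /dF dFx.
  by rewrite derive1E; exact: derive_val.
Qed.

Variable v : R.
Hypothesis v_gt0 : 0 < v.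
Let w (z : R) : R := 4 * v - z ^+ 2.
Let a : R := 2 * Num.sqrt v.

Let w_gt0 (z : R) : - a < z < a -> 0 < w z.
Proof.
move=> /andP[h1 h2]; have a2 : a ^+ 2 = 4 * v.
  by rewrite /a exprMn sqr_sqrtr ?ltW //; ring.
rewrite /w -a2; nra.
Qed.

Let wa : w a = 0.
Proof. by rewrite /w /a exprMn sqr_sqrtr ?ltW //; ring. Qed.

Let cw : continuous w.
Proof.
move=> z; rewrite /w; apply: cvgB; first exact: cvg_cst.
exact: exprn_continuous.
Qed.

Let csw : continuous (fun z => Num.sqrt (w z)).
Proof. by move=> z; apply: continuous_comp; [exact: cw|exact: sqrt_continuous]. Qed.

Let dw (z : R) : is_derive z 1 w (- (2 * z)).
Proof.
have h := is_deriveB (is_derive_cst (4 * v) z 1)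
  (is_deriveM (is_derive_id z (1 : R)) (is_derive_id z (1 : R))).
have wE : w = cst (4 * v) - id * id by apply/funext => y; rewrite /w expr2.
by rewrite wE; apply: is_derive_eq h _; rewrite /GRing.scale /=; ring.
Qed.

Let dwsw (z : R) : - a < z < a ->
  is_derive z 1 (fun z => w z * Num.sqrt (w z)) (- (3 * z * Num.sqrt (w z))).
Proof.
move=> za; have wz := w_gt0 za.
have ds : is_derive z 1 (fun z => Num.sqrt (w z)) ((2 * Num.sqrt (w z))^-1 * - (2 * z)).
  have dsw := is_derive1_sqrt wz.
  exact: is_derive1_comp.
have swz : Num.sqrt (w z) != 0 by rewrite gt_eqF // sqrtr_gt0.
have h := is_deriveM (dw z) ds.
apply: is_derive_eq h _; rewrite /GRing.scale /=.
have wE : w z = Num.sqrt (w z) ^+ 2 by rewrite sqr_sqrtr // ltW.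
by set s := Num.sqrt (w z) in swz wE *; rewrite wE; field.
Qed.

Let aNa : - a < a.
Proof. by rewrite gtrN // /a mulr_gt0 // sqrtr_gt0. Qed.

Let wNa : w (- a) = 0.
Proof. by rewrite /w sqrrN -/(w a) wa. Qed.

Lemma semicircle_moment1 :
  \int[lebesgue_measure]_(z in `[- (2 * Num.sqrt v), 2 * Num.sqrt v])
    (z ^+ 1 * semicircle_density v z) = 0.
Proof.
rewrite -/a; pose C := (2 * pi * v)^-1 : R.
pose F z := - (C / 3) * (w z * Num.sqrt (w z)).
transitivity (F a - F (- a)); last first.
  by rewrite /F wa wNa !mul0r !mulr0 subrr.
apply: (@Rintegral_FTC (fun z => z ^+ 1 * semicircle_density v z) F _ _ aNa).
- move=> z; apply: cvgM; first exact: exprn_continuous.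
  by apply: cvgMl_tmp; exact: csw.
- by move=> z; apply: cvgMl_tmp; apply: cvgM; [exact: cw|exact: csw].
- move=> z za; have h := is_deriveZ (- (C / 3)) (dwsw za).
  apply: is_derive_eq h _; rewrite /semicircle_density -/C -/(w z) /GRing.scale /=.
  by field.
Qed.

(** The derivative of [z w^(3/2)] is [4 (v - z^2) w^(1/2)], which ties the second moment to the
    mass. The mass itself is read off later from the moment of order 0, which is [tau 1]. *)
Lemma semicircle_moment2 :
  \int[lebesgue_measure]_(z in `[- (2 * Num.sqrt v), 2 * Num.sqrt v])
    (z ^+ 2 * semicircle_density v z) =
  v * \int[lebesgue_measure]_(z in `[- (2 * Num.sqrt v), 2 * Num.sqrt v])
    (z ^+ 0 * semicircle_density v z).
Proof.
rewrite -/a; pose C := (2 * pi * v)^-1 : R.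
have cn n : continuous (fun z : R => z ^+ n * semicircle_density v z).
  move=> z; apply: cvgM; first exact: exprn_continuous.
  by apply: cvgMl_tmp; exact: csw.
have i0 := continuous_integrable_itv (- a) a (cn 0%N).
have i2 := continuous_integrable_itv (- a) a (cn 2%N).
rewrite -RintegralZl //; apply/eqP; rewrite -subr_eq0 -RintegralB //; last first.
  by apply: (@continuous_integrable_itv (fun z => v * _)) => z; apply: cvgMl_tmp; exact: (cn 0%N).
apply/eqP.
pose F z := - (C / 4) * (z * (w z * Num.sqrt (w z))).
transitivity (F a - F (- a)); last first.
  by rewrite /F wa wNa !mul0r !mulr0 subrr.
apply: (@Rintegral_FTC
  (fun z => z ^+ 2 * semicircle_density v z - v * (z ^+ 0 * semicircle_density v z)) F _ _ aNa).
- move=> z; apply: cvgB; first exact: cn.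
  by apply: cvgMl_tmp; exact: cn.
- by move=> z; apply: cvgMl_tmp; apply: cvgM => //; apply: cvgM; [exact: cw|exact: csw].
- move=> z za; have h := is_deriveZ (- (C / 4)) (is_deriveM (is_derive_id z (1 : R)) (dwsw za)).
  apply: is_derive_eq h _; rewrite /semicircle_density -/C -/(w z) /GRing.scale /=.
  by rewrite /w; field.
Qed.

End Semicircle.

Section SemicircularElement.
Context {R : realType} {A : wstar_probability_space R}.
Implicit Types (v : R) (a : A).

Lemma semicircular_mean v a : 0 < v -> semicircular v a -> tau a = 0.
Proof.
by move=> v0 [_ /(_ 1%N)]; rewrite semicircle_moment1 // expr1 => ->.
Qed.

Lemma semicircular_variance v a : 0 < v -> semicircular v a -> tau (a * a) = v%:C.
Proof.
move=> v0 [_ h]; have := h 2%N; have := h 0%N.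
rewrite semicircle_moment2 // expr0 tau1 -expr2 => /(congr1 (@complex.Re R)) /= h0 ->.
by rewrite -h0 mulr1.
Qed.

End SemicircularElement.

(** * Second-order calculus of semicircular and circular increments *)

Section BrownianIncrements.
Context {R : realType} {A : wstar_probability_space R}.
Variable Ft : R -> set A.
Hypothesis Ft_filtration : filtration Ft.
Implicit Types (a b : A) (s t u : R).

Lemma Ft_subalg s : 0 <= s -> unital_star_subalgebra (Ft s).
Proof. by move=> s0; apply: vN_star_subalgebra; case: Ft_filtration => h _; exact: h. Qed.

Lemma Ft_le s t a : 0 <= s -> s <= t -> Ft s a -> Ft t a.
Proof. by move=> s0 st; case: Ft_filtration => _; exact. Qed.

Section SemicircularIncrement.
Variable x : R -> A.
Hypothesis x_bm : semicircular_brownian_motion Ft x.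

Lemma bm_adapted s t : 0 <= s -> s <= t -> Ft t (x t - x s).
Proof.
move=> s0 st; have t0 := le_trans s0 st; case: x_bm => ad _ _.
apply: (subalgB (Ft_subalg t0)); first exact: ad.
by apply: (Ft_le s0 st); exact: ad.
Qed.

Lemma bm_increment_star s t : 0 <= s -> s <= t -> star (x t - x s) = x t - x s.
Proof.
move=> s0; rewrite le_eqVlt => /predU1P[->|st]; first by rewrite subrr star0.
by case: x_bm => _ _ /(_ s t s0 st)[_ []].
Qed.

Lemma bm_increment_mean s t a : 0 <= s -> s <= t -> Ft s a -> tau (a * (x t - x s)) = 0.
Proof.
(* Freeness and the semicircle law are given for [s < t] only; a degenerate interval has a zero
   increment. *)
move=> s0; rewrite le_eqVlt => /predU1P[-> _|st sa]; first by rewrite subrr mulr0 tau0.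
case: x_bm => _ _ /(_ s t s0 st)[fr sc].
rewrite tauC (free_pairM fr); last 2 first.
- exact: gen_sub.
- exact: gen_sub.
by rewrite (semicircular_mean _ sc) ?subr_gt0 // mul0r.
Qed.

Lemma bm_increment_cov s t a b : 0 <= s -> s <= t -> Ft s a -> Ft s b ->
  tau (a * (x t - x s) * (b * (x t - x s))) = tau a * tau b * (t - s)%:C.
Proof.
move=> s0; rewrite le_eqVlt => /predU1P[-> _ _|st sa sb].
  by rewrite !subrr mulr0 mul0r tau0 mulr0.
case: x_bm => _ _ /(_ s t s0 st)[fr sc]; have st0 : 0 < t - s by rewrite subr_gt0.
have m0 := semicircular_mean st0 sc.
rewrite (free_pair_sandwich fr) //; try exact: gen_sub.
by rewrite (semicircular_variance st0 sc).
Qed.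

End SemicircularIncrement.

(** Traciality turns [y1 x1 x2 y2] into [x1 x2 y2 y1], a product of one element from each side. *)
Lemma free_pair_ip2 (S T : set A) (x1 x2 y1 y2 : A) : free_pair S T ->
  smallest unital_star_subalgebra S x1 -> smallest unital_star_subalgebra S x2 ->
  smallest unital_star_subalgebra T y1 -> smallest unital_star_subalgebra T y2 ->
  star x1 = x1 -> star y1 = y1 ->
  tau (star (x1 * y1) * (x2 * y2)) = tau (x1 * x2) * tau (y2 * y1).
Proof.
move=> fST Sx1 Sx2 Ty1 Ty2 sx sy; rewrite starM sx sy -mulrA tauC.
rewrite mulrA -mulrA (free_pairM fST) //.
- exact: (subalgM (gen_subalg S)).
- exact: (subalgM (gen_subalg T)).
Qed.

Variables x y : R -> A.
Hypothesis x_bm : semicircular_brownian_motion Ft x.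
Hypothesis y_bm : semicircular_brownian_motion Ft y.
Hypothesis xy_free : free_pair [set x t | t in [set t | 0 <= t]]
                               [set y t | t in [set t | 0 <= t]].

(* The increments of [x] and [y] are each free from [Ft s], but nothing is
   assumed about their joint freeness from it. Refining the partition of
   [s, t], the off-diagonal terms vanish by adaptedness, and freeness of [x]
   from [y] makes the diagonal sum small in L^2. *)
Lemma bm_cross_increment s t a : 0 <= s -> s <= t -> Ft s a ->
  rtr (a * ((x t - x s) * (y t - y s))) = 0.
Proof.
move=> s0 st sa.
suff small n : (0 < n)%N ->
    rtr (a * ((x t - x s) * (y t - y s))) ^+ 2 <= norm2 a ^+ 2 * (t - s) ^+ 2 / n%:R.
  apply/eqP; rewrite -sqrf_eq0; apply/eqP/le_anti; rewrite sqr_ge0 andbT.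
  apply/ler_addgt0Pr => e e0; rewrite add0r.
  set C := norm2 a ^+ 2 * (t - s) ^+ 2 in small.
  have C0 : 0 <= C by rewrite mulr_ge0 ?sqr_ge0.
  have [n hn] : exists n : nat, C / e < n%:R.
    by exists (Num.truncn (C / e)).+1; apply: truncnS_gt.
  have n0 : (0 < n)%N.
    by rewrite -(ltr_nat R); apply: le_lt_trans hn; rewrite divr_ge0 // ltW.
  apply: le_trans (small n n0) _; rewrite ler_pdivrMr ?ltr0n //.
  by move: hn; rewrite ltr_pdivrMr // mulrC => /ltW.
move=> n0; pose h := (t - s) / n%:R; pose u (i : nat) := s + i%:R * h.
have h0 : 0 <= h by rewrite divr_ge0 // ?subr_ge0.
have nn0 : n%:R != 0 :> R by rewrite pnatr_eq0 -lt0n.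
have us : u 0%N = s by rewrite /u mul0r addr0.
have ut : u n = t by rewrite /u /h mulrCA mulfV // mulr1 subrKC.
have u_le i j : (i <= j)%N -> u i <= u j.
  by move=> ij; rewrite lerD2l ler_wpM2r // ler_nat.
have u0 i : 0 <= u i by apply: le_trans s0 _; rewrite -us u_le.
have su i : s <= u i by rewrite -us u_le.
have uS i : u i.+1 - u i = h by rewrite /u -natr1; ring.
pose X i := x (u i.+1) - x (u i); pose Y i := y (u i.+1) - y (u i).
have dxE : x t - x s = \sum_(i < n) X i.
  by rewrite -us -ut -(big_mkord predT X) telescope_sumr.
have dyE : y t - y s = \sum_(i < n) Y i.
  by rewrite -us -ut -(big_mkord predT Y) telescope_sumr.
have aF i : Ft (u i) a by apply: Ft_le sa.
have XF i j : (i < j)%N -> Ft (u j) (X i).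
  move=> ij; apply: (@Ft_le (u i.+1)) => //; first exact: u_le.
  by apply: (bm_adapted x_bm) => //; exact: u_le.
have YF i j : (i < j)%N -> Ft (u j) (Y i).
  move=> ij; apply: (@Ft_le (u i.+1)) => //; first exact: u_le.
  by apply: (bm_adapted y_bm) => //; exact: u_le.
have off (i j : nat) : i != j -> rtr (a * (X i * Y j)) = 0.
  rewrite neq_ltn => /orP[ij|ji].
    rewrite mulrA /rtr (bm_increment_mean y_bm) //; first exact: u_le.
    by apply: (subalgM (Ft_subalg (u0 j))) => //; exact: XF.
  rewrite mulrA rtrC mulrA /rtr (bm_increment_mean x_bm) //; first exact: u_le.
  by apply: (subalgM (Ft_subalg (u0 i))) => //; exact: YF.
pose Z := \sum_(i < n) X i * Y i.
have aZ : rtr (a * ((x t - x s) * (y t - y s))) = rtr (a * Z).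
  rewrite dxE dyE mulr_suml mulr_sumr rtr_sum /Z mulr_sumr rtr_sum.
  apply: eq_bigr => i _; rewrite mulr_sumr mulr_sumr rtr_sum (bigD1 i) //=.
  by rewrite big1 ?addr0 // => j ji; apply: off; rewrite eq_sym.
have XS i : smallest unital_star_subalgebra [set x t | t in [set t | 0 <= t]] (X i).
  by apply: (subalgB (gen_subalg _)); apply: gen_sub; [exists (u i.+1) => //; exact: u0|exists (u i) => //; exact: u0].
have YS i : smallest unital_star_subalgebra [set y t | t in [set t | 0 <= t]] (Y i).
  by apply: (subalgB (gen_subalg _)); apply: gen_sub; [exists (u i.+1) => //; exact: u0|exists (u i) => //; exact: u0].
have sX i : star (X i) = X i by apply: (bm_increment_star x_bm) => //; exact: u_le.
have sY i : star (Y i) = Y i by apply: (bm_increment_star y_bm) => //; exact: u_le.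
have XX i j : tau (X i * X j) = if i == j then h%:C else 0.
  case: eqVneq => [<-|].
    have := @bm_increment_cov x x_bm (u i) (u i.+1) 1 1 (u0 i) (u_le _ _ (leqnSn i))
      (subalg1 (Ft_subalg (u0 i))) (subalg1 (Ft_subalg (u0 i))).
    by rewrite !mul1r tau1 !mul1r uS.
  rewrite neq_ltn => /orP[ij|ji]; last rewrite tauC.
    by rewrite (bm_increment_mean x_bm) //; [exact: u_le|exact: XF].
  by rewrite (bm_increment_mean x_bm) //; [exact: u_le|exact: XF].
have YY i : tau (Y i * Y i) = h%:C.
  have := @bm_increment_cov y y_bm (u i) (u i.+1) 1 1 (u0 i) (u_le _ _ (leqnSn i))
    (subalg1 (Ft_subalg (u0 i))) (subalg1 (Ft_subalg (u0 i))).
  by rewrite !mul1r tau1 !mul1r uS.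
(* Distinct increments of [x] are orthogonal, so only the [n] diagonal pairs contribute, each with
   [h ^+ 2]. *)
have Z2 : norm2 Z ^+ 2 = (t - s) ^+ 2 / n%:R.
  rewrite sqr_norm2 /l2ip /rtr /Z (big_morph (@star R A) (@starD R A) (@star0 R A)).
  rewrite mulr_suml tau_sum.
  under eq_bigr => i _.
    rewrite mulr_sumr tau_sum (bigD1 i) //= big1; last first.
      move=> j ji; rewrite (free_pair_ip2 xy_free) // XX.
      by rewrite -val_eqE eq_sym in ji; rewrite (negbTE ji) mul0r.
    rewrite addr0 (free_pair_ip2 xy_free) // XX eqxx YY -rmorphM /=.
    over.
  rewrite big_const card_ord iter_addr addr0 -rmorphMn /= /h -mulr_natl.
  by field.
rewrite aZ -mulrA -Z2 -exprMn -(real_normK (num_real (rtr _))) ler_sqr ?nnegrE ?mulr_ge0 ?norm2_ge0 //.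
exact: rtrM_le.
Qed.

Variable c : R -> A.
Hypothesis c_def : forall t : R, 0 <= t ->
  c t = ((Num.sqrt 2)^-1)%:C *: (x t + (0 +i* 1) *: y t).

Let ii : R[i] := 0 +i* 1.
Let kk : R := (Num.sqrt 2)^-1.

Let kk2 : kk * kk = 2^-1.
Proof. by rewrite /kk -invfM -expr2 sqr_sqrtr. Qed.

Let c_incr s t : 0 <= s -> s <= t ->
  c t - c s = kk%:C *: ((x t - x s) + ii *: (y t - y s)).
Proof.
move=> s0 st; rewrite !c_def ?(le_trans s0) // -/kk -/ii -scalerBr; congr (_ *: _).
by rewrite opprD addrACA -scalerBr.
Qed.

Let c_incr_star s t : 0 <= s -> s <= t ->
  star (c t - c s) = kk%:C *: ((x t - x s) - ii *: (y t - y s)).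
Proof.
move=> s0 st; rewrite c_incr // starZr starD starZ.
rewrite (bm_increment_star x_bm) // (bm_increment_star y_bm) //.
rewrite -scaleNr; congr (_ *: (_ + _ *: _)).
by apply/eqP; rewrite eq_complex /= oppr0 !eqxx.
Qed.

Lemma circular_adapted s t : 0 <= s -> s <= t -> Ft t (c t - c s).
Proof.
move=> s0 st; have sF := Ft_subalg (le_trans s0 st); rewrite c_incr //.
apply: (subalgZ sF); apply: (subalgD sF); first exact: (bm_adapted x_bm).
by apply: (subalgZ sF); exact: (bm_adapted y_bm).
Qed.

Lemma circular_mean s t a : 0 <= s -> s <= t -> Ft s a -> tau (a * (c t - c s)) = 0.
Proof.
move=> s0 st sa; rewrite c_incr // -scalerAr mulrDr -scalerAr tauZ tauD tauZ.
by rewrite (bm_increment_mean x_bm) // (bm_increment_mean y_bm) // mulr0 addr0 mulr0.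
Qed.

(** With [dx] and [dy] the increments, the product is half of [dx^2 + dy^2 + i (dy dx - dx dy)]. The
    cross terms have zero real trace by [bm_cross_increment], and each square contributes
    [t - s]. *)
Lemma circular_variance s t a : 0 <= s -> s <= t -> Ft s a ->
  rtr (a * ((c t - c s) * star (c t - c s))) = rtr a * (t - s).
Proof.
move=> s0 st sa; have sF := Ft_subalg s0.
rewrite c_incr_star // c_incr //; set dx := x t - x s; set dy := y t - y s.
have F1 := subalg1 sF.
have xx : tau (a * (dx * dx)) = tau a * (t - s)%:C.
  by have := bm_increment_cov x_bm s0 st sa F1; rewrite mul1r tau1 mulr1 mulrA.
have yy : tau (a * (dy * dy)) = tau a * (t - s)%:C.
  by have := bm_increment_cov y_bm s0 st sa F1; rewrite mul1r tau1 mulr1 mulrA.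
have xy b : Ft s b -> rtr (b * (dx * dy)) = 0 by exact: bm_cross_increment.
have yx b : Ft s b -> rtr (b * (dy * dx)) = 0.
  move=> sb; rewrite -rtr_star !starM (bm_increment_star x_bm) //.
  rewrite (bm_increment_star y_bm) // rtrC.
  by apply: xy; exact: (subalg_star sF).
have -> : a * ((kk%:C *: (dx + ii *: dy)) * (kk%:C *: (dx - ii *: dy))) =
    (2^-1)%:C *: (a * (dx * dx) + a * (dy * dy) +
     ((ii *: a) * (dy * dx) - (ii *: a) * (dx * dy))).
  clear xx yy xy yx; move: dx dy => {}dx {}dy.
  have kE (u v : A) : (kk%:C *: u) * (kk%:C *: v) = (2^-1)%:C *: (u * v) :> A.
    by rewrite -scalerAl -scalerAr scalerA -rmorphM /= kk2.
  rewrite kE -scalerAr; congr (_ *: _).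
  have ii2 : ii * ii = -1.
    by apply/eqP; rewrite eq_complex /=; apply/andP; split; apply/eqP; ring.
  have yyE : (ii *: dy) * (ii *: dy) = - (dy * dy).
    by rewrite -scalerAl -scalerAr scalerA ii2 scaleN1r.
  have -> : (dx + ii *: dy) * (dx - ii *: dy) =
      dx * dx + dy * dy + (ii *: (dy * dx) - ii *: (dx * dy)).
    rewrite mulrDl !mulrBr yyE opprK -scalerAl -scalerAr.
    by rewrite (addrC (ii *: (dy * dx))) addrACA (addrC (- _)).
  by rewrite !mulrDr mulrN -!scalerAr -!scalerAl.
rewrite rtrZ !rtrD rtrN xy; last exact: (subalgZ sF).
rewrite yx; last exact: (subalgZ sF).
rewrite subr0 addr0 /rtr xx yy mulrC; case: (tau a) => p q /=.
by field.
Qed.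

(** The increment of [c + c^*] is [sqrt 2] times that of [x], so the covariance of one semicircular
    motion decides. The square of [sqrt 2] is the factor 2. *)
Lemma circular_real_cov s t a b : 0 <= s -> s <= t -> Ft s a -> Ft s b -> star b = b ->
  let d := (c t - c s) + star (c t - c s) in
  rtr (a * d * (b * d)) = 2 * rtr a * rtr b * (t - s).
Proof.
move=> s0 st sa sb bb d; rewrite /d c_incr_star // c_incr //.
set dx := x t - x s; set dy := y t - y s.
have -> : kk%:C *: (dx + ii *: dy) + kk%:C *: (dx - ii *: dy) = (2 * kk)%:C *: dx.
  rewrite -scalerDr addrACA subrr addr0 -mulr2n -scaler_nat scalerA.
  by congr (_ *: _); rewrite mulrC rmorphM /= rmorph_nat.
rewrite -!scalerAr -scalerAl !scalerA -rmorphM /= mulrACA kk2.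
rewrite rtrZ /rtr (bm_increment_cov x_bm) // (tau_selfadjoint bb).
by case: (tau a) => p q /=; field.
Qed.

Lemma circular_disjoint s s' u u' a b : 0 <= s -> s <= s' -> s' <= u -> u <= u' ->
  Ft s a -> Ft u b -> l2ip (a * (c s' - c s)) (b * (c u' - c u)) = 0.
Proof.
move=> s0 ss' s'u uu' sa ub; have s'0 := le_trans s0 ss'; have u0 := le_trans s'0 s'u.
have sF := Ft_subalg u0.
rewrite /l2ip /rtr mulrA circular_mean //.
apply: (subalgM sF) => //; apply: (subalg_star sF).
apply: (subalgM sF); first by apply: Ft_le sa => //; exact: le_trans s'u.
by apply: (@Ft_le s') => //; exact: circular_adapted.
Qed.

Lemma circular_same s t a b : 0 <= s -> s <= t -> Ft s a -> Ft s b ->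
  l2ip (a * (c t - c s)) (b * (c t - c s)) = l2ip a b * (t - s).
Proof.
move=> s0 st sa sb; have sF := Ft_subalg s0.
rewrite /l2ip starM -mulrA rtrC -!mulrA -circular_variance ?mulrA //.
by apply: (subalgM sF) => //; exact: (subalg_star sF).
Qed.

(** Both intervals are cut at the ends of their intersection: disjoint pieces are orthogonal and the
    common piece falls under [circular_same]. The maximum with 0 covers an empty intersection. *)
Lemma circular_isometry s s' u u' a b : 0 <= s -> s <= s' -> 0 <= u -> u <= u' ->
  Ft s a -> Ft u b ->
  l2ip (a * (c s' - c s)) (b * (c u' - c u)) =
  l2ip a b * Num.max 0 (Num.min s' u' - Num.max s u).
Proof.
move=> s0 ss' u0 uu' sa ub.
wlog su : s s' u u' a b s0 ss' u0 uu' sa ub / s <= u => [wl|].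
  case/orP: (le_total s u) => ?; first exact: wl.
  rewrite l2ipC (l2ipC a) (minC s') (maxC s); exact: wl.
rewrite (max_r su).
have [s'u|us'] := leP s' u.
  rewrite circular_disjoint // max_l ?mulr0 // subr_le0.
  by rewrite (le_trans _ s'u) // ge_min lexx.
rewrite (_ : a * (c s' - c s) = a * (c u - c s) + a * (c s' - c u)); last first.
  by rewrite -mulrDr (addrC (c u - c s)) addrA subrK.
rewrite l2ipDl circular_disjoint // add0r.
have {}sa : Ft u a by exact: Ft_le sa.
have {}us' := ltW us'.
rewrite max_r; last by rewrite subr_ge0 le_min us'.
wlog s'u' : s' u' a b sa ub us' uu' {ss'} / s' <= u' => [wl|].
  case/orP: (le_total s' u') => ?; first exact: wl.
  by rewrite l2ipC (l2ipC a) minC; exact: wl.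
rewrite (min_l s'u').
rewrite (_ : b * (c u' - c u) = b * (c s' - c u) + b * (c u' - c s')); last first.
  by rewrite -mulrDr (addrC (c s' - c u)) addrA subrK.
rewrite l2ipDr circular_same // (@circular_disjoint u s') ?addr0 //.
by apply: Ft_le ub.
Qed.

End BrownianIncrements.

(** * Integrals of real step functions *)

Section StepFunctions.
Context {R : realType}.
Implicit Types (L : seq (R * (R * R))) (t : R).

Definition step_fun L (r : R) : R := \sum_(p <- L) p.1 * \1_(`[p.2.1, p.2.2[%classic) r.

Lemma measurable_step_fun L (D : set R) : measurable_fun D (step_fun L).
Proof.
apply: measurable_sum => p; apply: measurable_funM; first exact: measurable_cst.
exact: measurable_indic.
Qed.

(** The maximum with 0 allows reversed endpoints, for which the indicator is that of the empty set;
    these occur among the intersections listed in [gram]. *)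
Lemma step_fun_integral L t : (forall p, p \in L -> 0 <= p.2.1 /\ p.2.2 <= t) ->
  lebesgue_measure.-integrable `[0, t[ (EFin \o step_fun L) /\
  (\int[lebesgue_measure]_(r in `[0%R, t[) (step_fun L r)%:E)%E =
    (\sum_(p <- L) p.1 * Num.max 0 (p.2.2 - p.2.1))%:E.
Proof.
elim: L => [|p L IH] hL.
  rewrite big_nil; have e : EFin \o step_fun [::] = cst 0%E.
    by apply/funext => r; rewrite /= /step_fun big_nil.
  split; first by rewrite e; apply: integrable0.
  rewrite (eq_integral (cst 0%E)) ?integral0 // => r _.
  by rewrite /step_fun big_nil.
have [|iL intL] := IH; first by move=> q qL; apply: hL; rewrite inE qL orbT.
have [p0 pt] := hL p (mem_head _ _).
pose f (r : R) := (\1_(`[p.2.1, p.2.2[%classic) r)%:E : \bar R.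
have if1 : lebesgue_measure.-integrable `[0, t[ f.
  apply: (@integrableS _ _ _ _ setT) => //.
  exact: (integrable_indic_itv p.2.1 p.2.2 true true).
have if2 : lebesgue_measure.-integrable `[0, t[ (fun r => (p.1)%:E * f r)%E.
  exact: integrableZl.
have e : EFin \o step_fun (p :: L) = ((fun r => (p.1)%:E * f r)%E \+ (EFin \o step_fun L))%E.
  by apply/funext => r; rewrite /= /step_fun big_cons EFinD EFinM.
split; first by rewrite e; apply: integrableD.
rewrite -[LHS]/(\int[lebesgue_measure]_(r in `[0%R, t[) (EFin \o step_fun (p :: L)) r)%E e.
rewrite integralD // intL integralZl // big_cons EFinD; congr (_ + _)%E.
rewrite EFinM; congr (_ * _)%E.
rewrite /f integral_indic // setIidl; last first.
  move=> r /=; rewrite !in_itv /= => /andP[h1 h2].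
  by rewrite (le_trans p0 h1) (lt_le_trans h2 pt).
apply: etrans (lebesgue_measure_itv `[p.2.1, p.2.2[%R) _.
rewrite /= lte_fin -EFinB.
by case: ltP => h; [rewrite max_r // subr_ge0 ltW|rewrite max_l // subr_le0].
Qed.

End StepFunctions.

(** * The Ito isometry and the splitting of simple processes *)

Section ItoIntegral.
Context {R : realType} {A : wstar_probability_space R}.
Variable Ft : R -> set A.
Hypothesis Ft_filtration : filtration Ft.
Variable c : R -> A.
Hypothesis c_circ : circular_brownian_motion Ft c.
Implicit Types (a b : A) (s t u : R) (th : @simple_process R A).

Lemma cbm_mean s t a : 0 <= s -> s <= t -> Ft s a -> tau (a * (c t - c s)) = 0.
Proof. by have [x [y [hx hy _ hc]]] := c_circ; exact: (circular_mean hx hy hc). Qed.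

Lemma cbm_variance s t a : 0 <= s -> s <= t -> Ft s a ->
  rtr (a * ((c t - c s) * star (c t - c s))) = rtr a * (t - s).
Proof.
by have [x [y [hx hy xy hc]]] := c_circ; exact: (circular_variance Ft_filtration hx hy xy hc).
Qed.

Lemma cbm_real_cov s t a b : 0 <= s -> s <= t -> Ft s a -> Ft s b -> star b = b ->
  let d := (c t - c s) + star (c t - c s) in
  rtr (a * d * (b * d)) = 2 * rtr a * rtr b * (t - s).
Proof. by have [x [y [hx hy xy hc]]] := c_circ; exact: (circular_real_cov hx hy hc). Qed.

Lemma cbm_isometry s s' u u' a b : 0 <= s -> s <= s' -> 0 <= u -> u <= u' ->
  Ft s a -> Ft u b ->
  l2ip (a * (c s' - c s)) (b * (c u' - c u)) =
  l2ip a b * Num.max 0 (Num.min s' u' - Num.max s u).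
Proof.
by have [x [y [hx hy xy hc]]] := c_circ; exact: (circular_isometry Ft_filtration hx hy xy hc).
Qed.

Lemma l2ip0l a : l2ip (0 : A) a = 0.
Proof. by rewrite /l2ip star0 mul0r rtr0. Qed.

Lemma l2ip_suml I (r : seq I) (P : pred I) (F : I -> A) b :
  l2ip (\sum_(i <- r | P i) F i) b = \sum_(i <- r | P i) l2ip (F i) b.
Proof.
by rewrite (big_morph (fun a => l2ip a b) (fun x y => l2ipDl x y b) (l2ip0l b)).
Qed.

Lemma l2ip_sumr I (r : seq I) (P : pred I) (F : I -> A) b :
  l2ip b (\sum_(i <- r | P i) F i) = \sum_(i <- r | P i) l2ip b (F i).
Proof. by rewrite l2ipC l2ip_suml; apply: eq_bigr => i _; exact: l2ipC. Qed.

(** The squared L^2 norm of a simple process is the step function carried by the pairwise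
    intersections of its intervals. In this form both sides of the isometry are the same finite
    double sum. *)
Definition gram th : seq (R * (R * R)) :=
  [seq (l2ip e.2 f.2, (Num.max e.1.1 f.1.1, Num.min e.1.2 f.1.2)) | e <- th, f <- th].

Lemma simple_value_l2ip th a r :
  l2ip (simple_value th r) a = step_fun [seq (l2ip e.2 a, e.1) | e <- th] r.
Proof.
rewrite /step_fun big_map /simple_value l2ip_suml big_mkcond /=.
apply: eq_bigr => e _; rewrite indicE mem_setE in_itv /=.
by case: ifP; rewrite ?mulr1 ?mulr0.
Qed.

Lemma simple_value_norm th r : norm2 (simple_value th r) ^+ 2 = step_fun (gram th) r.
Proof.
rewrite sqr_norm2 /step_fun /gram big_allpairs_dep /= simple_value_l2ip /step_fun big_map.
apply: eq_bigr => e _; rewrite /= l2ipC simple_value_l2ip /step_fun big_map mulr_suml.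
apply: eq_bigr => f _; rewrite /= l2ipC !indicE !mem_setE !in_itv /= ge_max lt_min.
by case: (e.1.1 <= r); case: (r < e.1.2); case: (f.1.1 <= r); case: (r < f.1.2);
  rewrite /= ?mulr1 ?mulr0 ?mul0r.
Qed.

Lemma simple_isometry t th : simple_adapted Ft t th ->
  (norm2 (simple_integral th c) ^+ 2)%:E =
  (\int[lebesgue_measure]_(r in `[0%R, t[) (norm2 (simple_value th r) ^+ 2)%:E)%E.
Proof.
move=> hth; under eq_integral do rewrite simple_value_norm.
have [|_ ->] := @step_fun_integral _ (gram th) t.
  move=> p /allpairsP[[e f]] /= [/hth[e0 _ et _] /hth[f0 _ ft _] ->] /=.
  by rewrite le_max e0 ge_min et.
congr (_%:E); rewrite /gram big_allpairs_dep /= sqr_norm2 /simple_integral l2ip_suml.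
rewrite big_seq [RHS]big_seq; apply: eq_bigr => e /hth[e0 ee et eF].
rewrite l2ip_sumr big_seq [RHS]big_seq; apply: eq_bigr => f /hth[f0 ff ft fF].
exact: cbm_isometry.
Qed.

(** Intervals that start after [s] are dropped, since truncating them would reverse their endpoints.
    In [simple_after] an interval that ends before [s] merely collapses to a point. *)
Definition simple_before s th : @simple_process R A :=
  [seq (e.1.1, Num.min e.1.2 s, e.2) | e <- th & e.1.1 <= s].

Definition simple_after s th : @simple_process R A :=
  [seq (Num.max e.1.1 s, Num.max e.1.2 s, e.2) | e <- th].

Definition simple_opp th : @simple_process R A := [seq (e.1, - e.2) | e <- th].

Lemma simple_integral_split s th t : simple_adapted Ft t th ->
  simple_integral th c =
  simple_integral (simple_before s th) c + simple_integral (simple_after s th) c.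
Proof.
move=> hth; rewrite /simple_integral !big_map big_filter /= [X in _ = X + _]big_mkcond -big_split /=.
rewrite big_seq [RHS]big_seq; apply: eq_bigr => e /hth[e0 ee et eF].
case: leP => es.
  case: (leP e.1.2 s) => h; first by rewrite subrr mulr0 addr0.
  by rewrite -mulrDr (addrC (c s - _)) addrA subrK.
rewrite add0r max_l //; last by rewrite ltW // (lt_le_trans es).
Qed.

Lemma simple_integral_cat th th' :
  simple_integral (th ++ th') c = simple_integral th c + simple_integral th' c.
Proof. by rewrite /simple_integral big_cat. Qed.

Lemma simple_integral_opp th : simple_integral (simple_opp th) c = - simple_integral th c.
Proof.
by rewrite /simple_integral big_map -sumrN; apply: eq_bigr => e _; rewrite /= mulNr.
Qed.

Lemma simple_value_cat th th' r :
  simple_value (th ++ th') r = simple_value th r + simple_value th' r.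
Proof. by rewrite /simple_value big_cat. Qed.

Lemma simple_value_opp th r : simple_value (simple_opp th) r = - simple_value th r.
Proof. by rewrite /simple_value big_map -sumrN. Qed.

Lemma simple_value_before s th r : r < s -> simple_value (simple_before s th) r = simple_value th r.
Proof.
move=> rs; rewrite /simple_value big_map big_filter_cond /=; apply: eq_bigl => e.
rewrite lt_min rs andbT; case: (leP e.1.1 r) => er /=; last by rewrite andbF.
by rewrite (le_trans er (ltW rs)).
Qed.

Lemma simple_value_after s th r : s <= r -> simple_value (simple_after s th) r = simple_value th r.
Proof.
move=> sr; rewrite /simple_value big_map /=; apply: eq_bigl => e.
by rewrite ge_max sr andbT lt_max (ltNge r s) sr orbF.
Qed.

Lemma simple_value_after0 s th r : r < s -> simple_value (simple_after s th) r = 0.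
Proof.
move=> rs; rewrite /simple_value big_map /= big1 // => e.
by rewrite ge_max (leNgt s r) rs /= andbF.
Qed.

Lemma simple_adapted_before s t th : simple_adapted Ft t th -> simple_adapted Ft s (simple_before s th).
Proof.
move=> hth e' /mapP[e]; rewrite mem_filter => /andP[es /hth[e0 ee et eF]] -> /=.
by split=> //; [rewrite le_min ee|rewrite ge_min lexx orbT].
Qed.

Lemma simple_adapted_after s t th : s <= t -> simple_adapted Ft t th -> simple_adapted Ft t (simple_after s th).
Proof.
move=> st hth e' /mapP[e /hth[e0 ee et eF]] -> /=; split=> //.
- by rewrite le_max e0.
- by rewrite ge_max !le_max ee lexx !orbT.
- by rewrite ge_max et.
- by apply: (Ft_le Ft_filtration _ _ eF) => //; rewrite le_max lexx.
Qed.

Lemma simple_adapted_opp t th : simple_adapted Ft t th -> simple_adapted Ft t (simple_opp th).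
Proof.
move=> hth e' /mapP[e /hth[e0 ee et eF]] -> /=; split=> //.
exact: (subalgN (Ft_subalg Ft_filtration e0)).
Qed.

Lemma simple_adapted_cat t th th' : simple_adapted Ft t th -> simple_adapted Ft t th' ->
  simple_adapted Ft t (th ++ th').
Proof. by move=> h h' e; rewrite mem_cat => /orP[/h|/h']. Qed.

Lemma simple_after_martingale s t th a : 0 <= s -> simple_adapted Ft t th -> Ft s a ->
  rtr (a * simple_integral (simple_after s th) c) = 0.
Proof.
move=> s0 hth sa; rewrite /simple_integral mulr_sumr rtr_sum big_map big_seq big1 // => e.
move=> /hth[e0 ee et eF]; rewrite /= mulrA /rtr cbm_mean //.
- by rewrite le_max e0.
- by rewrite ge_max !le_max ee lexx !orbT.
- have m0 : 0 <= Num.max e.1.1 s by rewrite le_max e0.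
  apply: (subalgM (Ft_subalg Ft_filtration m0)).
    by apply: (Ft_le Ft_filtration _ _ sa) => //; rewrite le_max lexx orbT.
  by apply: (Ft_le Ft_filtration _ _ eF) => //; rewrite le_max lexx.
Qed.

End ItoIntegral.

(** * Local behaviour of the multiplicative Brownian motion *)

Section MultiplicativeIncrement.
Context {R : realType} {A : wstar_probability_space R}.
Variable Ft : R -> set A.
Hypothesis Ft_filtration : filtration Ft.
Variables c g : R -> A.
Hypothesis c_circ : circular_brownian_motion Ft c.
Hypothesis g_sol : free_multiplicative_brownian_motion Ft c g.
Implicit Types (a b : A) (s t u : R) (th : @simple_process R A).

Lemma norm2_wnorm a : norm2 a <= wnorm a.
Proof. exact/norm2_opbound/opbound_wnorm. Qed.

Lemma mbm_continuous s e : 0 <= s -> 0 < e ->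
  exists2 d, 0 < d & forall r, 0 <= r -> `|r - s| < d -> wnorm (g r - g s) < e.
Proof.
case: g_sol => _ gc _ _ s0 e0.
have := gc s s0 => /cvgrPdist_lt /(_ e e0).
rewrite near_withinE => /nbhs_ballP[d d0 hd]; exists d => // r r0 rs.
have := hd r; rewrite /ball /= distrC => /(_ rs r0).
by rewrite distrC subr0 => /(le_lt_trans (ler_norm _)).
Qed.

Lemma norm2_dist_le a b : `|norm2 a - norm2 b| <= norm2 (a - b).
Proof.
rewrite ler_norml; apply/andP; split.
  by rewrite lerNl opprB lerBlDr -(norm2N (a - b)) opprB -{1}(subrK a b) norm2D_le.
by rewrite lerBlDr -{1}(subrK b a) norm2D_le.
Qed.

Lemma mbm_continuous_norm : continuous (fun r : R => norm2 (g `|r|)).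
Proof.
move=> r; apply/cvgrPdist_lt => e e0.
have [d d0 hd] := mbm_continuous (normr_ge0 r) e0.
apply/nbhs_ballP; exists d => // u; rewrite /ball /= => ru.
rewrite distrC; apply: le_lt_trans (norm2_dist_le _ _) _.
apply: le_lt_trans (norm2_wnorm _) _; apply: hd => //.
by rewrite distrC (le_lt_trans (ler_dist_dist _ _)).
Qed.

Lemma mbm_continuous_l2ip a : continuous (fun r : R => l2ip a (g `|r|)).
Proof.
move=> r; apply/cvgrPdist_lt => e e0.
have n1 : 0 < norm2 a + 1 by rewrite ltr_wpDl ?norm2_ge0.
have [d d0 hd] := mbm_continuous (normr_ge0 r) (divr_gt0 e0 n1).
apply/nbhs_ballP; exists d => // u; rewrite /ball /= => ru.
rewrite distrC -l2ipNr -l2ipDr; apply: le_lt_trans (l2ip_CS _ _) _.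
have : wnorm (g `|u| - g `|r|) < e / (norm2 a + 1).
  by apply: hd => //; rewrite distrC (le_lt_trans (ler_dist_dist _ _)).
rewrite ltr_pdivlMr // => /(le_lt_trans _); apply.
rewrite mulrC ler_pM ?norm2_ge0 ?norm2_wnorm // lerDl //.
Qed.

Definition ito_error th r : R := norm2 (simple_value th r - g r) ^+ 2.

(** Expanding the square leaves a step function, the continuous squared norm of [g], and a cross
    term made of continuous functions times indicators. *)
Lemma measurable_ito_error th (i : interval R) : [set` i] `<=` `[0, +oo[ ->
  measurable_fun [set` i] (ito_error th).
Proof.
move=> i0.
pose f r := step_fun (gram th) r - 2 * l2ip (simple_value th r) (g `|r|) + norm2 (g `|r|) ^+ 2.
apply: (@eq_measurable_fun _ _ _ _ _ f).
  move=> r; rewrite inE => /i0 /=; rewrite in_itv /= andbT => r0.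
  rewrite /f /ito_error (ger0_norm r0) -simple_value_norm !sqr_norm2.
  rewrite !(l2ipDl, l2ipDr, l2ipNl, l2ipNr) (l2ipC (g r)); ring.
apply: measurable_funD; last first.
  apply: measurable_funX; apply: measurable_funTS.
  exact: continuous_measurable_fun mbm_continuous_norm.
apply: measurable_funB; first exact: measurable_step_fun.
apply: measurable_funM; first exact: measurable_cst.
pose f' r := \sum_(e <- th) l2ip e.2 (g `|r|) * \1_(`[e.1.1, e.1.2[%classic) r.
apply: (@eq_measurable_fun _ _ _ _ _ f').
  by move=> r _; rewrite simple_value_l2ip /step_fun big_map.
apply: measurable_sum => e; apply: measurable_funM.
  apply: measurable_funTS.
  exact: continuous_measurable_fun (@mbm_continuous_l2ip e.2).
exact: measurable_indic.
Qed.

Lemma ito_error_ge0 th r : 0 <= ito_error th r. Proof. exact: sqr_ge0. Qed.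

Lemma sqr_norm2B_le a b : norm2 (a - b) ^+ 2 <= 2 * norm2 a ^+ 2 + 2 * norm2 b ^+ 2.
Proof.
have h := norm2B_le a b; have n0 := norm2_ge0 (a - b).
apply: (@le_trans _ _ ((norm2 a + norm2 b) ^+ 2)).
  by rewrite ler_sqr ?nnegrE ?addr_ge0 ?norm2_ge0.
have := sqr_ge0 (norm2 a - norm2 b); rewrite sqrrB sqrrD; lra.
Qed.

Lemma ito_approx t e : 0 <= t -> 0 < e -> exists th,
  [/\ simple_adapted Ft t th,
    (\int[lebesgue_measure]_(r in `[0%R, t]) (ito_error th r)%:E < e%:E)%E &
    norm2 (simple_integral th c - (g t - 1)) < e].
Proof.
move=> t0 e0; case: g_sol => _ _ _ /(_ t t0)[th [had herr hint]].
have e0' : (0 < e%:E)%E by rewrite lte_fin.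
have [N1 _ h1] := herr _ (open_ereal_lt' e0').
move/cvgrPdist_lt: hint => /(_ e e0)[N2 _ h2].
exists (th (maxn N1 N2)); split => //.
  by apply: h1; rewrite /= leq_maxl.
have := h2 (maxn N1 N2); rewrite /= leq_maxr => /(_ isT).
by rewrite distrC subr0 => /(le_lt_trans (ler_norm _)).
Qed.

(** The Ito integral is known only through approximants chosen for each end time, so additivity over
    [[0, s]] and [[s, t]] is recovered from [th] for [t] and [th'] for [s]. Their mismatch before
    [s] is [rho], small by the isometry. The part of [th - g s] after [s] is [sig], whose integral
    [Q] is a martingale increment. The factor 3 counts the errors of [th], of [th'] and of [rho]. *)
Lemma mbm_increment_approx s t eps eta : 0 <= s -> s <= t -> 0 < eta ->
  (forall r, s <= r < t -> norm2 (g r - g s) <= eps) ->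
  exists Q : A, [/\ norm2 (g t - g s - g s * (c t - c s) - Q) <= 3 * eta,
    norm2 Q ^+ 2 <= eta ^+ 2 + 2 * eps ^+ 2 * (t - s) &
    forall a, Ft s a -> rtr (a * Q) = 0].
Proof.
move=> s0 st eta0 heps; have t0 := le_trans s0 st.
(* The two square errors enter [rho] with a factor 2 each, so a quarter of [eta ^+ 2] keeps the norm
   of its integral below [eta]. *)
pose e := Num.min eta (eta ^+ 2 / 4).
have e2 : eta ^+ 2 / 4 > 0 by rewrite divr_gt0 // exprn_gt0.
have e0 : 0 < e by rewrite lt_min eta0 e2.
have [th [had herr hint]] := ito_approx t0 e0.
have [th' [had' herr' hint']] := ito_approx s0 e0.
have gs : Ft s (g s) by case: g_sol => ad _ _ _; exact: ad.
pose rho := simple_before s th ++ simple_opp th'.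
pose z : @simple_process R A := [:: ((s, t), g s)].
have hz : simple_adapted Ft t z.
  by move=> e'; rewrite inE => /eqP -> /=.
pose sig := simple_after s (th ++ simple_opp z).
have adsz : simple_adapted Ft t (th ++ simple_opp z).
  by apply: simple_adapted_cat => //; exact: (simple_adapted_opp Ft_filtration).
have adrho : simple_adapted Ft s rho.
  apply: simple_adapted_cat; first exact: simple_adapted_before had.
  exact: (simple_adapted_opp Ft_filtration).
have adsig : simple_adapted Ft t sig by exact: (simple_adapted_after Ft_filtration).
have sub0 (u : R) (b : bool) : [set` Interval (BLeft 0) (BSide b u)] `<=` `[0, +oo[.
  by move=> r /=; rewrite !in_itv /= => /andP[->].
have mE th0 (u : R) (b : bool) : measurable_fun [set` Interval (BLeft 0) (BSide b u)]
    (fun r => (ito_error th0 r)%:E).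
  by apply/measurable_EFinP; exact: measurable_ito_error (sub0 _ _).
have E0 th0 r : (0 <= (ito_error th0 r)%:E)%E by rewrite lee_fin ito_error_ge0.
have mV th0 (D : set R) : measurable_fun D (fun r => (norm2 (simple_value th0 r) ^+ 2)%:E).
  apply/measurable_EFinP; apply: (@eq_measurable_fun _ _ _ _ _ (step_fun (gram th0))).
    by move=> r _; rewrite simple_value_norm.
  exact: measurable_step_fun.
have V0 th0 r : (0 <= (norm2 (simple_value th0 r) ^+ 2)%:E)%E by rewrite lee_fin sqr_ge0.
have two0 : (0 <= 2 :> R) by [].
have errt : (\int[lebesgue_measure]_(r in `[0%R, t[) (ito_error th r)%:E <= (eta ^+ 2 / 4)%:E)%E.
  apply: le_trans (_ : _ <= \int[lebesgue_measure]_(r in `[0%R, t]) (ito_error th r)%:E)%E _.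
    by apply: ge0_subset_integral => //; [exact: (mE _ _ false)|apply: subset_itvl; rewrite bnd_simp].
  by apply: le_trans (ltW herr) _; rewrite lee_fin ge_min lexx orbT.
have errs' : (\int[lebesgue_measure]_(r in `[0%R, s[) (ito_error th' r)%:E <= (eta ^+ 2 / 4)%:E)%E.
  apply: le_trans (_ : _ <= \int[lebesgue_measure]_(r in `[0%R, s]) (ito_error th' r)%:E)%E _.
    by apply: ge0_subset_integral => //; [exact: (mE _ _ false)|apply: subset_itvl; rewrite bnd_simp].
  by apply: le_trans (ltW herr') _; rewrite lee_fin ge_min lexx orbT.
have errs : (\int[lebesgue_measure]_(r in `[0%R, s[) (ito_error th r)%:E <= (eta ^+ 2 / 4)%:E)%E.
  apply: le_trans errt; apply: ge0_subset_integral => //; first exact: (mE _ _ true).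
  apply: subset_itvl.
  by rewrite bnd_simp.
have nrho : norm2 (simple_integral rho c) <= eta.
  rewrite -ler_sqr ?nnegrE ?norm2_ge0 ?(ltW eta0) // -lee_fin.
  rewrite (simple_isometry Ft_filtration c_circ adrho).
  apply: le_trans (_ : _ <= \int[lebesgue_measure]_(r in `[0%R, s[)
      (2%:E * (ito_error th r)%:E + 2%:E * (ito_error th' r)%:E))%E _.
    apply: ge0_le_integral => //; first exact: mV.
    - by apply: emeasurable_funD; apply: measurable_funeM; exact: (mE _ _ true).
    - move=> r /=; rewrite in_itv /= => /andP[r0 rs].
      rewrite -!EFinM -EFinD lee_fin simple_value_cat simple_value_opp simple_value_before //.
      rewrite (_ : _ - _ = (simple_value th r - g r) - (simple_value th' r - g r)); last first.
        by rewrite opprB addrA subrK.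
      exact: sqr_norm2B_le.
  rewrite ge0_integralD //; first last.
  - by apply: measurable_funeM; exact: (mE _ _ true).
  - by move=> r _; rewrite mule_ge0.
  - by apply: measurable_funeM; exact: (mE _ _ true).
  - by move=> r _; rewrite mule_ge0.
  rewrite !ge0_integralZl_EFin //; try exact: (mE _ _ true).
  apply: le_trans (leeD (lee_wpmul2l _ errs) (lee_wpmul2l _ errs')) _ => //.
  by rewrite -!EFinM -EFinD lee_fin; lra.
exists (simple_integral sig c); split; last first.
- by move=> a sa; apply: (simple_after_martingale Ft_filtration c_circ _ adsz).
- rewrite -lee_fin (simple_isometry Ft_filtration c_circ adsig).
  apply: le_trans (_ : _ <= \int[lebesgue_measure]_(r in `[0%R, t[)
      (2%:E * (ito_error th r)%:E + (2 * eps ^+ 2)%:E * (\1_(`[s, t[%classic) r)%:E))%E _.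
    apply: ge0_le_integral => //; first exact: mV.
    - apply: emeasurable_funD; apply: measurable_funeM; first exact: (mE _ _ true).
      by apply/measurable_EFinP; exact: measurable_indic.
    - move=> r /=; rewrite in_itv /= => /andP[r0 rt].
      rewrite -!EFinM -EFinD lee_fin.
      have [rs|sr] := ltP r s.
        rewrite simple_value_after0 // norm20 expr0n /=.
        by rewrite addr_ge0 // mulr_ge0 ?ito_error_ge0 // mulr_ge0 ?sqr_ge0.
      rewrite simple_value_after // simple_value_cat simple_value_opp.
      rewrite {2}/simple_value big_cons big_nil /= sr rt /= addr0.
      rewrite indicE mem_setE in_itv /= sr rt mulr1.
      rewrite (_ : _ - _ = (simple_value th r - g r) - (g s - g r)); last first.
        by rewrite opprB addrA subrK.
      apply: le_trans (sqr_norm2B_le _ _) _.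
      rewrite lerD2l ler_pM2l // ler_sqr ?nnegrE ?norm2_ge0 //.
        by rewrite -norm2N opprB heps // sr.
      by apply: le_trans (norm2_ge0 (g r - g s)) _; rewrite heps // sr.
  rewrite ge0_integralD //; first last.
  - by apply: measurable_funeM; apply/measurable_EFinP; exact: measurable_indic.
  - by move=> r _; rewrite -EFinM lee_fin mulr_ge0 // mulr_ge0 ?sqr_ge0.
  - by apply: measurable_funeM; exact: (mE _ _ true).
  - by move=> r _; rewrite mule_ge0.
  have mI : measurable_fun `[0, t[ (fun r => (\1_(`[s, t[%classic : set R) r)%:E : \bar R).
    by apply/measurable_EFinP; exact: measurable_indic.
  have eps2 : 0 <= 2 * eps ^+ 2 by rewrite mulr_ge0 ?sqr_ge0.
  rewrite !ge0_integralZl_EFin //; try exact: (mE _ _ true).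
  rewrite integral_indic // setIidl; last by apply: subset_itvr; rewrite bnd_simp.
  rewrite [X in (_ + _ * X)%E](_ : _ = (t - s)%:E); last first.
    apply: etrans (lebesgue_measure_itv `[s, t[%R) _.
    rewrite /= lte_fin -EFinB; case: ltP => // ts.
    by congr (_%:E); apply/eqP; rewrite eq_sym subr_eq0 eq_le ts st.
  apply: le_trans (leeD (lee_wpmul2l _ errt) (lexx _)) _ => //.
  rewrite -!EFinM -EFinD lee_fin lerD2r.
  by have := sqr_ge0 eta; lra.
- have iE : simple_integral sig c + simple_integral rho c =
      simple_integral th c - simple_integral th' c - g s * (c t - c s).
    rewrite [X in _ = X - _ - _](simple_integral_split c s had).
    rewrite /sig /simple_after map_cat -/(simple_after s th) !simple_integral_cat simple_integral_opp.
    rewrite {2}/simple_integral big_cons big_nil /= maxxx (max_l st) addr0 mulNr.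
    by rewrite addrACA (addrC (simple_integral (simple_after s th) c)) (addrC (- (g s * _))) addrA.
  rewrite (_ : _ - simple_integral sig c =
    - (simple_integral th c - (g t - 1)) + (simple_integral th' c - (g s - 1)) +
      simple_integral rho c); last first.
    have -> : simple_integral rho c = simple_integral th c - simple_integral th' c -
        g s * (c t - c s) - simple_integral sig c by rewrite -iE (addrC (simple_integral sig c)) addrK.
    move: (simple_integral th c) (simple_integral th' c) (g s * _) (simple_integral sig c).
    move=> p q w z'; rewrite (opprB p).
    have E1 (x y : A) : x - p + (q - y) = x - y + (q - p).
      by rewrite (addrC q) addrACA (addrC (- p)).
    rewrite E1 (opprB (g s)) (addrA (g t - 1)) subrK -(opprB p).
    by rewrite -(addrA (p - q)) -(addrA (g t - g s) (- (p - q))) addKr addrA.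
  have -> : 3 * eta = eta + eta + eta by ring.
  have ee : e <= eta by rewrite ge_min lexx.
  apply: le_trans (norm2D_le _ _) _; apply: lerD => //.
  apply: le_trans (norm2D_le _ _) _; rewrite norm2N; apply: lerD.
    exact: le_trans (ltW hint) ee.
  exact: le_trans (ltW hint') ee.
Qed.

(** Replacing the integrand by its value at [s] costs only the oscillation [eps] of [g], so the
    remainder is negligible against [sqrt (t - s)], the size of the noise. *)
Lemma mbm_increment s t eps : 0 <= s -> s <= t ->
  (forall r, s <= r < t -> norm2 (g r - g s) <= eps) ->
  norm2 (g t - g s - g s * (c t - c s)) ^+ 2 <= 4 * eps ^+ 2 * (t - s).
Proof.
move=> s0 st heps; apply/ler_addgt0Pr => e e0.
(* Here [20 = 2 * 9 + 2]: the square error of the approximation and the term [eta ^+ 2] in the bound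
   on [Q], both doubled. *)
pose eta := Num.sqrt (e / 20).
have e20 : 0 < e / 20 by rewrite divr_gt0.
have eta0 : 0 < eta by rewrite sqrtr_gt0.
have etaE : eta ^+ 2 = e / 20 by rewrite sqr_sqrtr // ltW.
have [Q [h1 h2 _]] := mbm_increment_approx s0 st eta0 heps.
set rr := g t - g s - _ in h1 *.
have := sqr_norm2B_le (rr - Q) (- Q); rewrite opprK subrK norm2N.
have h3 : norm2 (rr - Q) ^+ 2 <= 9 * eta ^+ 2.
  have -> : 9 * eta ^+ 2 = (3 * eta) ^+ 2 by ring.
  by rewrite ler_sqr ?nnegrE ?norm2_ge0 // mulr_ge0 // ltW.
rewrite etaE in h2 h3; lra.
Qed.

(** Both [Q] and [g s (c t - c s)] have zero real trace against [Ft s], and the remainder is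
    arbitrarily small in L^2. Any bound on the oscillation of [g] will do; compactness of [[s, t]]
    supplies one. *)
Lemma mbm_martingale s t a : 0 <= s -> s <= t -> Ft s a -> rtr (a * (g t - g s)) = 0.
Proof.
move=> s0 st sa.
have gs : Ft s (g s) by case: g_sol => ad _ _ _; exact: ad.
have gsE : rtr (a * (g s * (c t - c s))) = 0.
  rewrite mulrA /rtr (cbm_mean c_circ) //.
  exact: (subalgM (Ft_subalg Ft_filtration s0)).
apply/eqP; rewrite -normr_eq0; apply/eqP/le_anti; rewrite normr_ge0 andbT.
apply/ler_addgt0Pr => e e0; rewrite add0r.
have n1 : 0 < norm2 a * 3 + 1 by rewrite ltr_wpDl // mulr_ge0 // norm2_ge0.
have eta0 : 0 < e / (norm2 a * 3 + 1) by rewrite divr_gt0.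
have [K hK] : exists K, forall r, s <= r < t -> norm2 (g r - g s) <= K.
  have [K hK] : exists K, forall r, r \in `[s, t]%R -> norm2 (g `|r|) <= K.
    have [|u _ hu] := @EVT_max R (fun r => norm2 (g `|r|)) s t st.
      by apply: continuous_subspaceT; exact: mbm_continuous_norm.
    by exists (norm2 (g `|u|)).
  exists (K + K) => r /andP[sr rt]; apply: le_trans (norm2B_le _ _) _; apply: lerD.
    have r0 := le_trans s0 sr.
    by have := hK r; rewrite (ger0_norm r0) in_itv /= sr (ltW rt); apply.
  by have := hK s; rewrite (ger0_norm s0) in_itv /= lexx st; apply.
have [Q [h1 _ h3]] := mbm_increment_approx s0 st eta0 hK.
set rr := g t - g s - _ in h1.
have -> : rtr (a * (g t - g s)) = rtr (a * (rr - Q)).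
  by rewrite /rr (mulrBr a _ Q) rtrB h3 // subr0 (mulrBr a _ (g s * _)) (rtrB (a * (g t - g s))) gsE subr0.
apply: le_trans (rtrM_le _ _) _; apply: le_trans (ler_wpM2l (norm2_ge0 _) h1) _.
by rewrite !mulrA ler_pdivrMr // [_ * e]mulrC ler_pM2l // lerDl.
Qed.

End MultiplicativeIncrement.

(** * First-order expansion of the resolvent trace *)

Section ResolventFlow.
Context {R : realType} {A : wstar_probability_space R}.
Variable Ft : R -> set A.
Hypothesis Ft_filtration : filtration Ft.
Variables c g : R -> A.
Hypothesis c_circ : circular_brownian_motion Ft c.
Hypothesis g_sol : free_multiplicative_brownian_motion Ft c g.
Implicit Types (a b : A) (s t u p : R).

Definition gsq u : A := g u * star (g u).

(** The default 0 is taken only where no resolvent exists; for [p > 0] and [u >= 0] existence and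
    uniqueness make the choice immaterial. *)
Definition resolv p u : A := xget 0 [set r | is_resolvent p (gsq u) r].

Lemma mbm_adapted u : 0 <= u -> Ft u (g u).
Proof. by case: g_sol => ad _ _ _; exact: ad. Qed.

Lemma resolvP p u : 0 < p -> 0 <= u ->
  [/\ Ft u (resolv p u), is_resolvent p (gsq u) (resolv p u) & opbound (resolv p u) p^-1].
Proof.
move=> p0 u0; have vF : von_neumann_subalgebra (Ft u).
  by case: Ft_filtration => h _; exact: h.
have [r Fr [hr br _]] := resolvent_exists vF (mbm_adapted u0) (opbound_wnorm (g u)) (lexx _) p0.
rewrite /resolv; case: xgetP => [y -> hy|/(_ r)] //.
by rewrite (resolvent_unique hy hr).
Qed.

Lemma gsq_star u : star (gsq u) = gsq u.
Proof. by rewrite starM starK. Qed.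

Lemma resolv_star p u : 0 < p -> 0 <= u -> star (resolv p u) = resolv p u.
Proof. by move=> p0 u0; have [_ h _] := resolvP p0 u0; apply: resolvent_star h; exact: gsq_star. Qed.

Lemma gsq_resolv p u : 0 < p -> 0 <= u -> gsq u * resolv p u = 1 - p%:C *: resolv p u.
Proof.
move=> p0 u0; have [_ [h _] _] := resolvP p0 u0.
by have := h; rewrite mulrDl -scalerAl mul1r => /(canRL (addKr _)) ->; rewrite addrC.
Qed.

(** A second-order expansion of [r' = r - r' D' r], where [D'] is the increment of [p + g g^*]. The
    drift of [g g^*] contributes [p N d], the quadratic variation [- 2 p N M d], and the motion of
    [p] contributes [- lam p N d]. Everything else is at most a constant times [eps d]. *)
Lemma resolvent_increment s t p p' (B eps lam : R) :
  let d := t - s in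
  let r := resolv p s in
  let N := rtr (gsq s * (r * r)) in
  let M := 1 - p * rtr r in
  let M' := 1 - p' * rtr (resolv p' t) in
  0 <= s -> s <= t -> 0 < p -> 0 < p' -> 1 <= B -> 0 < eps -> eps <= 1 ->
  opbound (g s) B -> p^-1 <= B -> p'^-1 <= B -> p <= B ->
  (forall u, s <= u <= t -> wnorm (g u - g s) <= eps) ->
  d <= eps ^+ 2 -> `|p' - p| <= B * d -> `|p' - p - lam * p * d| <= eps * d ->
  `|M' - M - p * N * (1 - lam - 2 * M) * d| <= 509 * B ^+ 10 * eps * d.
Proof.
move=> d r N M M' s0 st p0 p'0 B1 eps0 eps1 hg pB p'B p_le_B heps deps hd hlam.
have t0 := le_trans s0 st; have sF := Ft_subalg Ft_filtration s0.
have B0 : 0 <= B by lra.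
have d0 : 0 <= d by rewrite subr_ge0.
(* [h] is the size of the noise over a step of length [d]: a term is negligible once it carries [h]
   twice and [eps] once. *)
pose h := Num.sqrt d.
have h0 : 0 <= h by exact: sqrtr_ge0.
have hh : h * h = d by rewrite -expr2 sqr_sqrtr.
have h_eps : h <= eps by rewrite -ler_sqr ?nnegrE // ?(ltW eps0) // expr2 hh.
set gs := g s in hg *.
pose E := c t - c s; pose G := g t - gs; pose rr := G - gs * E.
have Fg : Ft s gs by exact: mbm_adapted.
have [Fr hr br] := resolvP p0 s0; rewrite -/r in Fr hr br.
have [_ hr' br'] := resolvP p'0 t0; set r' := resolv p' t in hr' br' M' *.
have sr : star r = r by exact: resolv_star.
have {}br : opbound r B by exact: opboundW br pB.
have {}br' : opbound r' B by exact: opboundW br' p'B.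
have oG : opbound G eps by apply: opboundW (opbound_wnorm _) _; rewrite heps // st lexx.
have nrr : norm2 rr <= 2 * eps * h.
  have e2h : 0 <= 2 * eps * h by rewrite !mulr_ge0 // ltW.
  rewrite -ler_sqr ?nnegrE ?norm2_ge0 //.
  have -> : (2 * eps * h) ^+ 2 = 4 * eps ^+ 2 * (t - s) by rewrite -/d -hh; ring.
  apply: (mbm_increment Ft_filtration c_circ g_sol) => // u /andP[su ut].
  by apply: le_trans (norm2_wnorm _) _; rewrite heps // su ltW.
have mart a : Ft s a -> rtr (a * G) = 0 by exact: (mbm_martingale Ft_filtration c_circ g_sol).
have var a : Ft s a -> rtr (a * (E * star E)) = rtr a * d.
  exact: (cbm_variance Ft_filtration c_circ).
have ngE : norm2 (gs * E) <= B * h.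
  rewrite -ler_sqr ?nnegrE ?norm2_ge0 ?mulr_ge0 // sqr_norm2 /l2ip starM.
  rewrite -mulrA rtrC -!mulrA [star gs * _]mulrA var; last first.
    by apply: (subalgM sF) => //; exact: (subalg_star sF).
  rewrite exprMn [h ^+ 2]expr2 hh ler_wpM2r // (le_trans (ler_norm _)) // expr2.
  by apply: rtr_opbound; apply: opboundM => //; exact: opbound_star.
have GE : G = gs * E + rr by rewrite /rr addrC subrK.
have nG : norm2 G <= 3 * B * h.
  rewrite GE (le_trans (norm2D_le _ _)) // (le_trans (lerD ngE nrr)) //.
  by rewrite -mulrDl ler_wpM2r //; lra.
pose D := gs * star G + G * star gs + G * star G.
have DE : gsq t = gsq s + D.
  rewrite /gsq (_ : g t = gs + G); last by rewrite /G addrC subrK.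
  by rewrite starD mulrDl !mulrDr /D -!addrA.
pose D' := (p' - p)%:C *: 1 + D.
have D'E : p'%:C *: 1 + gsq t = (p%:C *: 1 + gsq s) + D'.
  by rewrite /D' DE addrACA -scalerDl -rmorphD /= subrKC.
clearbody rr; have cov a b : Ft s a -> Ft s b -> star b = b ->
    rtr (a * (E + star E) * (b * (E + star E))) = 2 * rtr a * rtr b * d.
  by move=> Fa Fb sb; exact: (cbm_real_cov c_circ).
clearbody E G d.
have rE : r' = r - r' * D' * r.
  have D'2 : D' = (p'%:C *: 1 + gsq t) - (p%:C *: 1 + gsq s).
    by rewrite D'E (addrC _ D') addrK.
  have [_ h1] := hr'; have [h2 _] := hr.
  by rewrite D'2 mulrBr mulrBl h1 mul1r -(mulrA r') h2 mulr1 opprB addrC subrK.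
have osG : opbound (star G) eps by exact: opbound_star.
have osg : opbound (star gs) B by exact: opbound_star.
have dB : B * d <= B * (eps * h) by rewrite -hh ler_wpM2l // ler_wpM2r.
have oD' : opbound D' (4 * B * eps).
  apply: opboundW (opboundD (opboundZ _ opbound1) (opboundD (opboundD
    (opboundM hg osG) (opboundM oG osg)) (opboundM oG osG))) _.
  have : B * d <= B * eps by rewrite ler_wpM2l //; nra.
  by move: hd; nra.
(* [S] is the part of [D'] linear in the noise, of L^2 size [h]. [W] gathers the change of [p], the
   Ito remainder and the quadratic term, of size [eps h]. *)
pose S := gs * (E + star E) * star gs.
pose W := (p' - p)%:C *: 1 + (gs * star rr + rr * star gs + G * star G).
have D'SW : D' = S + W.
  have X : gs * star G + G * star gs = S + (gs * star rr + rr * star gs).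
    rewrite GE starD starM mulrDr !mulrDl addrACA; congr (_ + _).
    by rewrite /S mulrDr mulrDl addrC !mulrA.
  rewrite /D' /D X /W {X}; move: {-}S (_ *: 1) (gs * _ + _) (G * _) => *.
  by rewrite -addrA [LHS]addrCA.
have nW : norm2 W <= 8 * B * eps * h.
  have b1 : norm2 ((p' - p)%:C *: 1 : A) <= B * eps * h.
    apply: le_trans (norm2_opbound (opboundZ _ opbound1)) _.
    by rewrite mulr1 -mulrA; exact: le_trans hd dB.
  have b2 : norm2 (gs * star rr) <= B * (2 * eps * h).
    by apply: le_trans (norm2_mull _ hg) _; rewrite norm2_star ler_wpM2l.
  have b3 : norm2 (rr * star gs) <= B * (2 * eps * h).
    by apply: le_trans (norm2_mulr _ osg) _; rewrite ler_wpM2l.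
  have b4 : norm2 (G * star G) <= eps * (3 * B * h).
    by apply: le_trans (norm2_mull _ oG) _; rewrite norm2_star ler_wpM2l // ltW.
  apply: le_trans (norm2D_le _ _) _; apply: le_trans (lerD b1 (norm2D_le _ _)) _.
  apply: le_trans (lerD (lexx _) (lerD (norm2D_le _ _) b4)) _.
  apply: le_trans (lerD (lexx _) (lerD (lerD b2 b3) (lexx _))) _.
  by lra.
have nS : norm2 S <= 2 * B * B * h.
  have b1 : norm2 (gs * E * star gs) <= B * (B * h).
    by apply: le_trans (norm2_mulr _ osg) _; rewrite ler_wpM2l.
  have b2 : norm2 (gs * star E * star gs) <= B * (B * h).
    by rewrite -norm2_star !starM !starK mulrA.
  rewrite /S mulrDr mulrDl; apply: le_trans (norm2D_le _ _) _.
  apply: le_trans (lerD b1 b2) _.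
  by lra.
have nD' : norm2 D' <= 10 * B * B * h.
  rewrite D'SW; apply: le_trans (norm2D_le _ _) _; apply: le_trans (lerD nS nW) _.
  have : 8 * B * eps * h <= 8 * B * B * h.
    rewrite ler_wpM2r // ler_wpM2l ?mulr_ge0 //; lra.
  by move=> /(lerD (lexx (2 * B * B * h))) /le_trans; apply; lra.
have eps_ge0 := ltW eps0.
have rr2 : opbound (r * r) (B * B) by exact: opboundM.
have Frr : Ft s (r * r) by exact: (subalgM sF).
have Fsg : Ft s (star gs) by exact: (subalg_star sF).
have NE : rtr (star gs * (r * r) * gs) = N by rewrite rtrC mulrA.
(* The terms linear in [G] vanish by the martingale property; what remains is [G G^*], evaluated by
   the variance of [E]. *)
have T1 : `|rtr (r * r * D) - N * d| <= 8 * B ^+ 3 * eps * d.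
  have z1 : rtr (r * r * (G * star gs)) = 0.
    by rewrite mulrA rtrC mulrA mart //; exact: (subalgM sF).
  have z2 : rtr (r * r * (gs * star G)) = 0.
    by rewrite -rtr_star !starM starK sr rtrC z1.
  have GG : G * star G = gs * E * star (gs * E) + (gs * E * star rr + rr * star G).
    by rewrite {1}GE mulrDl {1}GE starD mulrDr addrA.
  have m1 : rtr (r * r * (gs * E * star (gs * E))) = N * d.
    rewrite starM -NE -var; last by apply: (subalgM sF) => //; exact: (subalgM sF).
    by rewrite rtrC -!mulrA rtrC -!mulrA rtrC -!mulrA rtrC -!mulrA rtrC -!mulrA.
  rewrite /D !mulrDr !rtrD z1 z2 !add0r GG !mulrDr !rtrD m1 (addrC (N * d)) addrK.
  have b1 : `|rtr (r * r * (gs * E * star rr))| <= B * B * (B * h) * (2 * eps * h).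
    rewrite mulrA; apply: le_trans (rtrM_le _ _) _; rewrite norm2_star.
    apply: ler_pM; rewrite ?norm2_ge0 //.
    apply: le_trans (norm2_mull _ rr2) _.
    by rewrite ler_wpM2l // mulr_ge0.
  have b2 : `|rtr (r * r * (rr * star G))| <= B * B * (2 * eps * h) * (3 * B * h).
    rewrite mulrA; apply: le_trans (rtrM_le _ _) _; rewrite norm2_star.
    apply: ler_pM; rewrite ?norm2_ge0 //.
    apply: le_trans (norm2_mull _ rr2) _.
    by rewrite ler_wpM2l // mulr_ge0.
  apply: le_trans (ler_normD _ _) _; apply: le_trans (lerD b1 b2) _.
  by rewrite -hh le_eqVlt; apply/orP; left; apply/eqP; ring.
(* Only the pair of factors [S] counts. The covariance of [E + E^*] splits the trace at the two
   noises, into [rtr (gs^* r^2 gs) = N] and [rtr (gs^* r gs) = M]. *)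
have T2 : `|rtr (r * r * D' * (r * D')) - 2 * N * M * d| <= 96 * B ^+ 6 * eps * d.
  have m2 : rtr (r * r * S * (r * S)) = 2 * N * M * d.
    have ME : rtr (star gs * r * gs) = M.
      by rewrite rtrC mulrA -/(gsq s) gsq_resolv // rtrB rtr1 rtrZ.
    rewrite -NE -ME -cov //; last 3 first.
    - by apply: (subalgM sF) => //; exact: (subalgM sF).
    - by apply: (subalgM sF) => //; exact: (subalgM sF).
    - by rewrite !starM starK sr mulrA.
    rewrite /S; set F := E + star E.
    have -> : r * r * (gs * F * star gs) * (r * (gs * F * star gs)) =
      (r * r * gs * F * (star gs * r * gs * F)) * star gs by rewrite !mulrA.
    by rewrite rtrC !mulrA.
  have -> : rtr (r * r * D' * (r * D')) = rtr (r * r * S * (r * S)) +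
      (rtr (r * r * W * (r * D')) + rtr (r * r * S * (r * W))).
    rewrite -!rtrD; congr rtr; rewrite {1}D'SW mulrDr mulrDl [X in _ = _ + X]addrC addrA; congr (_ + _).
    by rewrite -mulrDr -mulrDr -D'SW.
  rewrite m2 (addrC (2 * N * M * d)) addrK.
  have br2 : opbound r B by [].
  have b1 : `|rtr (r * r * W * (r * D'))| <= B * B * (8 * B * eps * h) * (B * (10 * B * B * h)).
    apply: le_trans (rtrM_le _ _) _; apply: ler_pM; rewrite ?norm2_ge0 //.
      by apply: le_trans (norm2_mull _ rr2) _; rewrite ler_wpM2l // mulr_ge0.
    by apply: le_trans (norm2_mull _ br) _; rewrite ler_wpM2l.
  have b2 : `|rtr (r * r * S * (r * W))| <= B * B * (2 * B * B * h) * (B * (8 * B * eps * h)).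
    apply: le_trans (rtrM_le _ _) _; apply: ler_pM; rewrite ?norm2_ge0 //.
      by apply: le_trans (norm2_mull _ rr2) _; rewrite ler_wpM2l // mulr_ge0.
    by apply: le_trans (norm2_mull _ br) _; rewrite ler_wpM2l.
  apply: le_trans (ler_normD _ _) _; apply: le_trans (lerD b1 b2) _.
  by rewrite -hh le_eqVlt; apply/orP; left; apply/eqP; ring.
have orDr : opbound (r' * D' * r) (B * (4 * B * eps) * B).
  by apply: opboundM => //; exact: opboundM.
(* Of the three factors [D'], one is bounded in operator norm by a multiple of [eps] and two in L^2
   norm by a multiple of [h]. *)
have T3 : `|rtr (r' * D' * r * D' * (r * D' * r))| <= 400 * B ^+ 9 * eps * d.
  apply: le_trans (rtrM_le _ _) _.
  apply: le_trans (_ : _ <= B * (4 * B * eps) * B * (10 * B * B * h) * (B * (B * (10 * B * B * h)))) _.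
    apply: ler_pM; rewrite ?norm2_ge0 //.
      apply: le_trans (norm2_mull _ orDr) _; rewrite ler_wpM2l //.
      exact: opbound_ge0 orDr.
    apply: le_trans (norm2_mulr _ br) _; rewrite ler_wpM2l //.
    by apply: le_trans (norm2_mull _ br) _; rewrite ler_wpM2l.
  by rewrite -hh le_eqVlt; apply/orP; left; apply/eqP; ring.
have T4 : `|(p' - p) * rtr (r' * D' * r)| <= 4 * B ^+ 4 * eps * d.
  rewrite normrM; apply: le_trans (_ : _ <= (B * d) * (B * (4 * B * eps) * B)) _.
    by apply: ler_pM => //; exact: rtr_opbound.
  by lra.
have T5 : `|(p' - p - lam * p * d) * N| <= B ^+ 4 * eps * d.
  rewrite normrM; apply: le_trans (_ : _ <= (eps * d) * (B * B * (B * B))) _.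
    apply: ler_pM => //; apply: rtr_opbound; apply: opboundM => //.
    by apply: opboundM.
  by lra.
have N2 : N = rtr r - p * rtr (r * r).
  by rewrite /N mulrA gsq_resolv // mulrBl mul1r -scalerAl rtrB rtrZ.
pose y1 := rtr (r' * D' * r); pose t1 := rtr (r * r * D).
pose t2 := rtr (r * r * D' * (r * D')); pose t3 := rtr (r' * D' * r * D' * (r * D' * r)).
have e1 : rtr r' = rtr r - y1 by rewrite {1}rE rtrB.
(* The resolvent identity is inserted twice more, so that [r'] survives only in the negligible cubic
   term [t3]. *)
have e2 : y1 = (p' - p) * rtr (r * r) + t1 - t2 + t3.
  have f1 : rtr (r * D' * r) = (p' - p) * rtr (r * r) + t1.
    by rewrite rtrC mulrA /D' mulrDr -scalerAr mulr1 rtrD rtrZ.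
  have f2 : rtr (r * D' * r * D' * r) = t2 by rewrite rtrC /t2 !mulrA.
  rewrite /y1 {1}rE !mulrBl rtrB f1.
  have -> : rtr (r' * D' * r * D' * r) = t2 - t3.
    by rewrite {1}rE !mulrBl rtrB f2 /t3 !mulrA.
  by ring.
have -> : M' - M - p * N * (1 - lam - 2 * M) * d =
   - ((p' - p - lam * p * d) * N) + p * (t1 - N * d) - p * (t2 - 2 * N * M * d) + p * t3
   + (p' - p) * y1.
  have key : p * y1 - (p' - p) * rtr r = p * (t1 - t2 + t3) - (p' - p) * N.
    by rewrite e2 N2; ring.
  have ME : p * rtr r = 1 - M by rewrite /M; ring.
  by rewrite /M' e1; clearbody M N; lra.
have X0 : 0 <= eps * d by rewrite mulr_ge0.
have Bp (m : nat) : (m <= 10)%N -> B ^+ m * (eps * d) <= B ^+ 10 * (eps * d).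
  by move=> m10; rewrite ler_wpM2r // ler_weXn2l.
have pn : `|p| = p by rewrite ger0_norm // ltW.
have pT1 : `|p * (t1 - N * d)| <= 8 * (B ^+ 4 * (eps * d)).
  rewrite normrM pn; apply: le_trans (_ : _ <= B * (8 * B ^+ 3 * eps * d)) _.
    by apply: ler_pM => //; exact: ltW.
  by lra.
have pT2 : `|p * (t2 - 2 * N * M * d)| <= 96 * (B ^+ 7 * (eps * d)).
  rewrite normrM pn; apply: le_trans (_ : _ <= B * (96 * B ^+ 6 * eps * d)) _.
    by apply: ler_pM => //; exact: ltW.
  by lra.
have pT3 : `|p * t3| <= 400 * (B ^+ 10 * (eps * d)).
  rewrite normrM pn; apply: le_trans (_ : _ <= B * (400 * B ^+ 9 * eps * d)) _.
    by apply: ler_pM => //; exact: ltW.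
  by lra.
have {}T4 : `|(p' - p) * y1| <= 4 * (B ^+ 4 * (eps * d)).
  by apply: le_trans T4 _; lra.
have {}T5 : `|(p' - p - lam * p * d) * N| <= B ^+ 4 * (eps * d).
  by apply: le_trans T5 _; lra.
apply: le_trans (ler_normD _ _) _; apply: le_trans (lerD (ler_normD _ _) T4) _.
apply: le_trans (lerD (lerD (ler_normB _ _) pT3) (lexx _)) _.
apply: le_trans (lerD (lerD (lerD (ler_normD _ _) pT2) (lexx _)) (lexx _)) _.
rewrite normrN; apply: le_trans (lerD (lerD (lerD (lerD T5 pT1) (lexx _)) (lexx _)) (lexx _)) _.
(* The constant is the sum [1 + 8 + 96 + 400 + 4] of the five error bounds, and [B ^+ 10] dominates
   each of their powers of [B]. *)
have h4 := Bp 4 isT; have h7 := Bp 7 isT; rewrite -(mulrA _ eps) -(mulrA 509).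
by lra.
Qed.

End ResolventFlow.

(** * A one-sided Gronwall lemma *)

Section RightGronwall.
Context {R : realType}.

(* The right-sided estimate carries the bound [|f u| <= e * exp ((C + 1) u)]
   beyond any time up to which it holds; continuity closes the set of such times. *)
Lemma right_gronwall (f : R -> R) (C : R) : 0 <= C -> f 0 = 0 ->
  (forall t : R, 0 <= t -> f r @[r --> within [set r | 0 <= r] (nbhs t)] --> f t) ->
  (forall s e : R, 0 <= s -> 0 < e -> exists2 d, 0 < d &
    forall t : R, s <= t -> t < s + d -> `|f t - f s| <= (C * `|f s| + e) * (t - s)) ->
  forall t : R, 0 <= t -> f t = 0.
Proof.
move=> C0 f0 fc fr T T0.
apply/eqP; rewrite -normr_eq0; apply/eqP/le_anti; rewrite normr_ge0 andbT.
pose E (u : R) := expR ((C + 1) * u).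
have C1 : 0 <= C + 1 by rewrite addr_ge0.
suff bd e : 0 < e -> `|f T| <= e * E T.
  apply/ler_addgt0Pr => e e0; rewrite add0r.
  have := bd (e / E T) (divr_gt0 e0 (expR_gt0 _)); rewrite mulfVK //.
  by rewrite gt_eqF // expR_gt0.
move=> e0.
have E1 u : 0 <= u -> 1 <= E u.
  by move=> u0; rewrite -expR0 ler_expR mulr_ge0.
pose S := [set u : R | 0 <= u <= T /\ forall v, 0 <= v <= u -> `|f v| <= e * E v].
have S0 : S 0.
  split; first by rewrite lexx T0.
  move=> v v0; have -> : v = 0 by apply/le_anti; rewrite andbC.
  by rewrite f0 normr0 mulr_ge0 // ?ltW // expR_gt0.
have supS : has_sup S by split; [exists 0|exists T => u [/andP[]]].
pose sg := sup S.
have sg0 : 0 <= sg by apply: sup_upper_bound.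
have sgT : sg <= T by apply: ge_sup => //; [exists 0|move=> u [/andP[]]].
have below v : 0 <= v -> v < sg -> `|f v| <= e * E v.
  move=> v0 vs; have [u Su vu] : exists2 u, S u & v < u.
    have vs' : 0 < sg - v by rewrite subr_gt0.
    by have [u Su] := sup_adherent vs' supS; rewrite -/sg subKr; exists u.
  by case: Su => _; apply; rewrite v0 ltW.
have at_sg : `|f sg| <= e * E sg.
  have [->|sg_neq0] := eqVneq sg 0.
    by case: S0 => _; apply; rewrite lexx.
  have sg_gt0 : 0 < sg by rewrite lt0r sg_neq0.
  apply/ler_addgt0Pr => e1 e10.
  have := fc sg sg0 => /cvgrPdist_lt /(_ e1 e10).
  rewrite near_withinE => /nbhs_ballP[d d0 hd].
  pose v := Num.max 0 (sg - d / 2).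
  have v0 : 0 <= v by rewrite le_max lexx.
  have vs : v < sg by rewrite gt_max sg_gt0 ltrBlDr ltrDl divr_gt0.
  have vd : `|sg - v| < d.
    rewrite ger0_norm ?subr_ge0 ?ltW // ltrBlDr.
    have : sg - d / 2 <= v by rewrite le_max lexx orbT.
    lra.
  have := hd v vd v0 => /= h1; have h2 := below v v0 vs.
  have h3 : e * E v <= e * E sg by rewrite ler_pM2l // ler_expR ler_wpM2l // ltW.
  have := ler_normD (f sg - f v) (f v); rewrite subrK; lra.
have Ssg : S sg.
  split; first by rewrite sg0 sgT.
  by move=> v /andP[v0]; rewrite le_eqVlt => /predU1P[->|vs] //; exact: below.
have [->//|sg_neq] := eqVneq T sg.
have sg_lt : sg < T by rewrite lt_neqAle eq_sym sg_neq sgT.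
have [d d0 hd] := fr sg e sg0 e0.
pose u := Num.min T (sg + d / 2).
have su : sg < u by rewrite lt_min sg_lt ltrDl divr_gt0.
have : S u.
  split; first by rewrite (le_trans sg0 (ltW su)) ge_min lexx.
  move=> v /andP[v0 vu]; have [vs|sv] := leP v sg; first by case: Ssg => _; apply; rewrite v0.
  have vd : v < sg + d.
    apply: le_lt_trans vu _; rewrite gt_min; apply/orP; right.
    by rewrite ltrD2l; lra.
  have := hd v (ltW sv) vd => h1.
  have Ev : E v = E sg * expR ((C + 1) * (v - sg)).
    by rewrite /E -expRD -mulrDr subrKC.
  have h2 : 1 + (C + 1) * (v - sg) <= expR ((C + 1) * (v - sg)) by exact: expR_ge1Dx.
  have := ler_normD (f v - f sg) (f sg); rewrite subrK => h3.
  have vs0 : 0 <= v - sg by rewrite subr_ge0 ltW.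
  rewrite Ev mulrA; apply: le_trans h3 _.
  apply: (@le_trans _ _ (e * E sg * (1 + (C + 1) * (v - sg)))); last first.
    by rewrite ler_wpM2l // mulr_ge0 ?expR_ge0 // ltW.
  have eE : e <= e * E sg by rewrite ler_peMr ?E1 // ltW.
  apply: le_trans (lerD h1 at_sg) _.
  have : (C * `|f sg| + e) * (v - sg) <= (C * (e * E sg) + e * E sg) * (v - sg).
    by rewrite ler_wpM2r // lerD // ler_wpM2l.
  lra.
by move=> /(sup_upper_bound supS); rewrite leNgt -/sg su.
Qed.

(** The upper bound is [exp x * (1 - x) <= 1] together with [(1 + x + 2 x^2) (1 - x) = 1 + x^2 (1 -
    2 x) >= 1]. *)
Lemma expR_quadratic (x : R) : `|x| <= 2^-1 ->
  0 <= expR x - 1 - x <= 2 * x ^+ 2.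
Proof.
rewrite ler_norml => /andP[x1 x2]; apply/andP; split.
  by have := expR_ge1Dx x; lra.
have h := expR_ge1Dx (- x).
have e0 := expR_gt0 x.
have : expR x * (1 - x) <= expR x * expR (- x) by rewrite ler_pM2l.
rewrite -expRD subrr expR0.
nra.
Qed.

End RightGronwall.

(** * The resolvent trace along a characteristic *)

Section FunctionalEquation.
Context {R : realType} {A : wstar_probability_space R}.
Variable Ft : R -> set A.
Hypothesis Ft_filtration : filtration Ft.
Variables c g : R -> A.
Hypothesis c_circ : circular_brownian_motion Ft c.
Hypothesis g_sol : free_multiplicative_brownian_motion Ft c g.
Implicit Types (a b : A) (s t u p : R).

Local Notation resolv := (resolv g).
Local Notation gsq := (gsq g).

Lemma resolv_lipschitz p q t u (L e : R) : 0 < p -> 0 < q -> 0 <= t -> 0 <= u ->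
  opbound (g t) L -> opbound (g u - g t) e ->
  `|rtr (resolv q u) - rtr (resolv p t)| <= q^-1 * (`|q - p| + (L * e + e * L + e * e)) * p^-1.
Proof.
move=> p0 q0 t0 u0 hL he.
have [_ [_ h1] b1] := resolvP Ft_filtration g_sol q0 u0.
have [_ [h2 _] b2] := resolvP Ft_filtration g_sol p0 t0.
set r := resolv p t in h2 b2 *; set r' := resolv q u in h1 b1 *.
pose G := g u - g t.
pose D := (q - p)%:C *: 1 + (g t * star G + G * star (g t) + G * star G).
have DE : (q%:C *: 1 + gsq u) - (p%:C *: 1 + gsq t) = D.
  have -> : gsq u = gsq t + (g t * star G + G * star (g t) + G * star G).
    rewrite /gsq (_ : g u = g t + G); last by rewrite /G addrC subrK.
    by clearbody G; rewrite starD mulrDl !mulrDr -!addrA.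
  clearbody G; rewrite opprD addrACA -scalerBl -rmorphB /=.
  by rewrite (addrC (gsq t)) addrK.
have rE : r' - r = - (r' * D * r).
  rewrite -DE mulrBr mulrBl h1 mul1r -(mulrA r') h2 mulr1.
  by rewrite opprB.
rewrite -rtrB rE rtrN normrN; apply: rtr_opbound.
apply: opboundM => //; apply: opboundM => //.
have he' := opbound_star he.
apply: opboundD; last by apply: opboundD; [apply: opboundD|]; apply: opboundM => //; exact: opbound_star.
by have := opboundZ (q - p) (@opbound1 R A); rewrite mulr1.
Qed.

Variable s0 : R.
Hypothesis s0_01 : 0 < s0 < 1.

Let lam := 1 - 2 * s0.
Let P (u : R) := (1 - s0) / s0 * expR (lam * u).
Let f (u : R) := 1 - P u * rtr (resolv (P u) u) - s0.

Let P_gt0 u : 0 < P u.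
Proof.
case/andP: s0_01 => h0 h1; rewrite mulr_gt0 ?expR_gt0 // divr_gt0 // subr_gt0 //.
Qed.

Let f_0 : f 0 = 0.
Proof.
case/andP: s0_01 => h0 h1.
have [_ [h _] _] := resolvP Ft_filtration g_sol (P_gt0 0) (lexx 0).
have P0 : P 0 = (1 - s0) / s0 by rewrite /P mulr0 expR0 mulr1.
have g1 : gsq 0 = 1 by rewrite /gsq; case: g_sol => _ _ -> _; rewrite star1 mulr1.
move: h; rewrite g1 -{2}(scale1r (1 : A)) -scalerDl -scalerAl mul1r.
rewrite -(_ : (P 0 + 1)%:C = (P 0)%:C + 1); last by rewrite rmorphD.
move=> /(congr1 rtr); rewrite rtrZ rtr1 => h.
have e : rtr (resolv (P 0) 0) = s0.
  have : P 0 + 1 = s0^-1 by rewrite P0; field; rewrite gt_eqF.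
  move=> e; rewrite e in h; have := congr1 (fun x => s0 * x) h.
  by rewrite mulrA mulfV ?gt_eqF // mul1r mulr1.
by rewrite /f e P0; field; rewrite gt_eqF.
Qed.

Let P_cts : continuous P.
Proof.
move=> u; apply: cvgMl_tmp; apply: continuous_comp; last exact: continuous_expR.
by apply: cvgMl_tmp.
Qed.

Let f_cts t : 0 <= t -> f r @[r --> within [set r | 0 <= r] (nbhs t)] --> f t.
Proof.
move=> t0; rewrite /f.
have Pc : P r @[r --> within [set r | 0 <= r] (nbhs t)] --> P t.
  by apply: cvg_within_filter; exact: P_cts.
apply: cvgB; last exact: cvg_cst.
apply: cvgB; first exact: cvg_cst.
apply: cvgM => //.
have wc : wnorm (g r - g t) @[r --> within [set r | 0 <= r] (nbhs t)] --> (0 : R).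
  by case: g_sol => _ gc _ _; exact: gc.
pose L := wnorm (g t).
pose b r := (P r)^-1 * (`|P r - P t| + (L * wnorm (g r - g t) + wnorm (g r - g t) * L
   + wnorm (g r - g t) * wnorm (g r - g t))) * (P t)^-1.
pose l := (P t)^-1 * (`|P t - P t| + (L * 0 + 0 * L + 0 * 0)) * (P t)^-1 : R.
have l0 : l = 0 by rewrite /l subrr normr0 !mulr0 mul0r !addr0 mulr0 mul0r.
have bc : b r @[r --> within [set r | 0 <= r] (nbhs t)] --> l.
  apply: cvgM; last exact: cvg_cst.
  apply: cvgM; first by apply: (cvgV _ Pc); rewrite gt_eqF.
  apply: cvgD.
    by apply: cvg_norm; apply: cvgB => //; exact: cvg_cst.
  by apply: cvgD; [apply: cvgD|]; apply: cvgM => //; exact: cvg_cst.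
apply/cvgrPdist_lt => e e0.
move: bc; rewrite l0 => /cvgrPdist_lt /(_ e e0); rewrite !near_withinE.
apply: filterS => r hr r0; have := hr r0; rewrite sub0r normrN => hb.
rewrite distrC; apply: le_lt_trans hb.
apply: le_trans (ler_norm _); apply: resolv_lipschitz => //; exact: opbound_wnorm.
Qed.

(** For [lam = 1 - 2 s0] the leading term of [resolvent_increment] is [- 2 p N (f s) d]. Since [p r]
    has norm at most 1 and [1 - p r] at most 2, [|p N| <= 2], whence the constant 4. *)
Let f_right s e : 0 <= s -> 0 < e -> exists2 d, 0 < d &
  forall t, s <= t -> t < s + d -> `|f t - f s| <= (4 * `|f s| + e) * (t - s).
Proof.
move=> s_ge0 e0; case/andP: s0_01 => h0 h1.
pose p := P s; have p0 : 0 < p by exact: P_gt0.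
have pV0 : 0 < p^-1 by rewrite invr_gt0.
(* The doubled terms leave room for the speed of [P], at most [2 p], and for [1 / p'], at most
   [2 / p]. *)
pose B := 1 + wnorm (g s) + 2 * p + 2 * p^-1.
have w0 := opbound_ge0 (opbound_wnorm (g s)).
have B1 : 1 <= B by rewrite /B; lra.
have B10 : 0 < 509 * B ^+ 10 by rewrite mulr_gt0 // exprn_gt0 //; lra.
pose eps := Num.min 1 (e / (509 * B ^+ 10)).
have eps0 : 0 < eps by rewrite lt_min ltr01 divr_gt0.
have eps1 : eps <= 1 by rewrite ge_min lexx.
have epse : 509 * B ^+ 10 * eps <= e.
  by rewrite mulrC -ler_pdivlMr // ge_min lexx orbT.
have [d1 d10 hd1] := mbm_continuous g_sol s_ge0 eps0.
(* In order: continuity of [g], validity of the quadratic bound on the exponential, [d <= eps^2],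
   and the second-order error of [P]. *)
pose d := Num.min d1 (Num.min 4^-1 (Num.min (eps ^+ 2) (eps / (2 * p)))).
exists d.
  by rewrite !lt_min d10 invr_gt0 ltr0n exprn_gt0 //= divr_gt0 // mulr_gt0.
move=> t st; rewrite -ltrBlDl !lt_min => /and4P[td1 td4 tde tdp].
pose dl := t - s; rewrite -/dl in td1 td4 tde tdp *.
have dl0 : 0 <= dl by rewrite subr_ge0.
pose p' := P t.
have p'E : p' = p * expR (lam * dl).
  by rewrite /p' /p /P -[RHS]mulrA -expRD -mulrDr subrKC.
have lam1 : `|lam| <= 1 by rewrite ler_norml /lam; lra.
have xle : `|lam * dl| <= dl by rewrite normrM (ger0_norm dl0) ler_piMl.
have xh : `|lam * dl| <= 2^-1 by lra.
have /andP[xq1 xq2] := expR_quadratic xh.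
have x2 : (lam * dl) ^+ 2 <= dl ^+ 2.
  by rewrite -(real_normK (num_real (lam * dl))) ler_sqr ?nnegrE.
have dd : dl ^+ 2 <= dl * 4^-1 by rewrite expr2 ler_wpM2l // ltW.
have [xa xb] : - dl <= lam * dl /\ lam * dl <= dl by move: xle; rewrite ler_norml => /andP[].
have hx : `|expR (lam * dl) - 1| <= 2 * dl by rewrite ler_norml; lra.
have hp : `|p' - p| <= 2 * p * dl.
  have -> : p' - p = p * (expR (lam * dl) - 1) by rewrite p'E; ring.
  rewrite normrM (gtr0_norm p0) (_ : 2 * p * dl = p * (2 * dl)); last by ring.
  by rewrite ler_pM2l.
have p'V : p'^-1 <= 2 * p^-1.
  have p2 : p / 2 <= p' by move: hp; rewrite ler_norml; nra.
  rewrite (_ : 2 * p^-1 = (p / 2)^-1); last by field; rewrite gt_eqF.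
  by rewrite lef_pV2 ?posrE ?divr_gt0 // P_gt0.
pose r := resolv p s; pose N := rtr (gsq s * (r * r)); pose M := 1 - p * rtr r.
have hmain : `|1 - p' * rtr (resolv p' t) - M - p * N * (1 - lam - 2 * M) * dl| <=
    509 * B ^+ 10 * eps * dl.
  apply: (resolvent_increment Ft_filtration c_circ g_sol) => //.
  - exact: P_gt0.
  - by apply: opboundW (opbound_wnorm _) _; rewrite /B; lra.
  - by rewrite /B; lra.
  - by apply: le_trans p'V _; rewrite /B; lra.
  - by rewrite /B; lra.
  - move=> u /andP[su ut]; apply/ltW/hd1; first exact: le_trans su.
    rewrite ger0_norm ?subr_ge0 //; apply: le_lt_trans td1; rewrite /dl; lra.
  - exact: ltW.
  - apply: le_trans hp _; rewrite ler_wpM2r // /B; lra.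
  - have -> : p' - p - lam * p * dl = p * (expR (lam * dl) - 1 - lam * dl) by rewrite p'E; ring.
    rewrite normrM (gtr0_norm p0) (ger0_norm xq1).
    have : p * (expR (lam * dl) - 1 - lam * dl) <= p * (2 * dl ^+ 2).
      by rewrite ler_pM2l //; lra.
    have p20 : 0 < 2 * p by lra.
    move=> /le_trans; apply; move: tdp; rewrite (ltr_pdivlMr _ _ p20) => /ltW tdp.
    have -> : p * (2 * dl ^+ 2) = (dl * (2 * p)) * dl by ring.
    by rewrite ler_wpM2r.
have pN : `|p * N| <= 2.
  have [_ _ br] := resolvP Ft_filtration g_sol p0 s_ge0; rewrite -/r in br.
  have -> : p * N = rtr ((1 - p%:C *: r) * (p%:C *: r)).
    rewrite -scalerAr rtrZ /N; congr (_ * rtr _).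
    by rewrite mulrA (gsq_resolv Ft_filtration g_sol).
  apply: rtr_opbound.
  have o1 : opbound (p%:C *: r) 1.
    by apply: opboundW (opboundZ _ br) _; rewrite gtr0_norm // mulfV // gt_eqF.
  by have := opboundM (opboundB (@opbound1 R A) o1) o1; rewrite mulr1.
have fs : f s = M - s0 by [].
have ft : f t - f s = (1 - p' * rtr (resolv p' t)) - M.
  by rewrite fs /f -/p'; ring.
rewrite ft.
set X := p * N * _ * dl in hmain.
have hX : `|X| <= 4 * `|f s| * dl.
  have -> : X = (p * N) * (- 2) * f s * dl by rewrite /X fs /lam; ring.
  move: pN; move: (p * N) (f s) => y z yN.
  rewrite !normrM (ger0_norm dl0) ler_wpM2r // ler_wpM2r // normrN (ger0_norm (ler0n R 2)); lra.
have := ler_normD (1 - p' * rtr (resolv p' t) - M - X) X; rewrite subrK.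
have : 509 * B ^+ 10 * eps * dl <= e * dl by rewrite ler_wpM2r.
lra.
Qed.

Theorem resolvent_characteristic u : 0 <= u ->
  1 - (1 - s0) / s0 * expR ((1 - 2 * s0) * u) *
    rtr (resolv ((1 - s0) / s0 * expR ((1 - 2 * s0) * u)) u) = s0.
Proof.
move=> u0; have := right_gronwall (ler0n R 4) f_0 f_cts f_right u0.
by rewrite /f /P /lam => /eqP; rewrite subr_eq0 => /eqP.
Qed.

End FunctionalEquation.

(** * Integration against a measure carried by a compact set *)

Section CompactlySupportedMeasure.
Context {R : realType}.
Variables (nu : probability (measurableTypeR R) R) (K : set R).
Hypotheses (K_compact : compact K) (K_pos : K `<=` `]0, +oo[) (K_full : nu K = 1%E).

Let D : set R := `]0, +oo[%classic.

Lemma K_measurable : measurable K.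
Proof. by apply: closed_measurable; apply: compact_closed. Qed.

Lemma D_measurable : measurable D. Proof. exact: measurable_itv. Qed.

Let nuD : nu D = 1%E.
Proof.
apply/le_anti/andP; split; first by apply: probability_le1; exact: D_measurable.
rewrite -[leLHS]K_full.
by apply: le_measure; rewrite ?inE; [exact: K_measurable|exact: D_measurable|exact: K_pos].
Qed.

Let nuDK : nu (D `\` K) = 0%E.
Proof.
have mDK : measurable (D `\` K) by apply: measurableD; [exact: D_measurable|exact: K_measurable].
have : nu (D `\` K) = (nu D - nu (D `&` K))%E.
  have fD : (nu D < +oo)%E by rewrite nuD ltry.
  by apply: measureD => //; [exact: D_measurable|exact: K_measurable].
rewrite setIidr; last exact: K_pos.
by rewrite nuD K_full subee.
Qed.

Let nuKoo : (nu K < +oo)%E. Proof. by rewrite K_full ltry. Qed.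

Lemma K_bounds : exists m L : R, [/\ 0 < m, m <= 1, 1 <= L & forall x, K x -> m <= x <= L].
Proof.
have K0 : K !=set0.
  apply/set0P/eqP => K0; move: K_full; rewrite K0 measure0 => /eqP.
  by rewrite eq_sym onee_eq0.
have [L [_ hL]] := compact_bounded K_compact.
have [a aK ha] : exists2 a, a \in K & forall x, x \in K -> a <= x.
  exact: (compact_EVT_min K0 K_compact (continuous_subspaceT (fun x => cvg_id))).
have a0 : 0 < a by have := K_pos (set_mem aK); rewrite /= in_itv /= andbT.
exists (Num.min 1 a), (`|L| + 1); split.
- by rewrite lt_min ltr01.
- by rewrite ge_min lexx.
- by rewrite lerDr.
- move=> x Kx; rewrite ge_min ha ?orbT ?mem_set //=.
  apply: le_trans (ler_norm _) _; apply: hL => //.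
  by rewrite (le_lt_trans (ler_norm L)) // ltrDl.
Qed.

Lemma measurable_fun_pos (f : R -> R) : (forall x, 0 < x -> {for x, continuous f}) ->
  measurable_fun D f.
Proof.
move=> cf; apply: open_continuous_measurable_fun; first exact: interval_open.
by move=> x /set_mem; rewrite /D /= in_itv /= andbT; exact: cf.
Qed.

(** A bound on [K] suffices because the rest of the half-line is null. *)
Lemma nu_integrable (f : R -> R) (C : R) : measurable_fun D f ->
  (forall x, K x -> `|f x| <= C) -> nu.-integrable D (EFin \o f).
Proof.
move=> mf bf.
have mDK : measurable (D `\` K) by apply: measurableD; [exact: D_measurable|exact: K_measurable].
have mf' : measurable_fun D (EFin \o f) by exact/measurable_EFinP.
have [_ h] := @negligible_integrable _ (measurableTypeR R) R nu D (D `\` K) (EFin \o f)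
  mDK D_measurable mf' nuDK; apply: h.
rewrite setDD setIidr; last exact: K_pos.
apply: measurable_bounded_integrable.
- exact: K_measurable.
- exact: nuKoo.
- by apply: measurable_funS mf; [exact: D_measurable|exact: K_pos].
- exists C; split; first exact: num_real.
  by move=> y Cy x Kx; apply: le_trans (bf x Kx) _; exact: ltW.
Qed.

Lemma nu_integral_le (f : R -> R) (C : R) : measurable_fun D f ->
  (forall x, K x -> `|f x| <= C) -> `|\int[nu]_(x in D) f x| <= C.
Proof.
move=> mf bf.
have mDK : measurable (D `\` K) by apply: measurableD; [exact: D_measurable|exact: K_measurable].
have intf := nu_integrable mf bf.
have intK : nu.-integrable K (EFin \o f).
  by apply: integrableS intf; [exact: D_measurable|exact: K_measurable|exact: K_pos].
rewrite /Rintegral (@negligible_integral _ (measurableTypeR R) R nu D (D `\` K) (EFin \o f)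
  mDK D_measurable intf nuDK) setDD setIidr; last exact: K_pos.
apply: le_trans (@le_normr_Rintegral _ (measurableTypeR R) R nu K f K_measurable intK) _.
have intC : nu.-integrable K (EFin \o cst C).
  apply: measurable_bounded_integrable.
  - exact: K_measurable.
  - exact: nuKoo.
  - exact: measurable_cst.
  - by exists `|C|; split; [exact: num_real|move=> y Cy x Kx; exact: ltW].
apply: le_trans (_ : _ <= \int[nu]_(x in K) cst C x) _.
  apply: le_Rintegral => //; first exact: K_measurable.
  exact: integrable_norm.
rewrite /Rintegral (_ : integral _ _ _ = C%:E) //.
apply: etrans (@integral_cst _ (measurableTypeR R) R nu K K_measurable C%:E) _.
by rewrite [X in (_ * X)%E]K_full mule1.
Qed.

Lemma nu_integralB_le (f1 f2 : R -> R) (C e : R) : measurable_fun D f1 -> measurable_fun D f2 ->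
  (forall x, K x -> `|f1 x| <= C) -> (forall x, K x -> `|f1 x - f2 x| <= e) ->
  `|\int[nu]_(x in D) f1 x - \int[nu]_(x in D) f2 x| <= e.
Proof.
move=> m1 m2 b1 b12.
have b2 x : K x -> `|f2 x| <= C + e.
  move=> Kx; rewrite -[f2 x](subrK (f1 x)) addrC (le_trans (ler_normD _ _)) //.
  by rewrite lerD ?b1 // distrC b12.
rewrite -RintegralB; last 3 first.
- exact: D_measurable.
- exact: nu_integrable m1 b1.
- exact: nu_integrable m2 b2.
by apply: nu_integral_le => //; exact: measurable_funB.
Qed.

End CompactlySupportedMeasure.

(** * From moments to the Stieltjes transform *)

Section StieltjesTransform.
Context {R : realType} {A : wstar_probability_space R}.
Variables (nu : probability (measurableTypeR R) R) (K : set R).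
Hypotheses (K_compact : compact K) (K_pos : K `<=` `]0, +oo[) (K_full : nu K = 1%E).

Let D : set R := `]0, +oo[%classic.

Let nu_int (f : R -> R) : (forall x, 0 < x -> {for x, continuous f}) ->
  (exists C, forall x, K x -> `|f x| <= C) -> nu.-integrable D (EFin \o f).
Proof.
move=> cf [C hC]; apply: nu_integrable hC => //; exact: measurable_fun_pos.
Qed.

Lemma K_gt0 x : K x -> 0 < x.
Proof. by move=> /K_pos /=; rewrite in_itv /= andbT. Qed.

(** Induction on the power of [b - x], with [j] kept general because expanding one factor raises the
    power of [x]. *)
Lemma nu_mixed_moments (a : A) (b : R) :
  (forall n : nat, \int[nu]_(x in D) (x ^+ n) = rtr (a ^+ n)) ->
  forall i j : nat, \int[nu]_(x in D) (x ^+ j * (b - x) ^+ i) =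
    rtr (a ^+ j * (b%:C *: 1 - a) ^+ i).
Proof.
move=> hm i.
have [m [L [m0 m1 L1 hK]]] := K_bounds K_compact K_pos K_full.
have cont i0 j0 : continuous (fun x : R => x ^+ j0 * (b - x) ^+ i0).
  move=> x; apply: cvgM; first exact: exprn_continuous.
  apply: (@continuous_comp _ _ _ (fun x => b - x) (fun x => x ^+ i0)); last exact: exprn_continuous.
  by apply: cvgB; [exact: cvg_cst|exact: cvg_id].
have intg i0 j0 : nu.-integrable D (EFin \o (fun x : R => x ^+ j0 * (b - x) ^+ i0)).
  apply: nu_int; first by move=> x _; exact: cont.
  exists (L ^+ j0 * (`|b| + L) ^+ i0) => x Kx; have /andP[mx xL] := hK x Kx.
  have x0 : `|x| = x by rewrite ger0_norm // ltW // K_gt0.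
  have xp := ltW (K_gt0 Kx).
  rewrite normrM !normrX x0; apply: ler_pM.
  - exact: exprn_ge0.
  - exact: exprn_ge0.
  - by apply: lerXn2r; rewrite ?nnegrE //; lra.
  - rewrite lerXn2r ?nnegrE //; first by rewrite addr_ge0 //; lra.
    by rewrite (le_trans (ler_normB _ _)) // x0 lerD2l.
elim: i => [|i IH] j.
  rewrite expr0 mulr1 -hm; congr fine; apply: eq_integral => x _.
  by rewrite expr0 mulr1.
rewrite exprS mulrA mulrBr -scalerAr mulr1 -exprSr mulrBl -scalerAl rtrB rtrZ -!IH.
rewrite -RintegralZl; [|exact: D_measurable|exact: intg].
rewrite -RintegralB; last 3 first.
- exact: D_measurable.
- exact: (@integrableZl _ (measurableTypeR R) R nu D (D_measurable (R := R)) b _ (intg i j)).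
- exact: intg.
by congr fine; apply: eq_integral => x _; congr EFin; rewrite !exprS; ring.
Qed.

(** The resolvent and the function [1 / (p + x)] are geometric series around the same point, with
    the same coefficients; equality of moments makes the partial sums agree, and both errors decay
    like [rho ^+ n]. *)
Lemma nu_stieltjes (g r : A) (p : R) : 0 < p ->
  (forall n : nat, \int[nu]_(x in D) (x ^+ n) = rtr ((g * star g) ^+ n)) ->
  is_resolvent p (g * star g) r -> \int[nu]_(x in D) (p + x)^-1 = rtr r.
Proof.
move=> p0 hm hr.
have [m [L [m0 m1 L1 hK]]] := K_bounds K_compact K_pos K_full.
(* The centre must dominate the norm of [g g^*] for the operator series and the support of [nu] for
   the scalar one. *)
pose b := wnorm g ^+ 2 + L.
have wb : wnorm g ^+ 2 <= b by rewrite /b; lra.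
have b0 : 0 < b by have := sqr_ge0 (wnorm g); rewrite /b; lra.
have pb0 : 0 < p + b by lra.
have [r' _ [hr' _ happ]] := resolvent_exists vN_setT (I : [set: A] g) (opbound_wnorm g) wb p0.
have <- : r' = r by exact: resolvent_unique hr' hr.
set rho := b / (p + b) in happ.
have rho0 : 0 <= rho by rewrite divr_ge0 // ltW.
have rho1 : rho < 1 by rewrite ltr_pdivrMr // mul1r ltrDr.
pose S n x := \sum_(i < n) (p + b) ^- i.+1 * (x ^+ 0 * (b - x) ^+ i).
have cont i : continuous (fun x : R => x ^+ 0 * (b - x) ^+ i).
  move=> x; apply: cvgM; first exact: exprn_continuous.
  apply: (@continuous_comp _ _ _ (fun x => b - x) (fun x => x ^+ i)); last exact: exprn_continuous.
  by apply: cvgB; [exact: cvg_cst|exact: cvg_id].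
have bx x : K x -> 0 <= b - x <= b.
  by move=> Kx; have /andP[_ xL] := hK x Kx; have := K_gt0 Kx; have := sqr_ge0 (wnorm g); rewrite /b; lra.
have intg i : nu.-integrable D (EFin \o (fun x : R => x ^+ 0 * (b - x) ^+ i)).
  apply: nu_int; first by move=> x _; exact: cont.
  exists (b ^+ i) => x Kx; have /andP[h1 h2] := bx x Kx.
  by rewrite expr0 mul1r normrX ger0_norm // lerXn2r ?nnegrE // ltW.
have SE n : \int[nu]_(x in D) S n x =
    rtr (\sum_(i < n) ((p + b) ^- i.+1)%:C *: (b%:C *: 1 - g * star g) ^+ i) /\
    nu.-integrable D (EFin \o S n).
  elim: n => [|n [IH1 IH2]].
    have e0 : S 0%N = cst 0 by apply/funext => x; rewrite /S big_ord0.
    rewrite e0 big_ord0 rtr0; split; last exact: integrable0.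
    by rewrite /Rintegral integral0.
  have e1 : S n.+1 = (fun x => S n x + (p + b) ^- n.+1 * (x ^+ 0 * (b - x) ^+ n)).
    by apply/funext => x; rewrite /S big_ord_recr.
  have i1 : nu.-integrable D (EFin \o (fun x => (p + b) ^- n.+1 * (x ^+ 0 * (b - x) ^+ n))).
    exact: (@integrableZl _ (measurableTypeR R) R nu D (D_measurable (R := R))
      ((p + b) ^- n.+1) _ (intg n)).
  rewrite e1; split; last first.
    exact: (@integrableD _ (measurableTypeR R) R nu D (D_measurable (R := R)) _ _ IH2 i1).
  rewrite RintegralD //; last exact: D_measurable.
  rewrite RintegralZl; [|exact: D_measurable|exact: intg].
  by rewrite big_ord_recr /= rtrD rtrZ IH1 (nu_mixed_moments b hm) expr0 mul1r.
have SK n x : K x -> S n x - (p + x)^-1 = - ((b - x) / (p + b)) ^+ n / (p + x).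
  move=> Kx; have px : 0 < p + x by have := K_gt0 Kx; lra.
  elim: n => [|n IH]; first by rewrite /S big_ord0 expr0 sub0r mulN1r.
  rewrite /S big_ord_recr /= -/(S n x) addrAC IH expr0 mul1r !exprMn exprVn !exprS invfM exprVn.
  by field; rewrite !gt_eqF // exprn_gt0.
have mV : measurable_fun D (fun x : R => (p + x)^-1).
  apply: measurable_fun_pos => x x0; apply: cvgV; first by rewrite gt_eqF //; lra.
  by apply: cvgD; [exact: cvg_cst|exact: cvg_id].
have mS n : measurable_fun D (S n).
  by apply: measurable_sum => i; apply: measurable_fun_pos => x _; apply: cvgMl_tmp; exact: cont.
have diff n : `|\int[nu]_(x in D) (p + x)^-1 - rtr r'| <= 2 / p * rho ^+ n.
  have [S1 _] := SE n.
  have h1 : `|\int[nu]_(x in D) (p + x)^-1 - \int[nu]_(x in D) S n x| <= rho ^+ n / p.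
    have bV x : K x -> `|(p + x)^-1| <= p^-1.
      move=> Kx; have x0 := K_gt0 Kx; rewrite ger0_norm ?invr_ge0; last by lra.
      by rewrite lef_pV2 ?posrE //; lra.
    apply: (nu_integralB_le K_compact K_pos K_full (C := p^-1)) => // x Kx.
    rewrite distrC SK // mulNr normrN normrM normrX (ger0_norm (x := _^-1)); last first.
      by rewrite invr_ge0; have := K_gt0 Kx; lra.
    have /andP[h1 h2] := bx x Kx.
    apply: ler_pM.
    - by rewrite exprn_ge0.
    - by rewrite invr_ge0; have := K_gt0 Kx; lra.
    - rewrite lerXn2r ?nnegrE // ger0_norm ?divr_ge0 ?(ltW pb0) //.
      by rewrite /rho ler_wpM2r // invr_ge0 ltW.
    - by rewrite lef_pV2 ?posrE //; have := K_gt0 Kx; lra.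
  have h2 := rtr_opbound (happ n); rewrite rtrB -S1 in h2.
  have := ler_normD (\int[nu]_(x in D) (p + x)^-1 - \int[nu]_(x in D) S n x)
                    (\int[nu]_(x in D) S n x - rtr r').
  rewrite addrA subrK => /le_trans; apply; apply: le_trans (lerD h1 h2) _.
  by lra.
apply/eqP; rewrite -subr_eq0 -normr_eq0; apply/eqP/le_anti; rewrite normr_ge0 andbT.
apply/ler_addgt0Pr => e e0; rewrite add0r.
have [N hN] := geometric_small (2 / p) rho0 rho1 e0.
by apply: le_trans (diff N) _; apply/ltW/hN.
Qed.

End StieltjesTransform.

(** * Layer-cake formulas for integrals of powers *)

Section LayerCake.
Context {R : realType}.
Local Notation mu := (@lebesgue_measure R).

(** The condition [0 < r] lets the level run over the whole line, as Tonelli's theorem wants, while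
    only positive levels count. *)
Definition tail_set (f : R -> R) (r : R) : set (measurableTypeR R) :=
  [set s : R | (0 < r) && (r < f s)].

Lemma layer_cake (f : R -> R) : measurable_fun [set: measurableTypeR R] f ->
  (forall s, 0 <= f s) ->
  (\int[mu]_s (f s)%:E = \int[mu]_r mu (tail_set f r))%E.
Proof.
move=> mf f0.
pose T := measurableTypeR R.
pose Q : set (T * T) := [set z | (0 < z.2) && (z.2 < f z.1)].
have mQ : measurable Q.
  have -> : Q = ([set: T * T] `&` [set z : T * T | ((cst 0%E) z < (EFin \o snd) z)%E]) `&`
     ([set: T * T] `&` [set z | ((EFin \o snd) z < (EFin \o f \o fst) z)%E]).
    by apply/seteqP; split => z /=; rewrite /Q /= !lte_fin; [case/andP|case=> [[_ ->] [_ ->]]].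
  have m2 : measurable_fun [set: T * T] (EFin \o (snd : T * T -> T)).
    by apply/measurable_EFinP; exact: measurable_snd.
  have m1 : measurable_fun [set: T * T] (EFin \o f \o (fst : T * T -> T)).
    by apply/measurable_EFinP; apply: measurableT_comp => //; exact: measurable_fst.
  by apply: measurableI; apply: measurable_lte => //; exact: measurable_cst.
pose F (z : T * T) : \bar R := (\1_Q z)%:E.
have mF : measurable_fun [set: T * T] F.
  by apply/measurable_EFinP; exact: measurable_indic.
have F0 z : (0 <= F z)%E by rewrite lee_fin.
have := @fubini_tonelli _ _ T T R mu mu F mF F0.
have -> : (\int[mu]_x \int[mu]_y F (x, y) = \int[mu]_s (f s)%:E)%E.
  apply: eq_integral => s _.
  have -> : (\int[mu]_y F (s, y))%E = (\int[mu]_y (\1_(`]0%R, f s[%classic : set T) y)%:E)%E.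
    apply: eq_integral => r _; rewrite /F !indicE.
    have -> // : ((s, r) \in Q) = (r \in (`]0%R, f s[%classic : set T)).
    by apply/idP/idP => /set_mem h; apply/mem_set; move: h; rewrite /Q /= in_itv.
  rewrite integral_indic // setIT; apply: etrans (lebesgue_measure_itv `]0%R, f s[%R) _.
  rewrite /= lte_fin; case: ltP => h; first by rewrite -EFinB subr0.
  by congr EFin; apply/le_anti; rewrite f0 h.
move=> ->; apply: eq_integral => r _.
have mS : measurable (tail_set f r).
  have -> : tail_set f r = [set s | 0 < r] `&`
     ([set: T] `&` [set s | ((cst r%:E) s < (EFin \o f) s)%E]).
    by apply/seteqP; split => s /=; rewrite /tail_set /= ?lte_fin; [case/andP|case=> -> [_ ->]].
  apply: measurableI; last first.
    by apply: measurable_lte => //; exact/measurable_EFinP.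
  have [r0|r0] := ltP 0 r.
    by rewrite (_ : [set _ | _] = setT) //; apply/seteqP; split.
  by rewrite (_ : [set _ | _] = set0) //; apply/seteqP; split.
have -> : (\int[mu]_x F (x, r))%E = (\int[mu]_x (\1_(tail_set f r) x)%:E)%E.
  apply: eq_integral => s _; rewrite /F !indicE.
  have -> // : ((s, r) \in Q) = (s \in tail_set f r).
  by apply/idP/idP => /set_mem h; apply/mem_set.
by rewrite integral_indic // setIT.
Qed.

(* [m] is the tail function of [f] on the unit interval, up to endpoints. *)
Lemma power_tail (f m : R -> R) (al : R) : 0 < al ->
  measurable_fun (`]0, 1[%classic : set (measurableTypeR R)) f ->
  (forall s, 0 < s < 1 -> 0 < f s) ->
  (forall q, 0 < q -> 0 <= m q <= 1) ->
  (forall s q, 0 < s < 1 -> 0 < q -> q < f s -> s <= m q) ->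
  (forall s q, 0 < s < 1 -> 0 < q -> f s <= q -> m q <= s) ->
  (\int[mu]_(s in `]0%R, 1%R[) (expR (al * ln (f s)))%:E =
   \int[mu]_(r in `]0%R, +oo[) (m (expR (ln r / al)))%:E)%E.
Proof.
move=> al0 mf f0 m01 h1 h2.
pose T := measurableTypeR R.
pose F : R -> R := (fun s => expR (al * ln (f s))) \_ `]0, 1[.
have mF0 : measurable_fun (`]0, 1[%classic : set T) (fun s => expR (al * ln (f s))).
  apply: measurableT_comp; first exact: measurable_expR.
  apply: measurable_funM; first exact: measurable_cst.
  by apply: measurableT_comp mf; exact: measurable_ln.
have mF : measurable_fun [set: T] F.
  by apply/(measurable_restrictT _ _).1 => //; exact: measurable_itv.
have F0 s : 0 <= F s by rewrite /F patchE; case: ifP => // _; exact: expR_ge0.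
have -> : (\int[mu]_(s in `]0%R, 1%R[) (expR (al * ln (f s)))%:E = \int[mu]_s (F s)%:E)%E.
  rewrite integral_mkcond; apply: eq_integral => s _.
  by rewrite /F !patchE; case: ifP.
rewrite layer_cake // [RHS]integral_mkcond; apply: eq_integral => r _.
rewrite patchE; case: ifPn => [|r0]; last first.
  rewrite (_ : tail_set F r = set0) ?measure0 //; apply/seteqP; split=> s //=.
  rewrite /tail_set /=.
  by move=> /andP[rp _]; move: r0; rewrite notin_setE /= in_itv /= rp.
rewrite inE /= in_itv /= andbT => r0; pose q := expR (ln r / al).
have q0 : 0 < q by exact: expR_gt0.
have equ s : 0 < s < 1 -> (r < expR (al * ln (f s))) = (q < f s).
  move=> s01; rewrite -[r in LHS]lnK ?posrE // ltr_expR mulrC -ltr_pdivrMr //.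
  by rewrite /q -[f s in RHS]lnK ?posrE ?f0 // ltr_expR.
have /andP[mq0 mq1] := m01 q q0.
have sub1 : (`]0, m q[%classic : set T) `<=` tail_set F r.
  move=> s /=; rewrite in_itv /= => /andP[s0 sm]; have s01 : 0 < s < 1 by rewrite s0 (lt_le_trans sm).
  rewrite /tail_set /= r0 /F patchE mem_set /=; last by rewrite in_itv.
  by rewrite equ // ltNge; apply/negP => /(h2 s q s01 q0); rewrite leNgt sm.
have sub2 : tail_set F r `<=` (`]0, m q]%classic : set T).
  move=> s /=; rewrite /tail_set /= /F patchE; case: ifPn => [|_ /andP[_]]; last first.
    by move=> /ltW; rewrite leNgt r0.
  rewrite inE /= in_itv /= => s01; rewrite r0 equ //= in_itv /= => qf.
  by case/andP: (s01) => -> _ /=; exact: h1.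
have mS : measurable (tail_set F r).
  have -> : tail_set F r = ([set: T] `&` [set s | ((cst r%:E) s < (EFin \o F) s)%E]).
    by apply/seteqP; split => s /=; rewrite /tail_set /= ?lte_fin r0 //=; case.
  by apply: measurable_lte => //; exact/measurable_EFinP.
have leb (b : bool) : mu ([set` Interval (BRight 0) (BSide b (m q))] : set T) = (m q)%:E.
  apply: etrans (lebesgue_measure_itv (Interval (BRight 0) (BSide b (m q)))) _.
  rewrite /= lte_fin; case: ltP => h; first by rewrite -EFinB subr0.
  by congr EFin; apply/le_anti; rewrite mq0 h.
apply/le_anti/andP; split.
  by rewrite -(leb false); apply: le_measure => //; rewrite inE //; exact: measurable_itv.
by rewrite -(leb true); apply: le_measure => //; rewrite inE //; exact: measurable_itv.
Qed.

End LayerCake.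

(** * Comparison of power moments *)

Section MellinTransform.
Context {R : realType}.
Local Notation mu := (@lebesgue_measure R).
Variables (nu : probability (measurableTypeR R) R) (K : set R).
Hypotheses (K_compact : compact K) (K_pos : K `<=` `]0, +oo[) (K_full : nu K = 1%E).
Variables (t : R).

Let D : set R := `]0, +oo[%classic.
Let T := measurableTypeR R.

Definition odds (s : R) : R := (1 - s) / s.
Definition pinv (s : R) : R := odds s * expR ((1 - 2 * s) * (t / 2)).

Hypothesis functional_eq : forall s, 0 < s < 1 ->
  1 - pinv s * \int[nu]_(x in D) (pinv s + x)^-1 = s.

Let M (q : R) : R := \int[nu]_(x in D) (x / (q + x)).

Let cont_inv (q x : R) : 0 < q -> 0 < x -> {for x, continuous (fun x : R => (q + x)^-1)}.
Proof.
move=> q0 x0; apply: cvgV; first by rewrite gt_eqF //; lra.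
by apply: cvgD; [exact: cvg_cst|exact: cvg_id].
Qed.

Let cont_ratio (q x : R) : 0 < q -> 0 < x -> {for x, continuous (fun x : R => x / (q + x))}.
Proof. by move=> q0 x0; apply: cvgM; [exact: cvg_id|exact: cont_inv]. Qed.

Let m_ratio (q : R) : 0 < q -> measurable_fun D (fun x : R => x / (q + x)).
Proof. by move=> q0; apply: measurable_fun_pos => x x0; exact: cont_ratio. Qed.

Let ratio01 (q x : R) : 0 < q -> 0 < x -> 0 <= x / (q + x) <= 1.
Proof.
move=> q0 x0; rewrite divr_ge0 /=; [|lra|lra].
by rewrite ler_pdivrMr; lra.
Qed.

Let int_ratio (q : R) : 0 < q -> nu.-integrable D (EFin \o (fun x : R => x / (q + x))).
Proof.
move=> q0; apply: (nu_integrable K_compact K_pos K_full (C := 1)); first exact: m_ratio.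
move=> x /(K_gt0 K_pos) x0; have /andP[h1 h2] := ratio01 q0 x0.
by rewrite ger0_norm.
Qed.

(** Integrate [x / (p + x) = 1 - p / (p + x)] against a probability. *)
Let M_functional s : 0 < s < 1 -> 0 < pinv s /\ M (pinv s) = s.
Proof.
move=> s01; have p0 : 0 < pinv s.
  by case/andP: s01 => s0 s1; rewrite mulr_gt0 ?expR_gt0 // divr_gt0 // subr_gt0.
split=> //; rewrite -[RHS](functional_eq s01).
have i1 : nu.-integrable D (EFin \o (fun x : R => (pinv s + x)^-1)).
  apply: (nu_integrable K_compact K_pos K_full (C := (pinv s)^-1)).
    by apply: measurable_fun_pos => x x0; exact: cont_inv.
  move=> x /(K_gt0 K_pos) x0; rewrite ger0_norm ?invr_ge0; last by lra.
  by rewrite lef_pV2 ?posrE //; lra.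
have c1 : nu.-integrable D (EFin \o cst (1 : R)).
  apply: (nu_integrable K_compact K_pos K_full (C := 1)); first exact: measurable_cst.
  by move=> x _ /=; rewrite normr1.
have nuD : \int[nu]_(x in D) (cst 1 x) = 1 :> R.
  have : (nu D <= 1)%E by apply: probability_le1; exact: D_measurable.
  have : (nu K <= nu D)%E.
    by apply: le_measure; rewrite ?inE; [exact: K_measurable|exact: D_measurable|exact: K_pos].
  rewrite [X in (X <= _)%E]K_full => h1 h2.
  rewrite /Rintegral (_ : integral _ _ _ = 1%E) //.
  apply: etrans (@integral_cst _ T R nu D (D_measurable (R := R)) 1%E) _.
  by rewrite mul1e; apply/le_anti; rewrite h1 h2.
rewrite -[X in X - _]nuD -RintegralZl //; last exact: D_measurable.
rewrite -RintegralB //; last 2 first.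
- exact: D_measurable.
- exact: (@integrableZl _ T R nu D (D_measurable (R := R)) (pinv s) _ i1).
rewrite /M /Rintegral; congr fine; apply: eq_integral => x /set_mem.
rewrite /D /= in_itv /= andbT => x0; congr EFin; field.
by rewrite gt_eqF //; lra.
Qed.

Let M01 q : 0 < q -> 0 <= M q <= 1.
Proof.
move=> q0; apply/andP; split.
  by apply: Rintegral_ge0 => x; rewrite /D /= in_itv /= andbT => x0; case/andP: (ratio01 q0 x0).
apply: le_trans (ler_norm _) _.
apply: (nu_integral_le K_compact K_pos K_full); first exact: m_ratio.
move=> x /(K_gt0 K_pos) x0; have /andP[h1 h2] := ratio01 q0 x0.
by rewrite ger0_norm.
Qed.

Let M_decr q q' : 0 < q -> q <= q' -> M q' <= M q.
Proof.
move=> q0 qq'; have q'0 := lt_le_trans q0 qq'.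
apply: le_Rintegral; [exact: D_measurable|exact: int_ratio|exact: int_ratio|].
move=> x; rewrite /D /= in_itv /= andbT => x0.
by rewrite ler_pM2l // lef_pV2 ?posrE; lra.
Qed.

Lemma measurable_odds : measurable_fun (`]0, 1[%classic : set T) odds.
Proof.
apply: open_continuous_measurable_fun; first exact: interval_open.
move=> s; rewrite inE /= in_itv /= => /andP[s0 s1]; apply: cvgM.
  by apply: cvgB; [exact: cvg_cst|exact: cvg_id].
by apply: cvgV; [rewrite gt_eqF|exact: cvg_id].
Qed.

Lemma measurable_pinv : measurable_fun (`]0, 1[%classic : set T) pinv.
Proof.
apply: measurable_funM; first exact: measurable_odds.
apply: measurableT_comp; first exact: measurable_expR.
apply: measurable_funM; last exact: measurable_cst.
apply: measurable_funB; first exact: measurable_cst.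
by apply: measurable_funM; first exact: measurable_cst.
Qed.

Lemma odds_gt0 s : 0 < s < 1 -> 0 < odds s.
Proof. by case/andP=> s0 s1; rewrite divr_gt0 // subr_gt0. Qed.

(** [power_tail] is used twice: [M] is the tail of [pinv], and for fixed [x] the ratio [x / (q + x)]
    is the tail of [s |-> x * odds s]. Tonelli exchanges the level with [x], and [x^al] comes out as
    a factor. *)
Lemma mellin_identity (al : R) : 0 < al ->
  (\int[mu]_(s in `]0%R, 1%R[) (expR (al * ln (pinv s)))%:E =
   \int[nu]_(x in D) (expR (al * ln x))%:E *
   \int[mu]_(s in `]0%R, 1%R[) (expR (al * ln (odds s)))%:E)%E.
Proof.
move=> al0; pose q r := expR (ln r / al).
have p0 s : 0 < s < 1 -> 0 < pinv s by move=> /M_functional[].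
have h1 s q0 : 0 < s < 1 -> 0 < q0 -> q0 < pinv s -> s <= M q0.
  move=> s01 q00 h; have [_ e] := M_functional s01.
  by rewrite -[leLHS]e; apply: M_decr => //; exact: ltW.
have h2 s q0 : 0 < s < 1 -> 0 < q0 -> pinv s <= q0 -> M q0 <= s.
  move=> s01 q00 h; have [h0 e] := M_functional s01.
  by rewrite -[leRHS]e; apply: M_decr.
rewrite (power_tail al0 measurable_pinv p0 M01 h1 h2).
(* The ratio is extended by 0 off the positive quadrant, and its reciprocal is written through
   [expR] and [ln], which are measurable everywhere. *)
pose F (z : T * T) : \bar R := (\1_(D : set T) z.1 * \1_(D : set T) z.2 *
  (z.1 * expR (-1 * ln (q z.2 + z.1))))%:E.
have FE x r : 0 < x -> 0 < r -> F (x, r) = (x / (q r + x))%:E.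
  move=> x0 r0; rewrite /F /= !indicE !mem_set /D /= ?in_itv /= ?x0 ?r0 // !mul1r.
  by congr (_ * _)%:E; rewrite mulN1r expRN lnK // posrE addr_gt0 ?expR_gt0.
have mF : measurable_fun [set: T * T] F.
  have m1 : measurable_fun [set: T * T] (fst : T * T -> T) by exact: measurable_fst.
  have m2 : measurable_fun [set: T * T] (snd : T * T -> T) by exact: measurable_snd.
  have mD : measurable_fun [set: T] (\1_(D : set T) : T -> R).
    by apply: measurable_indic; exact: D_measurable.
  have mq : measurable_fun [set: T] (q : T -> R).
    apply: measurableT_comp; first exact: measurable_expR.
    by apply: measurable_funM; [exact: measurable_ln|exact: measurable_cst].
  apply/measurable_EFinP; apply: measurable_funM.
    apply: measurable_funM.
      exact: (measurableT_comp mD m1).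
    exact: (measurableT_comp mD m2).
  apply: measurable_funM => //.
  apply: measurableT_comp; first exact: measurable_expR.
  apply: measurable_funM; first exact: measurable_cst.
  apply: measurableT_comp; first exact: measurable_ln.
  by apply: measurable_funD => //; exact: (measurableT_comp mq m2).
have F0 z : (0 <= F z)%E.
  case: z => x r; rewrite /F /= !indicE lee_fin.
  case: (boolP (x \in (D : set T))) => [/set_mem|]; last by rewrite mul0r mul0r.
  rewrite /D /= in_itv /= andbT => x0.
  by rewrite mulr_ge0 // mulr_ge0 ?expR_ge0 // ltW.
have Fout1 x r : x \notin (D : set T) -> F (x, r) = 0%E.
  by move=> h; rewrite /F /= !indicE (negbTE h) !mul0r.
have Fout2 x r : r \notin (D : set T) -> F (x, r) = 0%E.
  by move=> h; rewrite /F /= !indicE (negbTE h) mulr0 mul0r.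
have Dpos (x : R) : x \in (D : set T) -> 0 < x.
  by move=> /set_mem; rewrite /D /= in_itv /= andbT.
have e1 : (\int[mu]_(r in `]0%R, +oo[) (M (q r))%:E = \int[mu]_r \int[nu]_x F (x, r))%E.
  rewrite integral_mkcond; apply: eq_integral => r _; rewrite patchE.
  case: ifPn => rD; last first.
    by rewrite (eq_integral (cst 0%E)) ?integral0 // => x _; rewrite Fout2.
  have r0 := Dpos r rD; have q0 : 0 < q r by exact: expR_gt0.
  rewrite /M /Rintegral fineK; last first.
    exact: (@integrable_fin_num _ T R nu D (D_measurable (R := R)) _ (int_ratio q0)).
  rewrite integral_mkcond; apply: eq_integral => x _; rewrite patchE.
  by case: ifPn => xD; [rewrite FE // Dpos|rewrite Fout1].
rewrite -/q [LHS]e1 -(@fubini_tonelli _ _ T T R nu mu F mF F0).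
set b0 := (\int[mu]_(s in _) _)%E.
have e2 x : 0 < x -> (\int[mu]_r F (x, r) = (expR (al * ln x))%:E * b0)%E.
  move=> x0.
  have m0 : measurable_fun (`]0, 1[%classic : set T) (fun s => x * odds s).
    by apply: measurable_funM; [exact: measurable_cst|exact: measurable_odds].
  have f0 s : 0 < s < 1 -> 0 < x * odds s by move=> s01; rewrite mulr_gt0 // odds_gt0.
  have r01 q0 : 0 < q0 -> 0 <= x / (q0 + x) <= 1 by move=> q00; exact: ratio01.
  have oddsE s : 0 < s < 1 -> x * odds s * s = x * (1 - s).
    by case/andP=> s0 _; rewrite /odds -mulrA divfK // gt_eqF.
  have k1 s q0 : 0 < s < 1 -> 0 < q0 -> q0 < x * odds s -> s <= x / (q0 + x).
    move=> s01 q00 h; have oE := oddsE s s01; case/andP: (s01) => s0 s1.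
    rewrite ler_pdivlMr; last by lra.
    by have : q0 * s <= x * odds s * s by [rewrite ler_wpM2r // ltW]; rewrite oE; lra.
  have k2 s q0 : 0 < s < 1 -> 0 < q0 -> x * odds s <= q0 -> x / (q0 + x) <= s.
    move=> s01 q00 h; have oE := oddsE s s01; case/andP: (s01) => s0 s1.
    rewrite ler_pdivrMr; last by lra.
    by have : x * odds s * s <= q0 * s by [rewrite ler_wpM2r // ltW]; rewrite oE; lra.
  have := power_tail al0 m0 f0 r01 k1 k2 => e.
  transitivity (\int[mu]_(r in `]0%R, +oo[) (x / (q r + x))%:E)%E.
    rewrite [RHS]integral_mkcond; apply: eq_integral => r _; rewrite patchE.
    by case: ifPn => rD; [rewrite FE // Dpos|rewrite Fout2].
  rewrite -[LHS]e /b0 -ge0_integralZl_EFin; last 4 first.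
  - exact: measurable_itv.
  - by move=> s _; rewrite lee_fin expR_ge0.
  - apply/measurable_EFinP; apply: measurableT_comp; first exact: measurable_expR.
    apply: measurable_funM; first exact: measurable_cst.
    by apply: measurableT_comp measurable_odds; exact: measurable_ln.
  - exact: expR_ge0.
  apply: eq_integral => s /set_mem; rewrite /= in_itv /= => s01.
  by rewrite lnM ?posrE ?odds_gt0 // mulrDr expRD EFinM.
have b00 : (0 <= b0)%E by apply: integral_ge0 => s _; rewrite lee_fin expR_ge0.
have mx : measurable_fun (D : set T) (fun x : T => (expR (al * ln x))%:E).
  apply/measurable_EFinP; apply: measurableT_comp; first exact: measurable_expR.
  apply: measurable_funM; first exact: measurable_cst.
  by apply: measurable_funTS; exact: measurable_ln.
have x0 (x : T) : (D : set T) x -> (0 <= (expR (al * ln x))%:E)%E.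
  by move=> _; rewrite lee_fin expR_ge0.
rewrite -(ge0_integralZr nu (D_measurable (R := R)) mx x0 b00).
rewrite [RHS]integral_mkcond; apply: eq_integral => x _; rewrite patchE.
case: ifPn => xD; first by rewrite e2 // Dpos.
by rewrite (eq_integral (cst 0%E)) ?integral0 // => r _; rewrite Fout1.
Qed.

End MellinTransform.

(** * Taylor expansion of the complex exponential *)

Section ComplexExponential.
Context {R : realType}.
Implicit Types (z c w : R[i]) (r : R).

(** Equivalent to the modulus and submultiplicative, but real-valued and piecewise linear in the
    components, which suits linear arithmetic. *)
Definition cnorm1 z : R := `|complex.Re z| + `|complex.Im z|.

Lemma cnorm1_ge0 z : 0 <= cnorm1 z. Proof. by rewrite addr_ge0. Qed.

Lemma cnorm1D z w : cnorm1 (z + w) <= cnorm1 z + cnorm1 w.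
Proof.
case: z w => [a b] [c d]; rewrite /cnorm1 /= addrACA lerD //; exact: ler_normD.
Qed.

Lemma cnorm1N z : cnorm1 (- z) = cnorm1 z.
Proof. by case: z => a b; rewrite /cnorm1 /= !normrN. Qed.

Lemma cnorm1M z w : cnorm1 (z * w) <= cnorm1 z * cnorm1 w.
Proof.
case: z w => [a b] [c d]; rewrite /cnorm1 /=.
apply: le_trans (lerD (ler_normB _ _) (ler_normD _ _)) _.
by rewrite !normrM le_eqVlt; apply/orP; left; apply/eqP; ring.
Qed.

Lemma cnorm1X z n : cnorm1 (z ^+ n) <= cnorm1 z ^+ n.
Proof.
elim: n => [|n IH]; first by rewrite !expr0 /cnorm1 /= normr1 normr0 addr0.
by rewrite !exprS (le_trans (cnorm1M _ _)) // ler_wpM2l // cnorm1_ge0.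
Qed.

Lemma cnorm1_real r : cnorm1 r%:C = `|r|.
Proof. by rewrite /cnorm1 /= normr0 addr0. Qed.

Lemma cnorm1_sum I (s : seq I) (F : I -> R[i]) :
  cnorm1 (\sum_(i <- s) F i) <= \sum_(i <- s) cnorm1 (F i).
Proof.
elim: s => [|a s IH]; first by rewrite !big_nil /cnorm1 /= normr0 addr0.
by rewrite !big_cons (le_trans (cnorm1D _ _)) // lerD2l.
Qed.

Lemma cnorm1_eq0 z : cnorm1 z = 0 -> z = 0.
Proof.
case: z => a b; rewrite /cnorm1 /= => /eqP.
by rewrite paddr_eq0 // !normr_eq0 => /andP[/eqP -> /eqP ->].
Qed.

Lemma normc_le_cnorm1 z : `|z| <= (cnorm1 z)%:C.
Proof.
case: z => a b; rewrite normc_def lecR /cnorm1 /=.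
rewrite -[leRHS]ger0_norm ?addr_ge0 // -sqrtr_sqr ler_wsqrtr // sqrrD !real_normK ?num_real //.
by rewrite -addrA lerD2l lerDr mulrn_wge0 // mulr_ge0.
Qed.

Lemma cexp0 : cexp (0 : R[i]) = 1.
Proof.
rewrite /cexp /= expR0 cos0 sin0.
by apply/eqP; rewrite eq_complex /=; apply/andP; split; apply/eqP; ring.
Qed.

Lemma cexpD z w : cexp (z + w) = cexp z * cexp w.
Proof.
case: z w => [a b] [c d]; rewrite /cexp /= expRD cosD sinD.
by apply/eqP; rewrite eq_complex /=; apply/andP; split; apply/eqP; ring.
Qed.

Lemma cexpNK z : cexp z * cexp (- z) = 1.
Proof. by rewrite -cexpD subrr cexp0. Qed.

Lemma cnorm1_cexp z : cnorm1 (cexp z) <= 2 * expR (complex.Re z).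
Proof.
case: z => a b; rewrite /cexp /cnorm1 /= !mul0r subr0 addr0 !normrM (gtr0_norm (expR_gt0 a)).
by rewrite -mulrDr mulrC ler_pM2r ?expR_gt0 // -[leRHS](_ : 1 + 1 = _) ?lerD ?cos_max ?sin_max.
Qed.

(* Along [r |-> c z^k cexp (- r z)] differentiation raises [k], so the
   derivative of the Taylor polynomial of [cexp (r z)] times [cexp (- r z)]
   telescopes to its last term. *)
Definition twist z c r : R := complex.Re (c * cexp (- (r%:C * z))).

Lemma twistE z c r : twist z c r = expR (- r * complex.Re z) *
  (complex.Re c * cos (r * complex.Im z) + complex.Im c * sin (r * complex.Im z)).
Proof.
case: z c => [x y] [a b]; rewrite /twist /cexp /=.
rewrite !mul0r !subr0 !addr0 cosN sinN mulNr.
by ring.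
Qed.

Lemma is_derive_twist z c r : is_derive r 1 (twist z c) (- twist z (c * z) r).
Proof.
case: z c => [x y] [a b].
have dl (k : R) : is_derive r 1 (fun u : R => u * k) k.
  have h := is_deriveM (is_derive_id r (1 : R)) (is_derive_cst k r 1).
  by apply: is_derive_eq h _; rewrite /GRing.scale /=; ring.
have de : is_derive r 1 (fun u : R => expR (u * - x)) (expR (r * - x) * - x).
  exact: is_derive1_comp.
have dc : is_derive r 1 (fun u : R => cos (u * y)) (- sin (r * y) * y).
  exact: is_derive1_comp.
have ds : is_derive r 1 (fun u : R => sin (u * y)) (cos (r * y) * y).
  exact: is_derive1_comp.
have h := is_deriveM de (is_deriveD (is_deriveZ a dc) (is_deriveZ b ds)).
have -> : twist (x +i* y) (a +i* b) =
    (fun u : R => expR (u * - x)) * (a \*: (fun u : R => cos (u * y)) + b \*: (fun u : R => sin (u * y))).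
  by apply/funext => u; rewrite twistE /= mulNr -mulrN.
apply: is_derive_eq h _; rewrite twistE /= /GRing.scale /=.
rewrite -[X in X * (expR (r * - x) * - x)]/(a * cos (r * y) + b * sin (r * y)).
by rewrite (_ : - r * x = r * - x); ring.
Qed.

Lemma twist_bound z c r : 0 <= r <= 1 -> `|twist z c r| <= expR (cnorm1 z) * cnorm1 c.
Proof.
case/andP=> r0 r1; rewrite twistE normrM (gtr0_norm (expR_gt0 _)); apply: ler_pM => //.
- rewrite ler_expR (le_trans (ler_norm _)) // normrM normrN (ger0_norm r0).
  by rewrite (le_trans (ler_piMl _ _)) // /cnorm1 lerDl.
- rewrite (le_trans (ler_normD _ _)) // !normrM /cnorm1 lerD //.
    by rewrite ler_piMr // cos_max.
  by rewrite ler_piMr // sin_max.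
Qed.

Definition ctaylor n z : R[i] := \sum_(k < n) z ^+ k / (k`!)%:R.

(** One factor [exp Y] bounds the twisted remainder and the other bounds [cexp z]. Of the 4, one
    factor 2 counts the real and imaginary parts of the remainder and the other comes from
    [cnorm1_cexp]. *)
Definition cexp_err n (Y : R) : R := 4 * expR (2 * Y) * (Y ^+ n.+1 / (n`!)%:R).

Let S z c n r : R := \sum_(k < n) (r ^+ k / (k`!)%:R) * twist z (c * z ^+ k) r.

Let dS z c n r : is_derive r 1 (S z c n.+1) (- (r ^+ n / (n`!)%:R * twist z (c * z ^+ n.+1) r)).
Proof.
elim: n => [|n IH].
  have -> : S z c 1 = twist z c.
    by apply/funext => u; rewrite /S big_ord1 expr0 fact0 divr1 mul1r mulr1.
  by rewrite expr0 fact0 divr1 mul1r expr1; exact: is_derive_twist.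
have -> : S z c n.+2 = S z c n.+1 + (fun u : R => (n.+1`!%:R)^-1 * u ^+ n.+1) * twist z (c * z ^+ n.+1).
  by apply/funext => u; rewrite /S big_ord_recr /= [u ^+ _ / _]mulrC.
have dX : is_derive r 1 (fun u : R => (n.+1`!%:R)^-1 * u ^+ n.+1) (r ^+ n / n`!%:R).
  have h := is_deriveZ ((n.+1`!%:R)^-1 : R) (is_deriveX n.+1 (is_derive_id r (1 : R))).
  have -> : (fun u : R => (n.+1`!%:R)^-1 * u ^+ n.+1) = (n.+1`!%:R)^-1 \*: (id ^+ n.+1).
    by apply/funext => u; congr (_ * _); elim: (n.+1) => // m IHm; rewrite !exprS IHm.
  apply: is_derive_eq h _; rewrite /GRing.scale /= mulr1 factS natrM.
  have e (a b X : R) : a != 0 -> b != 0 -> (a * b)^-1 * (a * X) = X / b.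
    by move=> a0 b0; field; rewrite a0 b0.
  by apply: e; rewrite pnatr_eq0 -?lt0n ?fact_gt0.
have h := is_deriveD IH (is_deriveM dX (is_derive_twist z (c * z ^+ n.+1) r)).
apply: is_derive_eq h _; rewrite /GRing.scale /=.
rewrite (_ : c * z ^+ n.+1 * z = c * z ^+ n.+2); last by rewrite -mulrA -exprSr.
by ring.
Qed.

Let S1 z c n : S z c n 1 = complex.Re (c * (cexp (- z) * ctaylor n z)).
Proof.
have Re_sum (m : nat) (F : 'I_m -> R[i]) :
    complex.Re (\sum_i F i) = \sum_i complex.Re (F i).
  by rewrite (big_morph (@complex.Re R) ReD (erefl _)).
rewrite /ctaylor mulr_sumr mulr_sumr Re_sum; apply: eq_bigr => k _.
rewrite /twist mul1r expr1n -Re_rM; congr complex.Re.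
by rewrite div1r fmorphV rmorph_nat /=; ring.
Qed.

Let S0 z c n : S z c n.+1 0 = complex.Re c.
Proof.
rewrite /S big_ord_recl /= expr0 fact0 divr1 mul1r mulr1 big1 => [|k _].
  by rewrite /twist mul0r oppr0 cexp0 mulr1 addr0.
by rewrite /bump /= expr0n /= !mul0r.
Qed.

Let S_bound z c n :
  `|complex.Re (c * (cexp (- z) * ctaylor n.+1 z - 1))| <=
    expR (cnorm1 z) * cnorm1 c * (cnorm1 z ^+ n.+1 / n`!%:R).
Proof.
have -> : complex.Re (c * (cexp (- z) * ctaylor n.+1 z - 1)) = S z c n.+1 1 - S z c n.+1 0.
  rewrite S1 S0 mulrBr mulr1; case: c => a b.
  by case: (_ * (_ * _)) => u v.
have dSS (x : R) : is_derive x 1 (S z c n.+1) (- (x ^+ n / (n`!)%:R * twist z (c * z ^+ n.+1) x)).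
  exact: dS.
have cS : {within `[0, 1], continuous (S z c n.+1)}.
  apply: continuous_subspaceT => x; apply: differentiable_continuous.
  by apply/derivable1_diffP; case: (dSS x).
have [x x01 ->] := @MVT R _ _ 0 1 ltr01 (fun x _ => dSS x) cS.
rewrite subr0 mulr1 normrN normrM; move: x01; rewrite in_itv /= => /andP[x0 x1].
have x01 : 0 <= x <= 1 by rewrite !ltW.
have n0 : 0 < n`!%:R :> R by rewrite ltr0n fact_gt0.
apply: le_trans (ler_pM _ _ (_ : _ <= (n`!%:R)^-1) (twist_bound z (c * z ^+ n.+1) x01)) _ => //.
  rewrite normrM normfV (gtr0_norm n0) ler_piMl ?invr_ge0 ?(ltW n0) //.
  by rewrite normrX (ger0_norm (ltW x0)) exprn_ile1 // ltW.
have h : cnorm1 (c * z ^+ n.+1) <= cnorm1 c * cnorm1 z ^+ n.+1.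
  by apply: le_trans (cnorm1M _ _) _; rewrite ler_wpM2l ?cnorm1_ge0 ?cnorm1X.
apply: le_trans (ler_wpM2l _ (ler_wpM2l _ h)) _; rewrite ?invr_ge0 ?(ltW n0) ?expR_ge0 //.
by lra.
Qed.

Lemma cexp_taylor n z (Y : R) : cnorm1 z <= Y ->
  cnorm1 (cexp z - ctaylor n.+1 z) <= cexp_err n Y.
Proof.
move=> zY; have z0 := cnorm1_ge0 z.
pose w := cexp (- z) * ctaylor n.+1 z - 1.
have -> : cexp z - ctaylor n.+1 z = - (cexp z * w).
  by rewrite /w mulrBr mulrA cexpNK mul1r mulr1 opprB.
rewrite cnorm1N; apply: le_trans (cnorm1M _ _) _.
(* The weights 1 and [-i] extract the real and the imaginary part of [w]. *)
have w1 := S_bound z 1 n; have w2 := S_bound z (0 +i* (-1)) n.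
rewrite -/w mul1r in w1; rewrite -/w in w2.
have n1 : cnorm1 (1 : R[i]) = 1 by rewrite /cnorm1 /= normr1 normr0 addr0.
have n2 : cnorm1 (0 +i* (-1) : R[i]) = 1 by rewrite /cnorm1 /= normrN1 normr0 add0r.
have imE : complex.Re ((0 +i* (-1)) * w) = complex.Im w.
  by case: (w) => a b /=; ring.
rewrite n1 in w1; rewrite n2 imE in w2.
have n0 : 0 < n`!%:R :> R by rewrite ltr0n fact_gt0.
have Y0 := le_trans z0 zY.
have eY : expR (cnorm1 z) <= expR Y by rewrite ler_expR.
have zn : cnorm1 z ^+ n.+1 / n`!%:R <= Y ^+ n.+1 / n`!%:R.
  by rewrite ler_pM2r ?invr_gt0 // lerXn2r ?nnegrE.
have zn0 : 0 <= cnorm1 z ^+ n.+1 / n`!%:R by rewrite divr_ge0 ?exprn_ge0 // ltW.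
have wle : cnorm1 w <= 2 * (expR Y * (Y ^+ n.+1 / n`!%:R)).
  have h : expR (cnorm1 z) * 1 * (cnorm1 z ^+ n.+1 / n`!%:R) <= expR Y * (Y ^+ n.+1 / n`!%:R).
    by rewrite mulr1; apply: ler_pM => //; exact: expR_ge0.
  by rewrite /cnorm1; lra.
have ez : cnorm1 (cexp z) <= 2 * expR Y.
  apply: le_trans (cnorm1_cexp z) _; rewrite ler_pM2l // ler_expR.
  by apply: le_trans zY; rewrite /cnorm1 (le_trans (ler_norm _)) // lerDl.
apply: le_trans (ler_pM (cnorm1_ge0 _) (cnorm1_ge0 _) ez wle) _.
rewrite /cexp_err (_ : 2 * Y = Y + Y); last by ring.
by rewrite expRD le_eqVlt; apply/orP; left; apply/eqP; ring.
Qed.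

Lemma cexp_err_small (Y e : R) : 0 <= Y -> 0 < e ->
  exists N : nat, forall n, (N <= n)%N -> cexp_err n Y < e.
Proof.
move=> Y0 e0.
have : exp_coeff Y n @[n --> \oo] --> (0 : R).
  by apply: cvg_series_cvg_0; exact: is_cvg_series_exp_coeff.
move=> /(cvgMl_tmp (a := 4 * expR (2 * Y) * Y)); rewrite mulr0.
move=> /cvgrPdist_lt /(_ e e0)[N _ hN]; exists N => n Nn.
have := hN n Nn; rewrite /= distrC subr0 => /(le_lt_trans (ler_norm _)).
congr (_ < _); rewrite /cexp_err /exp_coeff /= exprS; ring.
Qed.

Lemma sum_exp_coeff_le n (r : R) : 0 <= r -> \sum_(k < n) r ^+ k / k`!%:R <= expR r.
Proof.
move=> r0; have := @nondecreasing_cvgn_le R (series (exp_coeff r)).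
rewrite /series /= => h; apply: le_trans (h _ _ n); last first.
- exact: is_cvg_series_exp_coeff.
- apply/nondecreasing_seqP => m; rewrite big_nat_recr //= lerDl /exp_coeff /=.
  by rewrite divr_ge0 // exprn_ge0.
- by rewrite big_mkord.
Qed.

End ComplexExponential.

(** * The beta integrals and their recurrence *)

Section BetaIntegrals.
Context {R : realType}.
Local Notation mu := (@lebesgue_measure R).
Variable al : R.
Hypothesis al01 : 0 < al < 1.

Let v (s : R) : R := expR (al * ln (odds s)).
Let u (j : nat) (s : R) : R := s ^+ j * v s.
(** This is [s^(j + 1 - al) (1 - s)^(1 + al)]: it vanishes at both ends, and its derivative combines
    two consecutive beta integrands. *)
Let W (j : nat) (s : R) : R := s ^+ j.+1 * (1 - s) * v s.
Let I01 : set R := `]0, 1[%classic.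

Let v_gt0 s : 0 < v s. Proof. exact: expR_gt0. Qed.

Let dv (s : R) : 0 < s < 1 -> is_derive s 1 v (- (al * v s / (s * (1 - s)))).
Proof.
move=> s01; have o0 := odds_gt0 s01; case/andP: s01 => s0 s1.
have sn0 : s != 0 by rewrite gt_eqF.
have s1n0 : 1 - s != 0 by rewrite gt_eqF // subr_gt0.
have dod : is_derive s 1 odds (- (s ^+ 2)^-1).
  have h := is_deriveM (is_deriveB (is_derive_cst (1 : R) s 1) (is_derive_id s (1 : R)))
    (is_deriveV sn0 (is_derive_id s (1 : R))).
  apply: is_derive_eq h _; rewrite /GRing.scale /=.
  rewrite -[X in X * (- _ * _)]/(1 - s); rewrite -[X in _ + X * _]/(s^-1).
  by field.
have dl := is_derive1_comp (is_derive1_ln o0) dod.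
have h := @is_derive1_comp R expR (fun s => al * ln (odds s)) s _ _
  (is_derive_expR _) (is_deriveZ al dl).
apply: is_derive_eq h _; rewrite /GRing.scale /= /v /odds.
by field; rewrite sn0 s1n0.
Qed.

Let dW j (s : R) : 0 < s < 1 ->
  is_derive s 1 (W j) ((j.+1%:R - al) * u j s - j.+2%:R * u j.+1 s).
Proof.
move=> s01; have dvs := dv s01; case/andP: s01 => s0 s1.
have sn0 : s != 0 by rewrite gt_eqF.
have s1n0 : 1 - s != 0 by rewrite gt_eqF // subr_gt0.
have dX : is_derive s 1 (fun s : R => s ^+ j.+1) (j.+1%:R * s ^+ j).
  have h := is_deriveX j.+1 (is_derive_id s (1 : R)).
  have -> : (fun s : R => s ^+ j.+1) = id ^+ j.+1.
    by apply/funext => x; elim: (j.+1) => // m IHm; rewrite !exprS IHm.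
  by apply: is_derive_eq h _; rewrite /GRing.scale /= mulr1.
have h := is_deriveM (is_deriveM dX (is_deriveB (is_derive_cst (1 : R) s 1) (is_derive_id s (1 : R)))) dvs.
apply: is_derive_eq h _; rewrite /GRing.scale /=.
rewrite -[X in X * - (_ / _)]/(s ^+ j.+1 * (1 - s)).
rewrite -[X in v s * (_ + X * _)]/(1 - s).
rewrite /u !exprS -[j.+2]addn1 natrD; move: (v s) (s ^+ j) => V X.
by field; rewrite sn0 s1n0.
Qed.

Let cv (s : R) : 0 < s < 1 -> {for s, continuous v}.
Proof.
move=> s01; apply: differentiable_continuous; apply/derivable1_diffP.
by case: (dv s01).
Qed.

Let cu j (s : R) : 0 < s < 1 -> {for s, continuous (u j)}.
Proof. by move=> s01; apply: cvgM; [exact: exprn_continuous|exact: cv]. Qed.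

Let cW j (s : R) : 0 < s < 1 -> {for s, continuous (W j)}.
Proof.
move=> s01; apply: differentiable_continuous; apply/derivable1_diffP.
by case: (dW j s01).
Qed.

Lemma measurable_beta j : measurable_fun (I01 : set (measurableTypeR R)) (u j).
Proof.
apply: open_continuous_measurable_fun; first exact: interval_open.
by move=> s /set_mem; rewrite /I01 /= in_itv /=; exact: cu.
Qed.

Let v_le (s : R) : 0 < s < 1 -> v s <= expR (- al * ln s).
Proof.
case/andP: al01 => al0 al1 s01; have o0 := odds_gt0 s01; case/andP: s01 => s0 s1.
rewrite ler_expR mulNr -mulrN ler_pM2l // -lnV ?posrE // ler_ln ?posrE ?invr_gt0 //.
by rewrite /odds ler_piMl ?invr_ge0 ?(ltW s0) //; lra.
Qed.

(** The exponent [1 - al] is positive, so [s v s] is bounded and tends to 0 with [s]; this controls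
    the endpoint where [v] blows up. *)
Let sv_le (s : R) : 0 < s < 1 -> s * v s <= expR ((1 - al) * ln s).
Proof.
move=> s01; have h := v_le s01; case/andP: s01 => s0 s1.
rewrite mulrBl mul1r expRD lnK ?posrE // -mulNr.
by rewrite ler_pM2l.
Qed.

Let sv_le1 (s : R) : 0 < s < 1 -> s * v s <= 1.
Proof.
move=> s01; apply: le_trans (sv_le s01) _; rewrite -[leRHS]expR0 ler_expR.
case/andP: al01 => al0 al1; case/andP: s01 => s0 s1.
by apply: mulr_ge0_le0; [lra|rewrite ln_le0 // ltW].
Qed.

(** The shift by 3 keeps [eps n] below 1/2, so that [J n] is a proper interval. *)
Let eps (n : nat) : R := n.+3%:R^-1.

Let eps_bounds n : 0 < eps n /\ eps n < 2^-1.
Proof.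
rewrite /eps invr_gt0 ltr0n; split=> //.
by rewrite ltf_pV2 ?posrE ?ltr0n // ltr_nat.
Qed.

Let eps_decr m n : (m <= n)%N -> eps n <= eps m.
Proof. by move=> mn; rewrite /eps lef_pV2 ?posrE ?ltr0n // ler_nat. Qed.

Let eps_small e : 0 < e -> exists N, forall n, (N <= n)%N -> eps n < e.
Proof.
move=> e0; exists (Num.truncn e^-1).+1 => n hn.
rewrite /eps -[e]invrK ltf_pV2 ?posrE ?ltr0n ?invr_gt0 //.
apply: lt_le_trans (truncnS_gt _) _; rewrite ler_nat.
by apply: leq_trans hn _; rewrite -addn3 leq_addr.
Qed.

Let J n : set (measurableTypeR R) := `[eps n, 1 - eps n]%classic.

Let J_sub n (s : R) : J n s -> 0 < s < 1.
Proof.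
have [e0 e1] := eps_bounds n; rewrite /J /= in_itv /= => /andP[h1 h2].
by apply/andP; split; lra.
Qed.

Let J_cup : \bigcup_n J n = I01.
Proof.
apply/seteqP; split=> s; first by move=> [n _ /J_sub]; rewrite /I01 /= in_itv.
rewrite /I01 /= in_itv /= => /andP[s0 s1].
have s1' : 0 < 1 - s by lra.
have [N1 h1] := eps_small s0; have [N2 h2] := eps_small s1'.
exists (maxn N1 N2) => //; rewrite /J /= in_itv /=.
have := h1 (maxn N1 N2) (leq_maxl _ _); have := h2 (maxn N1 N2) (leq_maxr _ _).
by move=> ? ?; apply/andP; split; lra.
Qed.

Let beta_cvg j : (\int[mu]_(s in J n) (u j s)%:E)%E @[n --> \oo] -->
  (\int[mu]_(s in I01) (u j s)%:E)%E.
Proof.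
rewrite -J_cup; apply: ge0_nondecreasing_set_cvg_integral.
- move=> m n mn; apply/subsetPset => s; rewrite /J /= !in_itv /= => /andP[h1 h2].
  by have := eps_decr mn; move=> ?; apply/andP; split; lra.
- by move=> n; exact: measurable_itv.
- move=> n; apply/measurable_EFinP; apply: measurable_funS (measurable_beta j).
    exact: measurable_itv.
  by move=> s /J_sub; rewrite /I01 /= in_itv.
- by move=> n s /J_sub /andP[s0 _]; rewrite lee_fin mulr_ge0 ?exprn_ge0 // ltW.
Qed.

Let integrable_J j n : mu.-integrable (J n) (EFin \o u j).
Proof.
apply: continuous_compact_integrable; first exact: segment_compact.
apply: continuous_in_subspaceT => s; rewrite inE => /J_sub; exact: cu.
Qed.

Let beta_ftc j n : (j.+1%:R - al) * \int[mu]_(s in J n) u j s -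
  j.+2%:R * \int[mu]_(s in J n) u j.+1 s = W j (1 - eps n) - W j (eps n).
Proof.
have [e0 e1] := eps_bounds n.
have mJ : measurable (J n) by exact: measurable_itv.
rewrite -!RintegralZl //; try exact: integrable_J.
rewrite -RintegralB //; last 2 first.
- exact: (integrableZl mJ _ (integrable_J j n)).
- exact: (integrableZl mJ _ (integrable_J j.+1 n)).
have e12 : eps n < 1 - eps n by lra.
have in01 (s : R) : eps n <= s <= 1 - eps n -> 0 < s < 1.
  by move=> /andP[h1 h2]; apply/andP; split; lra.
rewrite /Rintegral (@continuous_FTC2 _ _ (W j)) //.
- apply: continuous_in_subspaceT => s; rewrite inE => /J_sub s01.
  by apply: cvgB; apply: cvgMl_tmp; exact: cu.
- split=> [s||].
  + by rewrite in_itv /= => /andP[h1 h2]; case: (@dW j s _) => //; apply: in01; rewrite !ltW.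
  + by apply: cvg_at_right_filter; apply: cW; apply: in01; rewrite lexx ltW.
  + by apply: cvg_at_left_filter; apply: cW; apply: in01; rewrite lexx ltW.
- move=> s; rewrite in_itv /= => /andP[h1 h2]; rewrite derive1E.
  have d := @dW j s (in01 s _); have {}d := d (ltac:(by rewrite !ltW)).
  exact: derive_val.
Qed.

Let W_ge0 j (s : R) : 0 < s < 1 -> 0 <= W j s.
Proof.
case/andP=> s0 s1; rewrite !mulr_ge0 ?exprn_ge0 ?(ltW s0) //; first lra.
exact: ltW.
Qed.

Let W_le j (s : R) : 0 < s < 1 -> W j s <= (1 - s) * (s * v s).
Proof.
case/andP=> s0 s1; have -> : W j s = s ^+ j * ((1 - s) * (s * v s)) by rewrite /W exprS; ring.
rewrite ler_piMl ?exprn_ile1 ?(ltW s0) ?(ltW s1) //.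
by rewrite mulr_ge0 ?mulr_ge0 ?(ltW s0) ?(ltW (v_gt0 s)) //; lra.
Qed.

Let W_cvg1 j : W j (1 - eps n) @[n --> \oo] --> (0 : R).
Proof.
apply/cvgrPdist_lt => e e0; have [N hN] := eps_small e0; exists N => // n /= Nn.
have [h1 h2] := eps_bounds n.
have s01 : 0 < 1 - eps n < 1 by apply/andP; split; lra.
rewrite sub0r normrN ger0_norm ?W_ge0 //; apply: le_lt_trans (W_le j s01) _.
apply: le_lt_trans (hN n Nn); rewrite subKr ler_piMr ?sv_le1 //; lra.
Qed.

Let W_cvg0 j : W j (eps n) @[n --> \oo] --> (0 : R).
Proof.
case/andP: al01 => al0 al1; have al1' : 0 < 1 - al by lra.
apply/cvgrPdist_lt => e e0.
have [N hN] := eps_small (expR_gt0 (ln e / (1 - al))); exists N => // n /= Nn.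
have [h1 h2] := eps_bounds n.
have s01 : 0 < eps n < 1 by apply/andP; split; lra.
rewrite sub0r normrN ger0_norm ?W_ge0 //; apply: le_lt_trans (W_le j s01) _.
have p0 : 0 <= eps n * v (eps n) by rewrite mulr_ge0 // ltW.
apply: le_lt_trans (_ : _ <= eps n * v (eps n)) _; first by rewrite ler_piMl //; lra.
apply: le_lt_trans (sv_le s01) _; rewrite -[ltRHS]lnK ?posrE // ltr_expR mulrC -ltr_pdivlMr //.
by rewrite -ltr_expR lnK ?posrE // hN.
Qed.

(** The beta function at [j + 1 - al] and [1 + al]. *)
Definition beta_int j : R := \int[mu]_(s in `]0, 1[) (s ^+ j * expR (al * ln (odds s))).

Let mI01 : measurable (I01 : set (measurableTypeR R)).
Proof. exact: measurable_itv. Qed.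

Let fin_I01 : (mu (I01 : set (measurableTypeR R)) < +oo)%E.
Proof.
by rewrite (lebesgue_measure_itv `]0%R, 1%R[%R) /= lte_fin ltr01 -EFinB ltry.
Qed.

Lemma beta_integrableS j : mu.-integrable I01 (EFin \o u j.+1).
Proof.
apply: measurable_bounded_integrable.
- exact: measurable_itv.
- exact: fin_I01.
- exact: measurable_beta.
- exists 1; split=> // y y1 s; rewrite /I01 /= in_itv /= => s01.
  apply: le_trans (ltW y1); case/andP: (s01) => s0 s1.
  rewrite ger0_norm /u; last by rewrite mulr_ge0 ?exprn_ge0 // ltW.
  rewrite exprSr -mulrA mulr_ile1 ?exprn_ge0 ?exprn_ile1 ?sv_le1 ?(ltW s0) ?(ltW s1) //.
  by rewrite mulr_ge0 // ltW.
Qed.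

(** For [j = 0] the integrand is unbounded at 0, so integrability cannot be read off a bound.
    Integrating the derivative of [W] over [J n] expresses the truncated integral by the next,
    bounded, integrand; in the limit this yields finiteness and recurrence at once. *)
Lemma beta_step j : mu.-integrable I01 (EFin \o u j) /\
  (j.+1%:R - al) * beta_int j = j.+2%:R * beta_int j.+1.
Proof.
case/andP: (al01) => al0 al1.
have jal : j.+1%:R - al != 0.
  by rewrite gt_eqF // subr_gt0 (lt_le_trans al1) // ler1n.
pose a k n := \int[mu]_(s in J n) u k s.
have aE k n : (a k n)%:E = (\int[mu]_(s in J n) (u k s)%:E)%E.
  rewrite /a /Rintegral fineK //.
  have mJ : measurable (J n) by exact: measurable_itv.
  exact: (@integrable_fin_num _ (measurableTypeR R) R mu _ mJ _ (integrable_J k n)).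
have a1 : a j.+1 n @[n --> \oo] --> beta_int j.+1.
  have := @beta_cvg j.+1.
  rewrite (_ : (\int[mu]_(s in I01) _)%E = (beta_int j.+1)%:E); last first.
    rewrite /beta_int /Rintegral fineK //.
    exact: (@integrable_fin_num _ (measurableTypeR R) R mu _ mI01 _ (beta_integrableS j)).
  under eq_fun do rewrite -aE.
  by move=> /fine_cvgP[_].
pose L := (j.+1%:R - al)^-1 * (j.+2%:R * beta_int j.+1).
have a0 : a j n @[n --> \oo] --> L.
  have -> : a j = fun n => (j.+1%:R - al)^-1 * (j.+2%:R * a j.+1 n + (W j (1 - eps n) - W j (eps n))).
    by apply/funext => n; rewrite -beta_ftc -/(a j n) -/(a j.+1 n) subrKC mulKf.
  have -> : L = (j.+1%:R - al)^-1 * (j.+2%:R * beta_int j.+1 + (0 - 0)) by rewrite subrr addr0.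
  apply: cvgMl_tmp; apply: cvgD; first by apply: cvgMl_tmp.
  by apply: cvgB; [exact: W_cvg1|exact: W_cvg0].
have intE : (\int[mu]_(s in I01) (u j s)%:E)%E = L%:E.
  have := @beta_cvg j; under eq_fun do rewrite -aE.
  move=> b; apply: (cvg_unique (@ereal_hausdorff R) b).
  by apply/fine_cvgP; split; first exact: nearW.
split.
  apply/integrableP; split; first by apply/measurable_EFinP; exact: measurable_beta.
  rewrite (_ : integral _ _ _ = L%:E) ?ltry //.
  rewrite -intE; apply: eq_integral => s /set_mem.
  rewrite /I01 /= in_itv /= => /andP[s0 _]; rewrite ger0_norm //.
  by rewrite mulr_ge0 ?exprn_ge0 // ltW.
by rewrite {1}/beta_int /Rintegral intE /= /L mulrA divff // mul1r.
Qed.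

(** On []0, 1/2[] the odds are at least 1, hence so is the integrand. *)
Lemma beta_gt0 : 0 < beta_int 0.
Proof.
have [int0 _] := beta_step 0.
have sub : (`]0, 2^-1[%classic : set (measurableTypeR R)) `<=` I01.
  by move=> s; rewrite /I01 /= !in_itv /= => /andP[-> h]; apply: lt_trans h _; lra.
have h : (\int[mu]_(s in `]0%R, 2^-1%R[) (cst 1 s)%:E <= \int[mu]_(s in I01) (u 0 s)%:E)%E.
  apply: le_trans (_ : _ <= \int[mu]_(s in `]0%R, 2^-1%R[) (u 0 s)%:E)%E _; last first.
    apply: ge0_subset_integral => //.
      by apply/measurable_EFinP; exact: measurable_beta.
    by move=> s _; rewrite lee_fin /u expr0 mul1r ltW.
  apply: ge0_le_integral.
  - exact: measurable_itv.
  - by move=> s _; rewrite lee_fin.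
  - by apply/measurable_EFinP; exact: measurable_cst.
  - apply/measurable_EFinP; apply: measurable_funS mI01 sub (measurable_beta 0).
  - move=> s; rewrite /= in_itv /= => /andP[s0 s1]; rewrite lee_fin /u expr0 mul1r.
    rewrite -[leLHS]expR0 ler_expR mulr_ge0 //; first by case/andP: al01 => /ltW.
    by rewrite ln_ge0 // /odds ler_pdivlMr //; lra.
have fin0 : (\int[mu]_(s in I01) (u 0 s)%:E)%E \is a fin_num.
  exact: (@integrable_fin_num _ (measurableTypeR R) R mu _ mI01 _ int0).
have : ((2^-1)%:E <= (beta_int 0)%:E)%E.
  rewrite [leRHS](_ : _ = \int[mu]_(s in I01) (u 0 s)%:E)%E; last first.
    by rewrite /beta_int /Rintegral fineK.
  apply: le_trans h.
  have mh : measurable (`]0%R, (2^-1)%R[%classic : set (measurableTypeR R)) by exact: measurable_itv.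
  rewrite [leRHS](@integral_cst _ (measurableTypeR R) R mu _ mh 1%E).
  rewrite mul1e [leRHS](lebesgue_measure_itv `]0%R, (2^-1)%R[%R).
  by rewrite /= lte_fin invr_gt0 ltr0n -EFinB subr0.
by rewrite lee_fin; apply: lt_le_trans; rewrite invr_gt0.
Qed.

End BetaIntegrals.

(** * Kummer's series for exponents between 0 and 1 *)

Section RealPowerMoment.
Context {R : realType}.
Local Notation mu := (@lebesgue_measure R).
Variables (nu : probability (measurableTypeR R) R) (K : set R).
Hypotheses (K_compact : compact K) (K_pos : K `<=` `]0, +oo[) (K_full : nu K = 1%E).
Variables (t : R).
Hypothesis functional_eq : forall s, 0 < s < 1 ->
  1 - pinv t s * \int[nu]_(x in `]0, +oo[) (pinv t s + x)^-1 = s.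
Variable al : R.
Hypothesis al01 : 0 < al < 1.

Let D : set R := `]0, +oo[%classic.
Let T := measurableTypeR R.
Let I01 : set T := `]0, 1[%classic.
Let v (s : R) : R := expR (al * ln (odds s)).

Lemma expR_taylor n (y Y : R) : `|y| <= Y ->
  `|expR y - \sum_(j < n.+1) y ^+ j / j`!%:R| <= cexp_err n Y.
Proof.
move=> yY; have := @cexp_taylor R n y%:C Y; rewrite cnorm1_real => /(_ yY).
apply: le_trans; rewrite /cnorm1.
rewrite (_ : complex.Re _ = expR y - \sum_(j < n.+1) y ^+ j / j`!%:R) ?lerDl //.
have -> : ctaylor n.+1 y%:C = (\sum_(j < n.+1) y ^+ j / j`!%:R)%:C.
  rewrite rmorph_sum; apply: eq_bigr => j _.
  by rewrite rmorphM rmorphXn /= fmorphV rmorph_nat.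
by rewrite /cexp /= cos0 sin0; ring.
Qed.

(** The quotient of the rising factorials of [1 - al] and 2, obtained by iterating the ratio of
    consecutive beta integrals. *)
Let rho (j : nat) : R := \prod_(i < j) ((i.+1%:R - al) / i.+2%:R).

Let beta_rho j : beta_int al j = beta_int al 0 * rho j.
Proof.
elim: j => [|j IH]; first by rewrite /rho big_ord0 mulr1.
have [_ h] := beta_step al01 j.
have j2 : j.+2%:R != 0 :> R by rewrite pnatr_eq0.
apply: (mulfI j2); rewrite -h IH /rho big_ord_recr /=.
move: j2 {h IH}; move: (\prod_(i < j) _) (beta_int al 0) (j.+1%:R - al) (j.+2%:R : R).
by move=> P B a c c0; field.
Qed.

Let B0 := beta_int al 0.
Let m_I01 : measurable I01. Proof. exact: measurable_itv. Qed.

Let int_u j : mu.-integrable I01 (EFin \o (fun s : R => s ^+ j * v s)).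
Proof. by have [h _] := beta_step al01 j. Qed.

Let f (s : R) : R := expR (al * ln (pinv t s)).

Let fE s : 0 < s < 1 -> f s = expR (al * t / 2) * (expR (- (al * t) * s) * v s).
Proof.
move=> s01; rewrite /f /pinv lnM ?posrE ?odds_gt0 ?expR_gt0 // expRK.
by rewrite mulrDr expRD mulrC mulrA -expRD; congr (expR _ * _); field.
Qed.

Let I := \int[nu]_(x in D) expR (al * ln x).

Let int_I : nu.-integrable D (EFin \o (fun x : R => expR (al * ln x))).
Proof.
have [m [L [m0 m1 L1 hK]]] := K_bounds K_compact K_pos K_full.
case/andP: al01 => al0 _.
apply: (nu_integrable K_compact K_pos K_full (C := expR (al * ln L))).
  apply: measurableT_comp; first exact: measurable_expR.
  apply: measurable_funM; first exact: measurable_cst.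
  by apply: measurable_funTS; exact: measurable_ln.
move=> x Kx; have /andP[_ xL] := hK x Kx; rewrite gtr0_norm ?expR_gt0 //.
by rewrite ler_expR ler_pM2l // ler_ln ?posrE ?(K_gt0 K_pos Kx) //; lra.
Qed.

(** The Mellin identity equates extended integrals; finiteness of its right side yields
    integrability of [f] along with the value. *)
Let int_f : mu.-integrable I01 (EFin \o f) /\ \int[mu]_(s in I01) f s = I * B0.
Proof.
case/andP: (al01) => al0 _.
have := mellin_identity K_compact K_pos K_full functional_eq al0.
have -> : (\int[nu]_(x in D) (expR (al * ln x))%:E)%E = I%:E.
  by rewrite /I /Rintegral fineK //; exact: (@integrable_fin_num _ T R nu D (D_measurable (R := R)) _ int_I).
have -> : (\int[mu]_(s in I01) (expR (al * ln (odds s)))%:E)%E = B0%:E.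
  have i0 := int_u 0.
  have -> : (\int[mu]_(s in I01) (expR (al * ln (odds s)))%:E = \int[mu]_(s in I01) (s ^+ 0 * v s)%:E)%E.
    by apply: eq_integral => s _; rewrite expr0 mul1r.
  by rewrite /B0 /beta_int /Rintegral fineK //; exact: (@integrable_fin_num _ T R mu I01 m_I01 _ i0).
rewrite -EFinM => e.
split; last by rewrite /Rintegral e.
apply/integrableP; split.
  apply/measurable_EFinP; apply: measurableT_comp; first exact: measurable_expR.
  apply: measurable_funM; first exact: measurable_cst.
  by apply: measurableT_comp (measurable_pinv t); exact: measurable_ln.
rewrite (_ : integral _ _ _ = (I * B0)%:E) ?ltry //.
rewrite -e; apply: eq_integral => s _.
by rewrite /= gtr0_norm // expR_gt0.
Qed.

(** Expand [exp (- al t s)] in powers of [s] and integrate against the beta weight [v]. The Taylor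
    error is uniform in [0 < s < 1], so it is multiplied by [B0], which the normalisation removes
    again. *)
Lemma power_moment_kummer (e : R) : 0 < e -> exists N, forall n, (N <= n)%N ->
  `|I * expR (- (al * t / 2)) -
    \sum_(j < n) (\prod_(i < j) ((i.+1%:R - al) / i.+2%:R)) * ((- (al * t)) ^+ j / j`!%:R)| < e.
Proof.
move=> e0; pose Y := `|al * t|.
have [N hN] := @cexp_err_small R Y e (normr_ge0 _) e0.
exists N.+1 => -[//|n] Nn.
apply: le_lt_trans (hN n Nn).
have B0_gt0 : 0 < B0 by exact: beta_gt0.
pose cf j : R := (- (al * t)) ^+ j / j`!%:R.
pose ex := expR (al * t / 2).
have ex0 : 0 < ex by exact: expR_gt0.
pose S m (s : R) := \sum_(j < m) cf j * (s ^+ j * v s).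
have SI m : mu.-integrable I01 (EFin \o S m) /\
    \int[mu]_(s in I01) S m s = \sum_(j < m) cf j * beta_int al j.
  elim: m => [|m [IH1 IH2]].
    have e0' : S 0%N = cst 0 by apply/funext => s; rewrite /S big_ord0.
    rewrite e0' big_ord0; split; first exact: integrable0.
    by rewrite /Rintegral integral0.
  have e1 : S m.+1 = (fun s => S m s + cf m * (s ^+ m * v s)).
    by apply/funext => s; rewrite /S big_ord_recr.
  have i1 : mu.-integrable I01 (EFin \o (fun s => cf m * (s ^+ m * v s))).
    exact: (@integrableZl _ T R mu I01 m_I01 (cf m) _ (int_u m)).
  rewrite e1; split; first exact: (@integrableD _ T R mu I01 m_I01 _ _ IH1 i1).
  by rewrite RintegralD // RintegralZl // big_ord_recr /= IH2.
have [fI fE'] := int_f; have [S1 S2] := SI n.+1.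
have i3 : mu.-integrable I01 (EFin \o (fun s => ex * S n.+1 s)).
  exact: (@integrableZl _ T R mu I01 m_I01 ex _ S1).
have i4 : mu.-integrable I01 (EFin \o (fun s : R => ex * cexp_err n Y * (s ^+ 0 * v s))).
  exact: (@integrableZl _ T R mu I01 m_I01 (ex * cexp_err n Y) _ (int_u 0)).
have i5 : mu.-integrable I01 (EFin \o (fun s => f s - ex * S n.+1 s)).
  exact: (@integrableB _ T R mu I01 m_I01 _ _ fI i3).
have main : `|\int[mu]_(s in I01) f s - ex * \int[mu]_(s in I01) S n.+1 s| <= ex * cexp_err n Y * B0.
  rewrite -RintegralZl // -RintegralB //.
  apply: le_trans (@le_normr_Rintegral _ T R mu I01 _ m_I01 i5) _.
  apply: le_trans (_ : _ <= \int[mu]_(s in I01) (ex * cexp_err n Y * (s ^+ 0 * v s))) _; last first.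
    by rewrite RintegralZl.
  apply: le_Rintegral => //; first exact: (@integrable_norm _ T R mu I01 _ i5).
  move=> s; rewrite /I01 /= in_itv /= => s01; case/andP: (s01) => s0 s1.
  have SE : S n.+1 s = (\sum_(j < n.+1) (- (al * t) * s) ^+ j / j`!%:R) * v s.
    rewrite /S mulr_suml; apply: eq_bigr => j _; rewrite /cf exprMn.
    by ring.
  rewrite fE // SE -/ex -mulrBr -mulrBl !normrM (gtr0_norm ex0) (gtr0_norm (expR_gt0 _)).
  rewrite expr0 mul1r -mulrA ler_pM2l // ler_pM2r ?expR_gt0 //.
  apply: expR_taylor; rewrite normrM normrN -/Y (gtr0_norm s0).
  by rewrite ler_piMr ?normr_ge0 // ltW.
move: main; rewrite fE' S2.
have -> : \sum_(j < n.+1) cf j * beta_int al j = B0 * \sum_(j < n.+1) rho j * cf j.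
  by rewrite mulr_sumr; apply: eq_bigr => j _; rewrite beta_rho -/B0; ring.
set X := \sum_(j < n.+1) rho j * cf j => main.
have exN : expR (- (al * t / 2)) = ex^-1 by rewrite expRN.
rewrite exN.
have -> : I / ex - X = (I * B0 - ex * (B0 * X)) / (ex * B0).
  by field; rewrite !gt_eqF.
rewrite normrM normfV (gtr0_norm (x := ex * B0)) ?mulr_gt0 // ler_pdivrMr ?mulr_gt0 //.
by apply: le_trans main _; lra.
Qed.

End RealPowerMoment.

(** * Kummer's series rearranged as a power series in the exponent *)

Section KummerPowerSeries.
Context {R : realType}.
Local Notation C := R[i].
Implicit Types (p : {poly C}) (q : {poly R}).

Lemma cnorm1_scale (r : R) (z : C) : cnorm1 (r%:C * z) = `|r| * cnorm1 z.
Proof.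
by case: z => a b; rewrite /cnorm1 /= !mul0r subr0 addr0 !normrM mulrDr.
Qed.

(** Cauchy's majorants: estimates on complex polynomials reduce to values of polynomials with
    nonnegative coefficients. *)
Definition majorized p q := forall k : nat, cnorm1 p`_k <= q`_k.

Lemma majorizedM p p' q q' : majorized p q -> majorized p' q' -> majorized (p * p') (q * q').
Proof.
move=> h h' k; rewrite !coefM; apply: le_trans (cnorm1_sum _ _) _.
apply: ler_sum => i _; apply: le_trans (cnorm1M _ _) _.
by apply: ler_pM; rewrite ?cnorm1_ge0.
Qed.

Lemma majorizedC (z : C) (r : R) : cnorm1 z <= r -> majorized z%:P r%:P.
Proof. by move=> zr [|k]; rewrite !coefC //= cnorm1_real normr0. Qed.

Lemma majorized1 : majorized 1 1.
Proof. by apply: majorizedC; rewrite /cnorm1 /= normr1 normr0 addr0. Qed.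

Lemma majorizedX : majorized 'X 'X.
Proof.
move=> k; rewrite !coefX; case: (k == 1)%N => /=.
  by rewrite /cnorm1 /= normr1 normr0 addr0.
by rewrite /cnorm1 /= normr0 addr0.
Qed.

Lemma majorizedD p p' q q' : majorized p q -> majorized p' q' -> majorized (p + p') (q + q').
Proof. by move=> h h' k; rewrite !coefD (le_trans (cnorm1D _ _)) // lerD. Qed.

Lemma majorizedN p q : majorized p q -> majorized (- p) q.
Proof. by move=> h k; rewrite coefN cnorm1N. Qed.

Lemma majorized_exp p q n : majorized p q -> majorized (p ^+ n) (q ^+ n).
Proof.
move=> h; elim: n => [|n IH]; first exact: majorized1.
by rewrite !exprS; exact: majorizedM.
Qed.

Lemma majorized_prod n (F : 'I_n -> {poly C}) (G : 'I_n -> {poly R}) :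
  (forall i, majorized (F i) (G i)) -> majorized (\prod_i F i) (\prod_i G i).
Proof. by move=> h; elim/big_rec2: _ => [|i x y _ IH]; [exact: majorized1|exact: majorizedM]. Qed.

(** From [r^k = 2^-k (2 r)^k], every coefficient of degree at least [n] gains the factor [2^-n] when
    the majorant is evaluated at [2 r]. *)
Lemma majorized_tail p q n (z : C) (r : R) : majorized p q -> cnorm1 z <= r ->
  cnorm1 (p.[z] - \sum_(k < n) p`_k * z ^+ k) <= 2 ^- n * q.[2 * r].
Proof.
move=> pq zr; have r0 := le_trans (cnorm1_ge0 z) zr.
have q0 k : 0 <= q`_k by exact: le_trans (cnorm1_ge0 _) (pq k).
pose m := maxn (size p) (size q).
have pm : (size p <= n + m)%N by rewrite (leq_trans (leq_maxl _ (size q))) // leq_addl.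
have qm : (size q <= n + m)%N by rewrite (leq_trans (leq_maxr (size p) _)) // leq_addl.
rewrite (horner_coef_wide _ pm) (horner_coef_wide _ qm) !big_split_ord /=.
rewrite addrAC subrr add0r; apply: le_trans (cnorm1_sum _ _) _.
apply: (@le_trans _ _ (2 ^- n * \sum_(i < m) q`_(n + i) * (2 * r) ^+ (n + i))); last first.
  rewrite ler_wpM2l ?invr_ge0 ?exprn_ge0 // lerDr sumr_ge0 // => i _.
  by rewrite mulr_ge0 // exprn_ge0 // mulr_ge0.
rewrite mulr_sumr; apply: ler_sum => i _; apply: le_trans (cnorm1M _ _) _.
rewrite mulrCA; apply: ler_pM; rewrite ?cnorm1_ge0 //.
apply: le_trans (cnorm1X _ _) _.
apply: (@le_trans _ _ (r ^+ (n + i))); first by rewrite lerXn2r ?nnegrE ?cnorm1_ge0.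
rewrite exprMn mulrA ler_peMl ?exprn_ge0 // exprD mulrA mulVf ?expf_neq0 // mul1r.
by rewrite exprn_ege1 // ler1n.
Qed.

Variable t : R.

(** The exponent occurs both in the parameter [1 - z] and in the argument [- z t], so each term of
    the series is a polynomial in it, of degree at most [2 j] and divisible by ['X^j]. In
    [kummer_major] all signs are made positive. *)
Definition kummer_poly (j : nat) : {poly C} :=
  \prod_(i < j) ((i.+2%:R^-1)%:P * (i.+1%:R%:P - 'X)) * ((- t%:C)%:P * 'X) ^+ j * (j`!%:R^-1)%:P.

Definition kummer_major (j : nat) : {poly R} :=
  \prod_(i < j) ((i.+2%:R^-1)%:P * (i.+1%:R%:P + 'X)) * (`|t|%:P * 'X) ^+ j * (j`!%:R^-1)%:P.

Lemma kummer_majorized j : majorized (kummer_poly j) (kummer_major j).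
Proof.
have cn (n : nat) : cnorm1 (n%:R : C) = n%:R by rewrite -(rmorph_nat (real_complex R)) cnorm1_real normr_nat.
have cv (n : nat) : cnorm1 (n%:R^-1 : C) = n%:R^-1.
  by rewrite -(rmorph_nat (real_complex R)) -fmorphV cnorm1_real normfV normr_nat.
apply: majorizedM; last by apply: majorizedC; rewrite cv.
apply: majorizedM.
  apply: majorized_prod => i; apply: majorizedM; first by apply: majorizedC; rewrite cv.
  by apply: majorizedD; [apply: majorizedC; rewrite cn|apply: majorizedN; exact: majorizedX].
apply: majorized_exp; apply: majorizedM; last exact: majorizedX.
by apply: majorizedC; rewrite cnorm1N cnorm1_real.
Qed.

Lemma kummer_polyE j (z : C) : (kummer_poly j).[z] =
  \prod_(i < j) ((i.+1%:R - z) / i.+2%:R) * ((- (z * t%:C)) ^+ j / j`!%:R).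
Proof.
rewrite /kummer_poly !hornerM hornerC horner_prod horner_exp hornerM hornerC hornerX.
rewrite mulrA; congr (_ * _ / _).
  by apply: eq_bigr => i _; rewrite hornerM hornerD hornerN !hornerC hornerX mulrC.
by rewrite mulNr [t%:C * z]mulrC.
Qed.

Definition kummer_growth (r : R) : R := (1 + r) * (`|t| * r).

Lemma kummer_major_le j (r : R) : 0 <= r ->
  (kummer_major j).[r] <= kummer_growth r ^+ j / j`!%:R.
Proof.
move=> r0; rewrite /kummer_major !hornerM hornerC horner_prod horner_exp hornerM hornerC hornerX.
rewrite ler_wpM2r ?invr_ge0 // /kummer_growth [in leRHS]exprMn ler_wpM2r //.
  by rewrite exprn_ge0 // mulr_ge0.
apply: (@le_trans _ _ (\prod_(i < j) (1 + r))); last by rewrite big_const card_ord iter_mulr_1.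
apply: ler_prod => i _; rewrite !hornerE.
have i2 : 0 < i.+2%:R :> R by rewrite ltr0n.
have i1 : 0 <= i%:R :> R by [].
have s0 : 0 <= i.+1%:R + r by rewrite addr_ge0 // ler0n.
have v0 : 0 <= i.+2%:R^-1 :> R by rewrite invr_ge0 ler0n.
rewrite (mulr_ge0 v0 s0) /=.
rewrite mulrC ler_pdivrMr //.
rewrite -!natr1; nra.
Qed.

Lemma kummer_major_sum n (r : R) : 0 <= r ->
  \sum_(j < n) (kummer_major j).[r] <= expR (kummer_growth r).
Proof.
move=> r0; have g0 : 0 <= kummer_growth r by rewrite mulr_ge0 ?mulr_ge0 ?addr_ge0.
apply: (@le_trans _ _ (\sum_(j < n) kummer_growth r ^+ j / j`!%:R)).
  by apply: ler_sum => j _; exact: kummer_major_le.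
exact: sum_exp_coeff_le.
Qed.

Lemma kummer_poly_low j k : (k < j)%N -> (kummer_poly j)`_k = 0.
Proof.
move=> kj; rewrite /kummer_poly exprMn_comm; last exact: mulrC.
by rewrite coefMC mulrA coefMXn kj mul0r.
Qed.

(** By [kummer_poly_low] only the terms with [j <= k] reach degree [k], so the coefficient is a
    finite sum. *)
Definition kummer_coef (k : nat) : C := \sum_(j < k.+1) (kummer_poly j)`_k.

(** Exchanging the sums leaves the parts of degree at least [n] of the first [n] polynomials;
    [majorized_tail] bounds each, and the majorants sum to an exponential. *)
Lemma kummer_rearrange n (z : C) (r : R) : cnorm1 z <= r ->
  cnorm1 (\sum_(j < n) (kummer_poly j).[z] - \sum_(k < n) kummer_coef k * z ^+ k) <=
    2 ^- n * expR (kummer_growth (2 * r)).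
Proof.
move=> zr; have r0 := le_trans (cnorm1_ge0 z) zr.
have -> : \sum_(k < n) kummer_coef k * z ^+ k = \sum_(j < n) \sum_(k < n) (kummer_poly j)`_k * z ^+ k.
  rewrite exchange_big /=; apply: eq_bigr => k _; rewrite -mulr_suml; congr (_ * _).
  rewrite /kummer_coef (big_ord_widen n (fun j => (kummer_poly j)`_k)) // big_mkcond /=.
  apply: eq_bigr => j _; case: ifPn => //; rewrite -leqNgt => kj.
  by rewrite kummer_poly_low.
rewrite -sumrB; apply: le_trans (cnorm1_sum _ _) _.
apply: (@le_trans _ _ (\sum_(j < n) 2 ^- n * (kummer_major j).[2 * r])).
  by apply: ler_sum => j _; apply: majorized_tail zr; exact: kummer_majorized.
rewrite -mulr_sumr ler_wpM2l ?invr_ge0 ?exprn_ge0 //.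
by apply: kummer_major_sum; rewrite mulr_ge0.
Qed.

(** A coefficient of a polynomial with nonnegative coefficients is at most its value at 1. *)
Lemma kummer_coef_bound k : cnorm1 (kummer_coef k) <= expR (kummer_growth 1).
Proof.
apply: le_trans (cnorm1_sum _ _) _.
apply: le_trans (kummer_major_sum k.+1 ler01); apply: ler_sum => j _.
apply: le_trans (kummer_majorized j k) _.
have q0 i : 0 <= (kummer_major j)`_i.
  exact: le_trans (cnorm1_ge0 _) (kummer_majorized j i).
rewrite (@horner_coef_wide _ (k.+1 + size (kummer_major j))) ?leq_addl //.
have kk : (k < k.+1 + size (kummer_major j))%N by rewrite ltn_addr.
rewrite (bigD1 (Ordinal kk)) //= expr1n mulr1 lerDl sumr_ge0 // => i _.
by rewrite expr1n mulr1.
Qed.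

End KummerPowerSeries.

(** * Uniqueness of power series coefficients *)

Section PowerSeriesUniqueness.
Context {R : realType}.

(** Strong induction on the degree: once the lower coefficients vanish, dividing by [a^m] bounds
    [d m] by a geometric tail of order [a], which tends to 0 with [a]. *)
Lemma power_series_eq0 (d : nat -> R[i]) (B : R) :
  (forall k, cnorm1 (d k) <= B) ->
  (forall a e : R, 0 < a < 1 -> 0 < e -> exists N, forall n, (N <= n)%N ->
     cnorm1 (\sum_(k < n) d k * a%:C ^+ k) < e) ->
  forall k, d k = 0.
Proof.
move=> dB dlim k; elim/ltn_ind: k => m IH.
have B0 : 0 <= B by apply: le_trans (cnorm1_ge0 (d 0%N)) (dB 0%N).
suff small a : 0 < a -> a <= 2^-1 -> cnorm1 (d m) <= 2 * B * a.
  apply: cnorm1_eq0; apply/le_anti; rewrite cnorm1_ge0 andbT.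
  apply/ler_addgt0Pr => e e0; rewrite add0r.
  pose a := Num.min 2^-1 (e / (2 * B + 1)).
  have B1 : 0 < 2 * B + 1 by lra.
  have a0 : 0 < a by rewrite lt_min invr_gt0 ltr0n divr_gt0.
  have a2 : a <= 2^-1 by rewrite ge_min lexx.
  apply: le_trans (small a a0 a2) _.
  have : a * (2 * B + 1) <= e by rewrite -ler_pdivlMr // ge_min lexx orbT.
  lra.
move=> a0 a2; apply/ler_addgt0Pr => e e0.
have a01 : 0 < a < 1 by rewrite a0 /=; lra.
have am0 : 0 < a ^+ m by exact: exprn_gt0.
have [N hN] := dlim a (e * a ^+ m) a01 (mulr_gt0 e0 am0).
pose n := (m.+1 + N)%N.
have := hN n (leq_addl _ _).
have -> : \sum_(k < n) d k * a%:C ^+ k =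
    d m * a%:C ^+ m + \sum_(i < N) d (m.+1 + i)%N * a%:C ^+ (m.+1 + i).
  rewrite /n big_split_ord /= big_ord_recr /= big1 ?add0r // => i _.
  by rewrite IH ?mul0r.
set T := \sum_(i < N) _ => h.
have hT : cnorm1 T <= 2 * B * a * a ^+ m.
  have geo (M : nat) : (1 - a) * \sum_(i < M) a ^+ i <= 1.
    have -> : (1 - a) * \sum_(i < M) a ^+ i = 1 - a ^+ M.
      elim: M => [|M IHM]; first by rewrite big_ord0 mulr0 expr0 subrr.
      by rewrite big_ord_recr /= mulrDr IHM exprS; ring.
    by rewrite gerBl exprn_ge0 // ltW.
  apply: le_trans (cnorm1_sum _ _) _.
  apply: (@le_trans _ _ (\sum_(i < N) B * a ^+ m.+1 * a ^+ i)).
    apply: ler_sum => i _; rewrite mulrC -rmorphXn cnorm1_scale exprD.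
    rewrite ger0_norm ?mulr_ge0 ?exprn_ge0 ?(ltW a0) // mulrC -mulrA.
    by rewrite ler_wpM2r // ?mulr_ge0 ?exprn_ge0 ?(ltW a0).
  rewrite -mulr_sumr; have := geo N; set G := \sum_(i < N) a ^+ i => hG.
  have G2 : G <= 2.
    have G0 : 0 <= G by apply: sumr_ge0 => i _; rewrite exprn_ge0 // ltW.
    nra.
  rewrite exprS (_ : 2 * B * a * a ^+ m = B * (a * a ^+ m) * 2); last by ring.
  by rewrite ler_wpM2l // !mulr_ge0 ?exprn_ge0 // ltW.
have hd : cnorm1 (d m * a%:C ^+ m) = a ^+ m * cnorm1 (d m).
  by rewrite mulrC -rmorphXn cnorm1_scale gtr0_norm.
have h2 : a ^+ m * cnorm1 (d m) <= (2 * B * a + e) * a ^+ m.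
  rewrite -hd -[X in cnorm1 X](addrK T); apply: le_trans (cnorm1D _ _) _.
  rewrite cnorm1N; apply: le_trans (lerD (ltW h) hT) _.
  by rewrite -mulrDl addrC.
by move: h2; rewrite mulrC ler_pM2r.
Qed.

End PowerSeriesUniqueness.

(** * Complex integrals and the expansion in logarithmic moments *)

Section ComplexIntegral.
Context {R : realType}.
Variables (nu : probability (measurableTypeR R) R) (K : set R).
Hypotheses (K_compact : compact K) (K_pos : K `<=` `]0, +oo[) (K_full : nu K = 1%E).
Implicit Types (f h : R -> R[i]) (z : R[i]).

Let D : set R := `]0, +oo[%classic.

Definition cbounded f : Prop :=
  [/\ measurable_fun D (fun x => complex.Re (f x)), measurable_fun D (fun x => complex.Im (f x)) &
      exists C : R, forall x, K x -> cnorm1 (f x) <= C].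

Let Re_le_cnorm1 z : `|complex.Re z| <= cnorm1 z. Proof. by rewrite lerDl. Qed.
Let Im_le_cnorm1 z : `|complex.Im z| <= cnorm1 z. Proof. by rewrite lerDr. Qed.

Lemma cbounded_integrable f : cbounded f -> cintegrable nu D f.
Proof.
case=> mr mi [C hC]; split.
- by apply: (nu_integrable K_compact K_pos K_full (C := C) mr) => x Kx; apply: le_trans (hC x Kx).
- by apply: (nu_integrable K_compact K_pos K_full (C := C) mi) => x Kx; apply: le_trans (hC x Kx).
Qed.

Lemma cbounded_linear z f h : cbounded f -> cbounded h -> cbounded (fun x => z * f x + h x).
Proof.
case=> mr mi [C hC] [mr' mi' [C' hC']].
have mM (r : R) (u : R -> R) : measurable_fun D u -> measurable_fun D (fun x => r * u x).
  by move=> mu; apply: measurable_funM => //; exact: measurable_cst.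
split.
- rewrite (_ : (fun x => _) = (fun x => (complex.Re z * complex.Re (f x) -
    complex.Im z * complex.Im (f x)) + complex.Re (h x))).
    by apply: measurable_funD => //; apply: measurable_funB; exact: mM.
  by apply/funext => x; case: z (f x) (h x) => [a b] [u v] [u' v'].
- rewrite (_ : (fun x => _) = (fun x => (complex.Re z * complex.Im (f x) +
    complex.Im z * complex.Re (f x)) + complex.Im (h x))).
    by apply: measurable_funD => //; apply: measurable_funD; exact: mM.
  by apply/funext => x; case: z (f x) (h x) => [a b] [u v] [u' v'].
- exists (cnorm1 z * C + C') => x Kx; apply: le_trans (cnorm1D _ _) _.
  rewrite lerD ?hC' // (le_trans (cnorm1M _ _)) // ler_wpM2l ?hC //; exact: cnorm1_ge0.
Qed.

Lemma cintegral_linear z f h : cbounded f -> cbounded h ->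
  cintegral nu D (fun x => z * f x + h x) = z * cintegral nu D f + cintegral nu D h.
Proof.
move=> /cbounded_integrable[ir ii] /cbounded_integrable[jr ji].
pose T := measurableTypeR R.
have mD := D_measurable (R := R).
have iM (r : R) (u : R -> R) : nu.-integrable D (EFin \o u) ->
    nu.-integrable D (EFin \o (fun x => r * u x)).
  by move=> iu; apply: (@integrableZl _ T R nu D mD r _ iu).
have IM (r : R) (u : R -> R) : nu.-integrable D (EFin \o u) ->
    \int[nu]_(x in D) (r * u x) = r * \int[nu]_(x in D) u x.
  by move=> iu; rewrite RintegralZl.
case: z => a b; rewrite /cintegral; apply/eqP; rewrite eq_complex /=; apply/andP; split; apply/eqP.
- rewrite (_ : Rintegral _ _ _ = \int[nu]_(x in D)
    ((a * complex.Re (f x) - b * complex.Im (f x)) + complex.Re (h x))); last first.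
    by apply: eq_Rintegral => x _; case: (f x) (h x) => [u v] [u' v'].
  rewrite RintegralD //; last exact: (@integrableB _ T R nu D mD _ _ (iM a _ ir) (iM b _ ii)).
  by rewrite RintegralB ?IM //; exact: iM.
- rewrite (_ : Rintegral _ _ _ = \int[nu]_(x in D)
    ((a * complex.Im (f x) + b * complex.Re (f x)) + complex.Im (h x))); last first.
    by apply: eq_Rintegral => x _; case: (f x) (h x) => [u v] [u' v'].
  rewrite RintegralD //; last exact: (@integrableD _ T R nu D mD _ _ (iM a _ ii) (iM b _ ir)).
  by rewrite RintegralD ?IM //; exact: iM.
Qed.

Lemma cbounded0 : cbounded (fun=> 0).
Proof.
split; try exact: measurable_cst.
by exists 0 => x _; rewrite /cnorm1 /= normr0 addr0.
Qed.

Lemma cintegral0 : cintegral nu D (fun=> 0) = 0.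
Proof.
have := cintegral_linear (-1) cbounded0 cbounded0; rewrite mulr0 addr0 mulN1r addNr.
exact.
Qed.

Lemma cbounded_sum n (w : nat -> R[i]) (F : nat -> R -> R[i]) :
  (forall k, cbounded (F k)) -> cbounded (fun x => \sum_(k < n) w k * F k x) /\
  cintegral nu D (fun x => \sum_(k < n) w k * F k x) = \sum_(k < n) w k * cintegral nu D (F k).
Proof.
move=> bF; elim: n => [|n [IHb IHi]].
  rewrite (_ : (fun x => _) = fun=> 0); last by apply/funext => x; rewrite big_ord0.
  by rewrite big_ord0 cintegral0; split => //; exact: cbounded0.
rewrite (_ : (fun x => _) = (fun x => w n * F n x + \sum_(k < n) w k * F k x)); last first.
  by apply/funext => x; rewrite big_ord_recr addrC.
by rewrite cintegral_linear // IHi big_ord_recr addrC; split => //; exact: cbounded_linear.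
Qed.

Lemma cintegral_dist f h (e : R) : cbounded f -> cbounded h ->
  (forall x, K x -> cnorm1 (f x - h x) <= e) ->
  cnorm1 (cintegral nu D f - cintegral nu D h) <= 2 * e.
Proof.
move=> [mr mi [C hC]] [mr' mi' _] he; rewrite /cnorm1 /cintegral /= mulr2n mulrDl mul1r.
apply: lerD.
- apply: (nu_integralB_le K_compact K_pos K_full (C := C)) => // x Kx.
    exact: le_trans (hC x Kx).
  apply: le_trans (he x Kx); apply: le_trans (Re_le_cnorm1 _).
  by case: (f x) (h x) => [u v] [u' v'].
- apply: (nu_integralB_le K_compact K_pos K_full (C := C)) => // x Kx.
    exact: le_trans (hC x Kx).
  apply: le_trans (he x Kx); apply: le_trans (Im_le_cnorm1 _).
  by case: (f x) (h x) => [u v] [u' v'].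
Qed.

Variable b : R.

(** Centring the logarithm by [b], later [t / 2], absorbs the factor [exp (a t / 2)]. *)
Let y (x : R) : R := ln x - b.

Let y_continuous x : 0 < x -> {for x, continuous y}.
Proof. by move=> x0; apply: cvgB; [exact: continuous_ln|exact: cvg_cst]. Qed.

Let y_bounded : exists2 L : R, 0 <= L & forall x, K x -> `|y x| <= L.
Proof.
have [m [L [m0 m1 L1 hK]]] := K_bounds K_compact K_pos K_full.
exists (`|ln m| + `|ln L| + `|b|) => [|x Kx]; first by rewrite !addr_ge0.
have /andP[mx xL] := hK x Kx; have x0 := lt_le_trans m0 mx.
apply: le_trans (ler_normB _ _) _; rewrite lerD2r.
have l1 : ln m <= ln x by rewrite ler_ln ?posrE.
have l2 : ln x <= ln L by rewrite ler_ln ?posrE //; exact: lt_le_trans xL.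
have := ler_norm (ln L); have := ler_norm (- ln m); rewrite normrN => h1 h2.
have := normr_ge0 (ln L); have := normr_ge0 (ln m) => h3 h4.
by rewrite ler_norml; apply/andP; split; lra.
Qed.

Lemma cbounded_cexp z : cbounded (fun x => cexp (z * (y x)%:C)).
Proof.
have lin (r x : R) : 0 < x -> {for x, continuous (fun x => r * y x)}.
  by move=> x0; apply: cvgMl_tmp; exact: y_continuous.
have [L L0 hL] := y_bounded.
split.
- rewrite (_ : (fun x => _) = (fun x => expR (complex.Re z * y x) * cos (complex.Im z * y x))).
    apply: measurable_fun_pos => x x0; apply: cvgM.
      by apply: continuous_comp; [exact: lin|exact: continuous_expR].
    by apply: continuous_comp; [exact: lin|exact: continuous_cos].
  apply/funext => x; case: z => u v; rewrite /cexp /= !mulr0 mul0r !subr0 add0r.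
  by [].
- rewrite (_ : (fun x => _) = (fun x => expR (complex.Re z * y x) * sin (complex.Im z * y x))).
    apply: measurable_fun_pos => x x0; apply: cvgM.
      by apply: continuous_comp; [exact: lin|exact: continuous_expR].
    by apply: continuous_comp; [exact: lin|exact: continuous_sin].
  apply/funext => x; case: z => u v; rewrite /cexp /= !mulr0 mul0r !subr0 add0r addr0.
  by [].
- exists (2 * expR (cnorm1 z * L)) => x Kx; apply: le_trans (cnorm1_cexp _) _.
  rewrite ler_wpM2l // ler_expR (le_trans (ler_norm _)) //.
  apply: le_trans (Re_le_cnorm1 _) _; apply: le_trans (cnorm1M _ _) _.
  by rewrite cnorm1_real ler_wpM2l ?hL //; exact: cnorm1_ge0.
Qed.

Definition log_moment (k : nat) : R := \int[nu]_(x in D) (y x ^+ k).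

Let cbounded_pow k : cbounded (fun x => (y x ^+ k)%:C).
Proof.
have [L L0 hL] := y_bounded.
split => /=; last 2 first.
- exact: measurable_cst.
- exists (L ^+ k) => x Kx; rewrite cnorm1_real normrX lerXn2r ?nnegrE //; exact: hL.
apply: measurable_fun_pos => x x0.
apply: (@continuous_comp _ _ _ y (fun u => u ^+ k)); first exact: y_continuous.
exact: exprn_continuous.
Qed.

Lemma log_moment_bound : exists B : R, forall k, `|log_moment k / k`!%:R| <= B.
Proof.
have [L L0 hL] := y_bounded; exists (expR L) => k.
have [mr _ _] := cbounded_pow k.
have mk : `|log_moment k| <= L ^+ k.
  apply: (nu_integral_le K_compact K_pos K_full mr) => x Kx /=.
  by rewrite normrX lerXn2r ?nnegrE //; exact: hL.
rewrite normrM normfV normr_nat.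
apply: (@le_trans _ _ (L ^+ k / k`!%:R)); first by rewrite ler_wpM2r ?invr_ge0.
apply: le_trans (sum_exp_coeff_le k.+1 L0).
rewrite big_ord_recr /= lerDr sumr_ge0 // => i _.
by rewrite divr_ge0 // exprn_ge0.
Qed.

(** The logarithm is bounded on [K], so the Taylor expansion is uniform there and may be integrated
    termwise. *)
Lemma cintegral_cexp_series z (e : R) : 0 < e -> exists N, forall n, (N <= n)%N ->
  cnorm1 (cintegral nu D (fun x => cexp (z * (y x)%:C)) -
    \sum_(k < n) (log_moment k / k`!%:R)%:C * z ^+ k) < e.
Proof.
move=> e0; have [L L0 hL] := y_bounded.
have Y0 : 0 <= cnorm1 z * L by rewrite mulr_ge0 ?cnorm1_ge0.
have e2 : 0 < e / 2 by rewrite divr_gt0.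
have [N hN] := cexp_err_small Y0 e2.
exists N.+1 => -[//|n] Nn; have {}hN := hN n Nn.
have [bs is_] := @cbounded_sum n.+1 (fun k => z ^+ k / k`!%:R) _ cbounded_pow.
rewrite (_ : \sum_(k < n.+1) _ = \sum_(k < n.+1) (z ^+ k / k`!%:R) *
    cintegral nu D (fun x => (y x ^+ k)%:C)); last first.
  apply: eq_bigr => k _.
  have -> : cintegral nu D (fun x => (y x ^+ k)%:C) = (log_moment k)%:C.
    rewrite /cintegral /= /log_moment; congr (_ +i* _).
    by rewrite /Rintegral integral0_eq.
  by rewrite rmorphM fmorphV rmorph_nat mulrC [in RHS]mulrAC mulrA.
rewrite -is_; apply: le_lt_trans (cintegral_dist (cbounded_cexp z) bs _) _; last first.
  by rewrite -ltr_pdivlMl // mulrC; exact: hN.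
move=> x Kx /=.
have zy : cnorm1 (z * (y x)%:C) <= cnorm1 z * L.
  apply: le_trans (cnorm1M _ _) _.
  by rewrite cnorm1_real ler_wpM2l ?hL //; exact: cnorm1_ge0.
apply: le_trans (cexp_taylor n zy); rewrite le_eqVlt; apply/orP; left; apply/eqP.
congr (cnorm1 (_ - _)); apply: eq_bigr => k _.
by rewrite exprMn rmorphXn mulrAC.
Qed.

End ComplexIntegral.

(** * Convergence and the binomial form of the series *)

Section KummerSeries.
Context {R : realType}.
Implicit Types (z : R[i]) (u : nat -> R[i]).

Lemma csum_cvg u z : (forall e : R, 0 < e -> exists N, forall n, (N <= n)%N ->
    cnorm1 (z - \sum_(j < n) u j) < e) -> csummable u /\ csum u = z.
Proof.
move=> h; have cv : series (u : nat -> R[i]^o) @ \oo --> (z : R[i]^o).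
  (* A positive tolerance in [R[i]] has zero imaginary part, so it reduces to a positive real. *)
  apply/cvgrPdist_lt => e; case: e => er ei; rewrite ltcE /= => /andP[/eqP -> er0].
  have [N hN] := h er er0; near=> n.
  rewrite /series /= big_mkord; apply: le_lt_trans (normc_le_cnorm1 _) _.
  by rewrite ltcR; apply: hN; near: n; exact: nbhs_infty_ge.
split; first by apply/cvg_ex; exists z.
exact: (cvg_lim (@norm_hausdorff _ _) cv).
Unshelve. all: by end_near. Qed.

Lemma kummer_termE z (t : R) j :
  kummer_term (1 - z) 2 (- (z * t%:C)) j = (kummer_poly t j).[z].
Proof.
rewrite kummer_polyE /kummer_term /rising_factorial; congr (_ * _).
rewrite -prodf_div; apply: eq_bigr => i _.
by rewrite addrAC -[1]/(1%:R) -[2]/(2%:R) -!natrD add1n add2n.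
Qed.

(** Splitting the factor [z] off the binomial coefficient leaves [(-1)^j] times the product of the
    [i + 1 - z]; that sign turns [z t] into [- z t]. In this multiplied form the identity holds for
    [z = 0] too. *)
Lemma generalized_binomial_kummer z (t : R) j :
  generalized_binomial z (1 + j) * ((z * t%:C) ^+ j / j`!%:R) = z * (kummer_poly t j).[z].
Proof.
rewrite kummer_polyE [(- _) ^+ _]exprNn /generalized_binomial add1n big_ord_recl subr0.
have -> : \prod_(i < j) (z - (bump 0 i)%:R) = (-1) ^+ j * \prod_(i < j) (i.+1%:R - z).
  rewrite -[X in (-1) ^+ X]card_ord -prodrN; apply: eq_bigr => i _.
  by rewrite opprB.
have -> : \prod_(i < j) ((i.+1%:R - z) / i.+2%:R) = (j.+1)`!%:R^-1 * \prod_(i < j) (i.+1%:R - z).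
  elim: j => [|j IH]; first by rewrite !big_ord0 (_ : 1`! = 1%N) // invr1 mulr1.
  by rewrite !big_ord_recr /= IH [in RHS]factS natrM invfM; ring.
by ring.
Qed.

End KummerSeries.

(** * Extension to complex exponents *)

Section PowerMoments.
Context {R : realType}.
Variables (nu : probability (measurableTypeR R) R) (K : set R).
Hypotheses (K_compact : compact K) (K_pos : K `<=` `]0, +oo[) (K_full : nu K = 1%E).
Variables (t : R).
Hypothesis functional_eq : forall s, 0 < s < 1 ->
  1 - pinv t s * \int[nu]_(x in `]0, +oo[) (pinv t s + x)^-1 = s.

Let D : set R := `]0, +oo[%classic.
Let G (z : R[i]) : R[i] := cintegral nu D (fun x => cexp (z * (ln x - t / 2)%:C)).
Let m (k : nat) : R[i] := (log_moment nu (t / 2) k / k`!%:R)%:C.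

Let G_series z (e : R) : 0 < e -> exists N, forall n, (N <= n)%N ->
  cnorm1 (G z - \sum_(k < n) m k * z ^+ k) < e.
Proof. exact: (cintegral_cexp_series K_compact K_pos K_full (t / 2) z). Qed.

(** The trailing 0 gives the integrand the shape expected by [cintegral_linear]. *)
Let cpowE z x : cpow x z = cexp (z * t%:C / 2) * cexp (z * (ln x - t / 2)%:C) + 0.
Proof.
rewrite addr0 -cexpD /cpow; congr cexp.
by rewrite rmorphB rmorphM fmorphV rmorph_nat; field.
Qed.

Lemma cintegrable_cpow z : cintegrable nu D (fun x => cpow x z).
Proof.
rewrite (_ : (fun x => _) = fun x => cexp (z * t%:C / 2) * cexp (z * (ln x - t / 2)%:C) + 0).
  apply: (cbounded_integrable K_compact K_pos K_full); apply: cbounded_linear.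
    exact: (cbounded_cexp K_compact K_pos K_full).
  exact: cbounded0.
by apply/funext => x; exact: cpowE.
Qed.

Let cintegral_cpow z : cintegral nu D (fun x => cpow x z) = cexp (z * t%:C / 2) * G z.
Proof.
rewrite (_ : (fun x => _) = fun x => cexp (z * t%:C / 2) * cexp (z * (ln x - t / 2)%:C) + 0).
  rewrite (cintegral_linear K_compact K_pos K_full); last 2 first.
  - exact: (cbounded_cexp K_compact K_pos K_full).
  - exact: cbounded0.
  by rewrite (cintegral0 K_compact K_pos K_full) addr0.
by apply/funext => x; exact: cpowE.
Qed.

Let G_real (a : R) : G a%:C =
  ((\int[nu]_(x in D) expR (a * ln x)) * expR (- (a * t / 2)))%:C.
Proof.
have cexpR (r : R) : cexp r%:C = (expR r)%:C.
  by rewrite /cexp /= cos0 sin0 mulr1.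
have h := cintegral_cpow a%:C.
have e1 : cintegral nu D (fun x => cpow x a%:C) = (\int[nu]_(x in D) expR (a * ln x))%:C.
  rewrite /cintegral; congr (_ +i* _).
    by apply: eq_Rintegral => x _; rewrite /cpow -rmorphM cexpR.
  rewrite /Rintegral integral0_eq // => x _.
  by rewrite /cpow -rmorphM cexpR.
have e2 : cexp (a%:C * t%:C / 2) = (expR (a * t / 2))%:C.
  by rewrite -rmorphM -(rmorph_nat (real_complex R)) -fmorphV -rmorphM cexpR.
rewrite rmorphM /= -e1 h e2 mulrC mulrA -rmorphM /= -expRD addNr expR0 mul1r.
by [].
Qed.

Let pow2_small (C e : R) : 0 < e -> exists N, forall n, (N <= n)%N -> 2 ^- n * C < e.
Proof.
move=> e0; have h0 : 0 <= 2^-1 :> R by rewrite invr_ge0.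
have h1 : 2^-1 < 1 :> R by lra.
have [N hN] := geometric_small C h0 h1 e0; exists N => n Nn.
by have := hN n Nn; rewrite exprVn mulrC.
Qed.

(** For [0 < a < 1] both power series converge to [G a]: one by expanding the exponential, the other
    by the real moment formula and rearrangement. Uniqueness then identifies the coefficients. *)
Let m_kummer k : m k = kummer_coef t k.
Proof.
apply/eqP; rewrite -subr_eq0; apply/eqP; move: k.
have [B hB] := log_moment_bound K_compact K_pos K_full (t / 2).
apply: (@power_series_eq0 _ (fun k => m k - kummer_coef t k) (B + expR (kummer_growth t 1))).
  move=> k; apply: le_trans (cnorm1D _ _) _; rewrite cnorm1N.
  by apply: lerD; [rewrite cnorm1_real; exact: hB|exact: kummer_coef_bound].
move=> a e a01 e0.
have e3 : 0 < e / 3 by rewrite divr_gt0.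
have [N1 h1] := G_series a%:C e3.
have [N2 h2] := power_moment_kummer K_compact K_pos K_full functional_eq a01 e3.
have [N3 h3] := pow2_small (expR (kummer_growth t (2 * `|a|))) e3.
exists (N1 + N2 + N3)%N => n Nn.
have {}h1 := h1 n (leq_trans (leq_trans (leq_addr N2 N1) (leq_addr N3 _)) Nn).
have {}h2 := h2 n (leq_trans (leq_trans (leq_addl N1 N2) (leq_addr N3 _)) Nn).
have {}h3 := h3 n (leq_trans (leq_addl _ N3) Nn).
have h4 : cnorm1 (a%:C : R[i]) <= `|a| by rewrite cnorm1_real.
have {}h4 := le_lt_trans (kummer_rearrange t n h4) h3.
have {}h2 : cnorm1 (G a%:C - \sum_(j < n) (kummer_poly t j).[a%:C]) < e / 3.
  rewrite G_real; apply: le_lt_trans h2; rewrite -cnorm1_real.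
  rewrite rmorphB rmorph_sum; rewrite le_eqVlt; apply/orP; left; apply/eqP.
  congr (cnorm1 (_ - _)); apply: eq_bigr => j _.
  rewrite kummer_polyE rmorphM rmorph_prod; congr (_ * _).
    apply: eq_bigr => i _.
    by rewrite rmorphM fmorphV rmorphB !rmorph_nat.
  by rewrite rmorphM fmorphV rmorph_nat rmorphXn rmorphN rmorphM.
under eq_bigr => k _ do rewrite mulrBl.
rewrite sumrB; move: h1 h2 h4.
set S1 := \sum_(k < n) m k * _; set S2 := \sum_(j < n) _; set S3 := \sum_(k < n) _.
clearbody S1 S2 S3 => h1 h2 h4.
have -> : S1 - S3 = - (G a%:C - S1) + (G a%:C - S2) + (S2 - S3) by ring.
apply: le_lt_trans (cnorm1D _ _) _.
have := cnorm1D (- (G a%:C - S1)) (G a%:C - S2); rewrite cnorm1N.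
lra.
Qed.

Let kummer_series z (e : R) : 0 < e -> exists N, forall n, (N <= n)%N ->
  cnorm1 (G z - \sum_(j < n) (kummer_poly t j).[z]) < e.
Proof.
move=> e0; have e2 : 0 < e / 2 by rewrite divr_gt0.
have [N1 h1] := G_series z e2.
have [N3 h3] := pow2_small (expR (kummer_growth t (2 * cnorm1 z))) e2.
exists (N1 + N3)%N => n Nn.
have {}h1 := h1 n (leq_trans (leq_addr _ _) Nn).
have {}h3 := h3 n (leq_trans (leq_addl _ _) Nn).
have h4 := le_lt_trans (kummer_rearrange t n (lexx (cnorm1 z))) h3.
move: h1; under eq_bigr => k _ do rewrite m_kummer.
move: h4; set S2 := \sum_(j < n) _; set S3 := \sum_(k < n) _.
clearbody S2 S3 => h4 h1.
have -> : G z - S2 = (G z - S3) - (S2 - S3) by ring.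
apply: le_lt_trans (cnorm1D _ _) _; rewrite cnorm1N.
lra.
Qed.

Theorem power_moments z :
  [/\ csummable (kummer_term (1 - z) 2 (- (z * t%:C))),
      csummable (fun j : nat => generalized_binomial z (1 + j) * ((z * t%:C) ^+ j / j`!%:R)),
      cintegral nu `]0, +oo[ (fun x => cpow x z) =
        cexp (z * t%:C / 2) * kummer_1F1 (1 - z) 2 (- (z * t%:C)) &
      csum (fun j : nat => generalized_binomial z (1 + j) * ((z * t%:C) ^+ j / j`!%:R)) =
        z * kummer_1F1 (1 - z) 2 (- (z * t%:C))].
Proof.
have [k1 k2] : csummable (kummer_term (1 - z) 2 (- (z * t%:C))) /\
    csum (kummer_term (1 - z) 2 (- (z * t%:C))) = G z.
  apply: csum_cvg => e e0; have [N hN] := kummer_series z e0; exists N => n Nn.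
  by under eq_bigr => j _ do rewrite kummer_termE; exact: hN.
have [b1 b2] : csummable (fun j : nat =>
      generalized_binomial z (1 + j) * ((z * t%:C) ^+ j / j`!%:R)) /\
    csum (fun j : nat => generalized_binomial z (1 + j) * ((z * t%:C) ^+ j / j`!%:R)) = z * G z.
  apply: csum_cvg => e e0.
  have z1 : 0 < cnorm1 z + 1 by have := cnorm1_ge0 z; lra.
  have [N hN] := kummer_series z (divr_gt0 e0 z1); exists N => n Nn.
  under eq_bigr => j _ do rewrite generalized_binomial_kummer.
  rewrite -mulr_sumr -mulrBr; apply: le_lt_trans (cnorm1M _ _) _.
  have := hN n Nn; rewrite ltr_pdivlMr //.
  have := cnorm1_ge0 (G z - \sum_(j < n) (kummer_poly t j).[z]).
  by set w := cnorm1 (G z - _); have := cnorm1_ge0 z; clearbody w; nra.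
by split => //; rewrite /kummer_1F1 k2 //; exact: cintegral_cpow.
Qed.

End PowerMoments.

Theorem corollary1p3 (R : realType) (A : wstar_probability_space R)
    (Ft : R -> set A) (c g : R -> A)
    (Ft_filtration : filtration Ft)
    (c_circular : circular_brownian_motion Ft c)
    (g_solution : free_multiplicative_brownian_motion Ft c g)
    (t : R) (t_gt0 : 0 < t)
    (nu : probability (measurableTypeR R) R)
    (nu_spectral : spectral_distribution
       (free_positive_multiplicative_brownian_motion g t) nu)
    (alpha : R[i]) (alpha_neq0 : alpha <> 0) :
  [/\ cintegrable nu `]0, +oo[ (fun x => cpow x alpha),
      csummable (kummer_term (1 - alpha) 2 (- (alpha * t%:C))),
      csummable (fun j : nat =>
        generalized_binomial alpha (1 + j) * ((alpha * t%:C) ^+ j / j`!%:R)),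
      cintegral nu `]0, +oo[ (fun x => cpow x alpha) =
        cexp (alpha * t%:C / 2) * kummer_1F1 (1 - alpha) 2 (- (alpha * t%:C)) &
      cexp (alpha * t%:C / 2) * kummer_1F1 (1 - alpha) 2 (- (alpha * t%:C)) =
        cexp (alpha * t%:C / 2) * (alpha^-1 *
          csum (fun j : nat =>
            generalized_binomial alpha (1 + j) *
              ((alpha * t%:C) ^+ j / j`!%:R)))].
Proof.
case: nu_spectral => -[K [K_compact K_pos K_full]] moments.
(* The process is evaluated at time [t / 2], which is the time carried by the exponential in
   [pinv t]. *)
have u0 : 0 <= t / 2 by rewrite divr_ge0 // ltW.
have functional_eq s : 0 < s < 1 ->
    1 - pinv t s * \int[nu]_(x in `]0, +oo[) (pinv t s + x)^-1 = s.
  move=> s01.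
  have p0 : 0 < pinv t s by rewrite mulr_gt0 ?odds_gt0 ?expR_gt0.
  have [_ hr _] := resolvP Ft_filtration g_solution p0 u0.
  rewrite (nu_stieltjes K_compact K_pos K_full p0 _ hr); last first.
    by move=> n; rewrite /rtr -(moments n).
  by have := resolvent_characteristic Ft_filtration c_circular g_solution s01 u0; rewrite /pinv /odds.
have [h1 h2 h3 h4] := power_moments K_compact K_pos K_full functional_eq alpha.
split.
- exact: (cintegrable_cpow K_compact K_pos K_full t).
- exact: h1.
- exact: h2.
- exact: h3.
- by rewrite h4 (mulKf (introN eqP alpha_neq0)).
Qed.
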